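(* Let $K$ be a field of characteristic $0$, let $n\ge 1$, and let ${\cal F}_q[{\rm Mat}_n]$ be the quantized coordinate algebra described in the context, with ${\cal L}$ the $K[q]$-lattice spanned by all quantum bitableaux. Let $w=i_1\cdots i_k$ and $u=j_1\cdots j_k$ be two words of the same length $k$ on the alphabet $\{1,\ldots,n\}$, and let $(P(w),Q(w))$ and $(P(u),Q(u))$ be their images under the Robinson–Schensted correspondence. Then $$ t_{i_1j_1}t_{i_2j_2}\cdots t_{i_kj_k}\equiv\begin{cases}(P(w)\,|\,P(u)) \pmod{q{\cal L}} & \text{if } Q(w)=Q(u),\\ 0 \pmod{q{\cal L}} & \text{otherwise,}\end{cases} $$ where $x\equiv y \pmod{q{\cal L}}$ means $x-y\in q{\cal L}$.
   Context: ${\cal F}_q[{\rm Mat}_n]$ is the associative algebra over $K(q)$ generated by $t_{ij}$, $1\le i,j\le n$, subject to: for $1\le i<j\le n$ and $1\le k<l\le n$, $t_{ik}t_{il}=q^{-1}t_{il}t_{ik}$, $t_{ik}t_{jk}=q^{-1}t_{jk}t_{ik}$, $t_{il}t_{jk}=t_{jk}t_{il}$, and $t_{ik}t_{jl}-t_{jl}t_{ik}=(q^{-1}-q)t_{il}t_{jk}$. For sequences $I=(i_1,\ldots,i_m)$, $J=(j_1,\ldots,j_m)$ the quantum minor is $\det_q T_{IJ}=\sum_{w\in S_m}(-q)^{-\ell(w)}t_{i_1j_{w_1}}\cdots t_{i_mj_{w_m}}$, where $\ell(w)$ is the number of inversions. Young tableaux are in French convention: entries in $\{1,\ldots,n\}$,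 rows weakly increasing from left to right, columns strictly increasing from bottom to top. For two Young tableaux $\tau,\tau'$ of the same shape with columns $c_1,\ldots,c_r$ and $c'_1,\ldots,c'_r$ (left to right), the quantum bitableau $(\tau\,|\,\tau')$ is the ordered product $\prod_{s=1}^r\det_q T_{c_s c'_s}$ (left to right), where a column is read as the increasing sequence of its entries. The quantum bitableaux form a $K(q)$-basis of ${\cal F}_q[{\rm Mat}_n]$, and ${\cal L}$ denotes the $K[q]$-submodule they span. The Robinson–Schensted correspondence sends a word $w$ to the pair $(P(w),Q(w))$ of its (row-)insertion tableau $P(w)$ (a Young tableau) and its recording tableau $Q(w)$ (a standard Young tableau of the same shape).
   Formalization: The relation t_ik t_il = q^{-1} t_il t_ik is imposed for every row i (k<l) and t_ik t_jk = q^{-1} t_jk t_ik for every column k (i<j), including i=n and k=n, which the literal range ''i<j and k<l'' leaves out and without which the claim fails. *)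

(* Defs.v *)
From HB Require Import structures.
From mathcomp Require Import all_boot all_order all_algebra all_fingroup.
Set Implicit Arguments. Unset Strict Implicit. Unset Printing Implicit Defensive.
Import GRing.Theory.
Local Open Scope ring_scope.

Section QMat.
Variable K : fieldType.
Variable n : nat.

Definition Kq := {fraction {poly K}}.
Definition qv : Kq := FracField.tofrac 'X.
Definition polyq (p : {poly K}) : Kq := FracField.tofrac p.

Definition qmat_rel (A : algType Kq) (t : 'I_n -> 'I_n -> A) : Prop :=
  [/\ (forall i k l : 'I_n, (k < l)%N -> t i k * t i l = qv^-1 *: (t i l * t i k)),
      (forall i j k : 'I_n, (i < j)%N -> t i k * t j k = qv^-1 *: (t j k * t i k)),
      (forall i j k l : 'I_n, (i < j)%N -> (k < l)%N -> t i l * t j k = t j k * t i l)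
    & (forall i j k l : 'I_n, (i < j)%N -> (k < l)%N ->
         t i k * t j l - t j l * t i k = (qv^-1 - qv) *: (t i l * t j k))].

Definition inv_count m (s : 'S_m) : nat :=
  #|[set ij : 'I_m * 'I_m | (ij.1 < ij.2)%N && (s ij.2 < s ij.1)%N]|.

Definition qdet (A : algType Kq) (t : 'I_n -> 'I_n -> A) (I J : seq 'I_n) : A :=
  \sum_(s : 'S_(size I))
     ((- qv)^-1) ^+ inv_count s *:
       \prod_(k < size I) t (tnth (in_tuple I) k) (nth (tnth (in_tuple I) k) J (s k)).

(* Tableaux in French convention: a list of rows, row 0 at the bottom. *)
Definition tableau := seq (seq 'I_n).

Definition row_below (r1 r2 : seq 'I_n) : bool :=
  (size r2 <= size r1)%N && all (fun p : 'I_n * 'I_n => (p.1 < p.2)%N) (zip r1 r2).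

Definition is_tab (T : tableau) : bool :=
  all (fun r => (r != [::]) && sorted (fun x y : 'I_n => (x <= y)%N) r) T
  && sorted row_below T.

Definition shape {X} (T : seq (seq X)) : seq nat := map size T.

(* s-th column (0-indexed, from the left), read from bottom to top. *)
Definition column (T : tableau) (s : nat) : seq 'I_n := pmap (fun r => onth r s) T.

Definition bitab (A : algType Kq) (t : 'I_n -> 'I_n -> A) (T T' : tableau) : A :=
  \prod_(s < size (head [::] T)) qdet t (column T s) (column T' s).

(* Schensted row insertion; returns the new tableau and the row of the new cell. *)
Fixpoint ins (x : 'I_n) (T : tableau) : tableau * nat :=
  match T with
  | [::] => ([:: [:: x]], 0%N)
  | r :: T' =>
      let i := find (fun y : 'I_n => (x < y)%N) r in
      if (i < size r)%N then
        let: (T2, k) := ins (nth x r i) T' in (set_nth x r i x :: T2, k.+1)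
      else (rcons r x :: T', 0%N)
  end.

Definition add_cell (Q : seq (seq nat)) (k m : nat) : seq (seq nat) :=
  if (k < size Q)%N then set_nth [::] Q k (rcons (nth [::] Q k) m)
  else rcons Q [:: m].

Definition RS_step (st : tableau * seq (seq nat) * nat) (x : 'I_n) :=
  let: (P, Q, m) := st in
  let: (P', k) := ins x P in (P', add_cell Q k m.+1, m.+1).

Definition RS (w : seq 'I_n) : tableau * seq (seq nat) :=
  let: (P, Q, _) := foldl RS_step ([::], [::], 0%N) w in (P, Q).

(* An element of F_q[Mat_n], given as a term built uniformly from the generators. *)
Definition qelem := forall (A : algType Kq), ('I_n -> 'I_n -> A) -> A.

(* z lies in q L: z = sum of q * c * bitableaux, c in K[q], in the algebra
   generated by the t_ij subject to the relations (equivalently: in every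
   K(q)-algebra with elements satisfying them). *)
Definition in_qL (z : qelem) : Prop :=
  exists s : seq (tableau * tableau * {poly K}),
    all (fun e => [&& is_tab e.1.1, is_tab e.1.2 & shape e.1.1 == shape e.1.2]) s /\
    forall (A : algType Kq) (t : 'I_n -> 'I_n -> A), qmat_rel t ->
      z A t = \sum_(e <- s) ((qv * polyq e.2) *: bitab t e.1.1 e.1.2).

Definition congr_qL (x y : qelem) : Prop := in_qL (fun A t => x A t - y A t).

Definition qmonomial (A : algType Kq) (t : 'I_n -> 'I_n -> A) (w u : seq 'I_n) : A :=
  \prod_(p <- zip w u) t p.1 p.2.

End QMat.

(* Main.v *)
(* Let M be the K[q]-span of all monomials t_{w,u}; it contains the lattice L spanned
   by the bitableaux.

   Modulo qM, a monomial vanishes as soon as w has a descent where u has none, and it is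
   unchanged by a Knuth move performed on w and u at the same three positions: the
   defining relations say that the Hecke algebra acts in the same way on the row word w
   and on the column word u, and the move is read off from c_2 c_1 with c_i = q - T_i.
   Row insertion is a sequence of such moves at positions determined by the recording
   tableau only, so t_{w,u} is congruent modulo qM to the monomial of the row reading
   words of P(w) and P(u) if Q(w) = Q(u), and to 0 otherwise. Moving the columns out of
   the row reading words by Knuth moves shows that this monomial is congruent to the
   bitableau, because a quantum minor is congruent to its antidiagonal monomial.

   This gives M = L + qM, hence M = L + q^N M for every N. Quantum straightening over
   K[q, 1/q] (Garnir relations on the first two columns, together with the braiding that
   moves a generator past a minor) gives q^N M in L for large N in each degree, so M = L
   and the congruences hold modulo qL. *)

(* The Knuth congruence comes from a mixed monomial: its row word is not yet moved, its column word
   is already moved. The relations turn c_2 c_1 on the row word into c_1 c_2 on the column word.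
   After multiplication by q, the first expression is, modulo qM, minus the monomial with both words
   moved, and the second is minus the monomial with neither moved. The factor q cancels the single
   q^-1 that a descent produces.

   The lattice M is closed under products by construction, so local congruences can be multiplied by
   monomials on both sides; for L this is not visible in advance. Straightening only works over
   K[q, 1/q], because inverting the T_i and sorting the rows of a minor both cost powers of q^-1.
   One bound N for these denominators serves a whole degree, since a degree contains finitely many
   monomials. *)
Require Import Defs.
From HB Require Import structures.
From mathcomp Require Import all_boot all_order all_algebra all_fingroup.
From mathcomp Require Import ring zify.
Set Implicit Arguments. Unset Strict Implicit. Unset Printing Implicit Defensive.
Import GRing.Theory.
Local Open Scope ring_scope.

(** * The lattice of monomials *)

Section Lattice.
Variables (K : fieldType) (n : nat).
Local Notation q := (qv K).
Local Notation elt := (qelem K n).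

Lemma qv_neq0 : q != 0.
Proof. by rewrite tofrac_eq0 polyX_eq0. Qed.

Definition is_poly (c : Kq K) := exists p, c = polyq p.
Definition is_laurent (c : Kq K) := exists m, is_poly (q ^+ m * c).

Lemma is_poly0 : is_poly 0. Proof. by exists 0; rewrite /polyq tofrac0. Qed.
Lemma is_poly1 : is_poly 1. Proof. by exists 1; rewrite /polyq tofrac1. Qed.
Lemma is_polyq : is_poly q. Proof. by exists 'X. Qed.

Lemma is_polyD c d : is_poly c -> is_poly d -> is_poly (c + d).
Proof. by case=> p -> [r ->]; exists (p + r); rewrite /polyq tofracD. Qed.

Lemma is_polyM c d : is_poly c -> is_poly d -> is_poly (c * d).
Proof. by case=> p -> [r ->]; exists (p * r); rewrite /polyq tofracM. Qed.

Lemma is_polyN c : is_poly c -> is_poly (- c).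
Proof. by case=> p ->; exists (- p); rewrite /polyq tofracN. Qed.

Lemma is_polyX c m : is_poly c -> is_poly (c ^+ m).
Proof.
move=> cP; elim: m => [|m IHm]; first exact: is_poly1.
by rewrite exprS; apply: is_polyM.
Qed.

Lemma is_laurentP c : is_poly c -> is_laurent c.
Proof. by exists 0%N; rewrite expr0 mul1r. Qed.

Lemma is_laurentD c d : is_laurent c -> is_laurent d -> is_laurent (c + d).
Proof.
case=> i ci [j dj]; exists (i + j)%N.
have -> : q ^+ (i + j) * (c + d)
  = q ^+ j * (q ^+ i * c) + q ^+ i * (q ^+ j * d) by rewrite exprD; ring.
by apply: is_polyD; apply: is_polyM => //; apply: is_polyX; apply: is_polyq.
Qed.

Lemma is_laurentM c d : is_laurent c -> is_laurent d -> is_laurent (c * d).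
Proof.
case=> i ci [j dj]; exists (i + j)%N.
have -> : q ^+ (i + j) * (c * d) = (q ^+ i * c) * (q ^+ j * d) by rewrite exprD; ring.
exact: is_polyM.
Qed.

Lemma is_laurentN c : is_laurent c -> is_laurent (- c).
Proof. by case=> i ci; exists i; rewrite mulrN; apply: is_polyN. Qed.

Lemma is_laurentX c m : is_laurent c -> is_laurent (c ^+ m).
Proof.
move=> cL; elim: m => [|m IHm]; first exact/is_laurentP/is_poly1.
by rewrite exprS; apply: is_laurentM.
Qed.

Lemma is_laurentq : is_laurent q. Proof. exact/is_laurentP/is_polyq. Qed.

Lemma is_laurentVq : is_laurent q^-1.
Proof. by exists 1%N; rewrite expr1 divff ?qv_neq0 //; apply: is_poly1. Qed.

(* Equality in the algebra with the given presentation: equality in all its models. *)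
Definition eqz (x y : elt) := forall (A : algType (Kq K)) (t : 'I_n -> 'I_n -> A),
  qmat_rel t -> x A t = y A t.

Definition elt0 : elt := fun A t => 0.
Definition elt1 : elt := fun A t => 1.
Definition eltD (x y : elt) : elt := fun A t => x A t + y A t.
Definition eltZ (c : Kq K) (x : elt) : elt := fun A t => c *: x A t.
Definition eltM (x y : elt) : elt := fun A t => x A t * y A t.
Definition gen (i j : 'I_n) : elt := fun A t => t i j.
Definition mon (w u : seq 'I_n) : elt := fun A t => qmonomial t w u.

(** Elements are terms, and the presented algebra is never formed as a quotient; closure under [eqz]
    takes its place. Submodules are predicates so that they can be pulled back along multiplication
    by a fixed element or along transposition. The inductions over spans can then treat one factor
    of a product at a time. *)
Record submod (S : Kq K -> Prop) (P : elt -> Prop) : Prop := Submod {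
  submod0 : P elt0;
  submodD : forall x y, P x -> P y -> P (eltD x y);
  submodZ : forall c x, S c -> P x -> P (eltZ c x);
  submod_eq : forall x y, eqz x y -> P x -> P y }.

Inductive zspan (S : Kq K -> Prop) (G : elt -> Prop) : elt -> Prop :=
| span_gen g : G g -> zspan S G g
| span0 : zspan S G elt0
| spanD x y : zspan S G x -> zspan S G y -> zspan S G (eltD x y)
| spanZ c x : S c -> zspan S G x -> zspan S G (eltZ c x)
| span_eq x y : eqz x y -> zspan S G x -> zspan S G y.

Lemma span_submod S G : submod S (zspan S G).
Proof. split; [exact: span0 | exact: spanD | exact: spanZ | exact: span_eq]. Qed.

Lemma span_min S G P : submod S P -> (forall g, G g -> P g) -> forall x, zspan S G x -> P x.
Proof.
case=> P0 PD PZ Peq GP x; elim=> {x} [g /GP //|//|x y _ Px _ Py|c x cS _ Px|x y xy _ Px].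
- exact: PD.
- exact: PZ.
- exact: Peq xy Px.
Qed.

Lemma submod_sum S P (I : Type) (r : seq I) (Q : pred I) (F : I -> elt) :
  submod S P -> (forall i, Q i -> P (F i)) ->
  P (fun A t => \sum_(i <- r | Q i) F i A t).
Proof.
move=> mP PF; elim: r => [|i r IHr].
  by apply: (submod_eq mP) (submod0 mP) => A t _; rewrite big_nil.
case Qi: (Q i).
  by apply: (submod_eq mP) (submodD mP (PF i Qi) IHr) => A t _; rewrite big_cons Qi.
by apply: (submod_eq mP) IHr => A t _; rewrite big_cons Qi.
Qed.

Lemma submod_mull S P z : submod S P -> submod S (fun x => P (eltM z x)).
Proof.
case=> P0 PD PZ Peq; split.
- by apply: Peq P0 => A t _; rewrite /eltM mulr0.
- by move=> x y Px Py; apply: Peq (PD _ _ Px Py) => A t _; rewrite /eltM /eltD mulrDr.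
- by move=> c x cS Px; apply: Peq (PZ _ _ cS Px) => A t _; rewrite /eltM /eltZ scalerAr.
- by move=> x y xy Px; apply: Peq Px => A t rt; rewrite /eltM (xy A t rt).
Qed.

Lemma submod_mulr S P z : submod S P -> submod S (fun x => P (eltM x z)).
Proof.
case=> P0 PD PZ Peq; split.
- by apply: Peq P0 => A t _; rewrite /eltM mul0r.
- by move=> x y Px Py; apply: Peq (PD _ _ Px Py) => A t _; rewrite /eltM /eltD mulrDl.
- by move=> c x cS Px; apply: Peq (PZ _ _ cS Px) => A t _; rewrite /eltM /eltZ scalerAl.
- by move=> x y xy Px; apply: Peq Px => A t rt; rewrite /eltM (xy A t rt).
Qed.

Definition monG k (z : elt) := exists w u, [/\ size w = k, size u = k & z = mon w u].
Definition polymon k := zspan is_poly (monG k).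
Definition laurmon k := zspan is_laurent (monG k).

Lemma qmonomial_cat (A : algType (Kq K)) (t : 'I_n -> 'I_n -> A) w1 u1 w2 u2 :
  size w1 = size u1 ->
  qmonomial t (w1 ++ w2) (u1 ++ u2) = qmonomial t w1 u1 * qmonomial t w2 u2.
Proof. by move=> s1; rewrite /qmonomial zip_cat // big_cat. Qed.

Lemma qmonomial_cons (A : algType (Kq K)) (t : 'I_n -> 'I_n -> A) a w b u :
  qmonomial t (a :: w) (b :: u) = t a b * qmonomial t w u.
Proof. by rewrite /qmonomial big_cons. Qed.

Lemma qmonomial_nil (A : algType (Kq K)) (t : 'I_n -> 'I_n -> A) :
  qmonomial t [::] [::] = 1.
Proof. by rewrite /qmonomial big_nil. Qed.

Lemma span_mon_mul (S : Kq K -> Prop) i j x y :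
  zspan S (monG i) x -> zspan S (monG j) y -> zspan S (monG (i + j)) (eltM x y).
Proof.
move=> xM yM; move: x xM; apply: span_min.
  exact/submod_mulr/span_submod.
move=> _ [w [u [sw su ->]]]; move: y yM; apply: span_min.
  exact/submod_mull/span_submod.
move=> _ [w' [u' [sw' su' ->]]].
apply: (@span_eq _ _ (mon (w ++ w') (u ++ u'))) => [A t _|].
  by rewrite /eltM /mon qmonomial_cat // sw.
by apply: span_gen; exists (w ++ w'), (u ++ u'); rewrite !size_cat sw sw' su su'.
Qed.

Lemma span_mon1 (S : Kq K -> Prop) : zspan S (monG 0) elt1.
Proof.
apply: (@span_eq _ _ (mon [::] [::])) => [A t _|]; first exact: qmonomial_nil.
by apply: span_gen; exists [::], [::].
Qed.

Lemma span_gen_mon (S : Kq K -> Prop) i j : zspan S (monG 1) (gen i j).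
Proof.
apply: (@span_eq _ _ (mon [:: i] [:: j])) => [A t _|].
  by rewrite /mon qmonomial_cons qmonomial_nil mulr1.
by apply: span_gen; exists [:: i], [:: j].
Qed.

Lemma span_mon (S : Kq K -> Prop) k w u :
  size w = k -> size u = k -> zspan S (monG k) (mon w u).
Proof. by move=> sw su; apply: span_gen; exists w, u. Qed.

(* [polymon k] is the degree [k] part of the K[q]-lattice M; [qpm k] is q M. *)
Definition qpm k (z : elt) := exists2 x, polymon k x & eqz z (eltZ q x).

Lemma qpm_submod k : submod is_poly (qpm k).
Proof.
split.
- by exists elt0; [exact: span0 | move=> A t _; rewrite /eltZ /elt0 scaler0].
- move=> x y [x' Mx Ex] [y' My Ey]; exists (eltD x' y'); first exact: spanD.
  by move=> A t rt; rewrite /eltD (Ex _ _ rt) (Ey _ _ rt) /eltZ scalerDr.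
- move=> c x cS [x' Mx Ex]; exists (eltZ c x'); first exact: spanZ.
  by move=> A t rt; rewrite /eltZ (Ex _ _ rt) /eltZ !scalerA mulrC.
- move=> x y xy [x' Mx Ex]; exists x' => // A t rt.
  by rewrite -(xy _ _ rt); apply: Ex.
Qed.

Definition eltB (x y : elt) : elt := fun A t => x A t - y A t.
Definition cong k (x y : elt) := qpm k (eltB x y).

Lemma cong_refl k x y : eqz x y -> cong k x y.
Proof.
move=> xy; exists elt0; first exact: span0.
by move=> A t rt; rewrite /eltB /eltZ /elt0 scaler0 (xy _ _ rt) subrr.
Qed.

Lemma submodN P x : submod is_poly P -> P x -> P (eltZ (-1) x).
Proof. by move=> mP; apply: (submodZ mP); apply/is_polyN/is_poly1. Qed.

Lemma cong_sym k x y : cong k x y -> cong k y x.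
Proof.
move=> /(submodN (qpm_submod k)); apply: (submod_eq (qpm_submod k)) => A t _.
by rewrite /eltZ /eltB scaleN1r opprB.
Qed.

Lemma cong_trans k y x z : cong k x y -> cong k y z -> cong k x z.
Proof.
move=> xy yz; apply: (submod_eq (qpm_submod k)) (submodD (qpm_submod k) xy yz).
by move=> A t _; rewrite /eltB /eltD addrA subrK.
Qed.

Lemma qpm_mull i j x y : polymon i x -> qpm j y -> qpm (i + j) (eltM x y).
Proof.
move=> Mx [y' My Ey]; exists (eltM x y'); first exact: span_mon_mul.
by move=> A t rt; rewrite /eltM /eltZ (Ey _ _ rt) /eltZ scalerAr.
Qed.

Lemma qpm_mulr i j x y : qpm i x -> polymon j y -> qpm (i + j) (eltM x y).
Proof.
move=> [x' Mx Ex] My; exists (eltM x' y); first exact: span_mon_mul.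
by move=> A t rt; rewrite /eltM /eltZ (Ex _ _ rt) /eltZ scalerAl.
Qed.

(** Telescoping: x y - x' y' = x (y - y') + (x - x') y', so only x and y' have to lie in M. *)
Lemma cong_mul i j x x' y y' : polymon i x -> polymon j y' ->
  cong i x x' -> cong j y y' -> cong (i + j) (eltM x y) (eltM x' y').
Proof.
move=> Mx My xx' yy'.
apply: (submod_eq (qpm_submod _))
  (submodD (qpm_submod _) (qpm_mull Mx yy') (qpm_mulr xx' My)).
by move=> A t _; rewrite /eltM /eltB /eltD mulrBr mulrBl addrA subrK.
Qed.

End Lattice.

(** * Knuth moves modulo q *)

Section Knuth.
Variables (K : fieldType) (n : nat).
Local Notation q := (qv K).
Local Notation elt := (qelem K n).
Local Notation mon := (@mon K n).
Local Notation qpm := (@qpm K n).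
Local Notation cong := (@cong K n).
Local Notation polymon := (@polymon K n).

(* Diagonal coefficients of the Hecke generator T on pairs of letters:
   T(ab) = ba + co a b * ab, so that T(aa) = q aa. *)
Definition co (a b : 'I_n) : Kq K :=
  if (a < b)%N then 0 else if a == b then q - 1 else q - q^-1.

Lemma co_lt (a b : 'I_n) : (a < b)%N -> co a b = 0. Proof. by rewrite /co => ->. Qed.
Lemma co_eq a : co a a = q - 1. Proof. by rewrite /co ltnn eqxx. Qed.
Lemma co_gt (a b : 'I_n) : (b < a)%N -> co a b = q - q^-1.
Proof.
rewrite /co => ba; rewrite ltnNge (ltnW ba) /=.
by case: eqP => // E; rewrite E ltnn in ba.
Qed.

Section FRT.
Variables (A : algType (Kq K)) (t : 'I_n -> 'I_n -> A).
Hypothesis rt : qmat_rel t.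

(* The FRT form of the relations: the actions of T on row words and on column words agree. *)
Lemma qmat_frt a b c d :
  t a d * t b c - t b c * t a d = (co a b - co c d) *: (t a c * t b d).
Proof.
case: rt => r1 r2 r3 r4.
have r1' (i k l : 'I_n) : (k < l)%N -> t i l * t i k = q *: (t i k * t i l).
  by move=> kl; rewrite (r1 i k l kl) scalerA divff ?scale1r ?qv_neq0.
have r2' (i j k : 'I_n) : (i < j)%N -> t j k * t i k = q *: (t i k * t j k).
  by move=> ij; rewrite (r2 i j k ij) scalerA divff ?scale1r ?qv_neq0.
case: (ltngtP a b) => [ab|ba|/val_inj <-]; case: (ltngtP c d) => [cd|dc|/val_inj <-].
- by rewrite !co_lt // subrr scale0r (r3 a b c d) // subrr.
- by rewrite (co_lt ab) (co_gt dc) sub0r opprB r4.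
- by rewrite (co_lt ab) co_eq sub0r opprB (r2' a b c ab) scalerBl scale1r.
- by rewrite (co_gt ba) (co_lt cd) subr0 -opprB r4 // (r3 b a c d) // -scaleNr opprB.
- by rewrite (co_gt ba) (co_gt dc) subrr scale0r (r3 b a d c) // subrr.
- rewrite (co_gt ba) co_eq; have -> : q - q^-1 - (q - 1) = 1 - q^-1 by ring.
  by rewrite scalerBl scale1r -(r2 b a c).
- by rewrite co_eq (co_lt cd) subr0 (r1' a c d cd) scalerBl scale1r.
- rewrite co_eq (co_gt dc); have -> : q - 1 - (q - q^-1) = q^-1 - 1 by ring.
  by rewrite (r1 a d c dc) scalerBl scale1r.
- by rewrite !co_eq !subrr scale0r.
Qed.

(** Diagonal coefficients of q - T, which sends ab to [dl a b] times ab minus ba. The values are q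
    on ascents, 1 on equal letters and q^-1 on descents, so only descents bring a denominator. *)
Definition dl (a b : 'I_n) := q - co a b.

Lemma qmat_dl a b c d :
  dl a b *: (t a c * t b d) - t b c * t a d = dl c d *: (t a c * t b d) - t a d * t b c.
Proof.
have /eqP := qmat_frt a b c d; rewrite subr_eq => /eqP ->.
by rewrite /dl opprD addrA -scalerBl; congr (_ *: _ - _); ring.
Qed.

Definition mon3 a b c x y z : A := t a x * t b y * t c z.

Lemma mon3_dl12 a b c x y z :
  dl a b *: mon3 a b c x y z - mon3 b a c x y z
  = dl x y *: mon3 a b c x y z - mon3 a b c y x z.
Proof.
by have := congr1 (fun v => v * t c z) (qmat_dl a b x y); rewrite !mulrBl -!scalerAl.
Qed.

Lemma mon3_dl23 a b c x y z :
  dl b c *: mon3 a b c x y z - mon3 a c b x y z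
  = dl y z *: mon3 a b c x y z - mon3 a b c x z y.
Proof.
have := congr1 (fun v => t a x * v) (qmat_dl b c y z).
by rewrite !mulrBr -!scalerAr /mon3 !mulrA.
Qed.

(* The two sides are [c_2 c_1] acting on the row word and [c_1 c_2] acting on the
   column word, where [c_i = q - T_i] in the Hecke algebra. *)
Lemma mon3_hecke a b c x y z :
  dl b c *: (dl a b *: mon3 a b c x y z - mon3 b a c x y z)
    - (dl a c *: mon3 a c b x y z - mon3 c a b x y z)
  = dl x y *: (dl y z *: mon3 a b c x y z - mon3 a b c x z y)
    - (dl x z *: mon3 a b c y x z - mon3 a b c y z x).
Proof.
rewrite !mon3_dl12 -!mon3_dl23 !scalerBr !scalerA (mulrC (dl x y)).
by rewrite !opprB addrACA [RHS]addrACA; congr (_ + _); rewrite addrC.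
Qed.

End FRT.

Lemma mon3E (A : algType (Kq K)) (t : 'I_n -> 'I_n -> A) a b c x y z :
  qmonomial t [:: a; b; c] [:: x; y; z] = mon3 t a b c x y z.
Proof. by rewrite !qmonomial_cons qmonomial_nil mulr1 /mon3 mulrA. Qed.

(** When exactly one of the two words descends, the coefficient in [qmat_frt] is e (f - q^-1) with e
    = 1 or -1 and f = 1 or q. Solving that relation for q^-1 times the monomial exhibits the
    monomial as q times an element of M. *)
Lemma qpm_mon_descent2 (a b c d : 'I_n) : (b < a)%N != (d < c)%N ->
  qpm 2 (mon [:: a; b] [:: c; d]).
Proof.
have key (e f : Kq K) : co a b - co c d = e * (f - q^-1) -> e * e = 1 ->
    is_poly e -> is_poly f -> qpm 2 (mon [:: a; b] [:: c; d]).
  move=> coE ee eP fP.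
  exists (eltD (eltZ f (mon [:: a; b] [:: c; d]))
    (eltZ (- e) (eltD (mon [:: a; b] [:: d; c]) (eltZ (-1) (mon [:: b; a] [:: c; d]))))).
    have mM w u : size w = 2%N -> size u = 2%N -> polymon 2 (mon w u).
      by move=> sw su; apply: span_mon.
    apply: spanD; first by apply: spanZ; rewrite //; apply: mM.
    apply: spanZ; first exact: is_polyN.
    by apply: spanD; [|apply: spanZ; [exact/is_polyN/is_poly1|]]; apply: mM.
  move=> A t rt; rewrite /eltZ /eltD /mon !qmonomial_cons !qmonomial_nil !mulr1.
  rewrite scaleN1r (qmat_frt rt) coE !scalerA -scalerDl scalerA.
  by rewrite !mulrA mulNr ee mulN1r opprB addrCA subrr addr0 divff ?qv_neq0 // scale1r.
have P1 := is_poly1 K; have PN1 := is_polyN P1; have Pq := is_polyq K.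
case: (ltngtP b a) => [ba|ab|/val_inj ba]; case: (ltngtP d c) => [dc|cd|/val_inj dc] //= _.
- by apply: (key 1 q) => //; rewrite ?(co_gt ba) ?(co_lt cd); ring.
- by apply: (key 1 1) => //; rewrite ?(co_gt ba) ?dc ?co_eq; ring.
- by apply: (key (-1) q) => //; rewrite ?(co_gt dc) ?(co_lt ab); ring.
- by apply: (key (-1) 1) => //; rewrite ?(co_gt dc) ?ba ?co_eq; ring.
Qed.

Lemma cong_mon_ctx k p p' w u w' u' s s' :
  size p = size p' -> size s = size s' ->
  size w = k -> size u = k -> size w' = k -> size u' = k ->
  cong k (mon w u) (mon w' u') ->
  cong (size p + k + size s) (mon (p ++ w ++ s) (p' ++ u ++ s'))
                             (mon (p ++ w' ++ s) (p' ++ u' ++ s')).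
Proof.
move=> sp ss sw su sw' su' H.
have E v x : size v = k -> size x = k ->
    eqz (mon (p ++ v ++ s) (p' ++ x ++ s'))
        (eltM (eltM (mon p p') (mon v x)) (mon s s')).
  by move=> sv sx A t _; rewrite /eltM /mon !qmonomial_cat ?mulrA // sv sx.
have Mp : polymon (size p) (mon p p') by apply: span_mon.
have Ms : polymon (size s) (mon s s') by apply: span_mon.
apply: cong_trans (cong_refl _ (E _ _ sw su)) _.
apply/cong_sym/(cong_trans (cong_refl _ (E _ _ sw' su')))/cong_sym.
apply: cong_mul => //; last exact: cong_refl.
  by apply: span_mon_mul => //; apply: span_mon.
by apply: cong_mul => //; [apply: span_mon | exact: cong_refl].
Qed.

Lemma qpm_mon_ctx k p p' w u s s' :
  size p = size p' -> size s = size s' -> size w = k -> size u = k ->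
  qpm k (mon w u) -> qpm (size p + k + size s) (mon (p ++ w ++ s) (p' ++ u ++ s')).
Proof.
move=> sp ss sw su H.
have Mp : polymon (size p) (mon p p') by apply: span_mon.
have Ms : polymon (size s) (mon s s') by apply: span_mon.
apply: (submod_eq (@qpm_submod K n _) _ (qpm_mulr (qpm_mull Mp H) Ms)) => A t _.
by rewrite /eltM /mon !qmonomial_cat ?mulrA // sw su.
Qed.

Lemma qpm_mon_descent p p' (a b c d : 'I_n) s s' : size p = size p' -> size s = size s' ->
  (b < a)%N != (d < c)%N ->
  qpm (size p + size s).+2 (mon (p ++ a :: b :: s) (p' ++ c :: d :: s')).
Proof.
move=> sp ss /qpm_mon_descent2 H.
have := @qpm_mon_ctx 2 p p' [:: a; b] [:: c; d] s s' sp ss erefl erefl H.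
by rewrite addn2 !addSn.
Qed.

(* The Knuth move on a window a <= b > c. *)
Definition knuth (a b c : 'I_n) := if (c < a)%N then [:: a; c; b] else [:: b; a; c].

Lemma dl_lt (a b : 'I_n) : (a < b)%N -> dl a b = q.
Proof. by move=> ab; rewrite /dl co_lt ?subr0. Qed.
Lemma dl_eq (a : 'I_n) : dl a a = 1.
Proof. by rewrite /dl co_eq opprB addrC subrK. Qed.
Lemma dl_gt (a b : 'I_n) : (b < a)%N -> dl a b = q^-1.
Proof. by move=> ab; rewrite /dl co_gt // opprB addrC subrK. Qed.
Lemma dl_poly (a b : 'I_n) : (a <= b)%N -> is_poly (dl a b).
Proof.
by rewrite leq_eqVlt => /orP[/eqP/val_inj ->|ab]; rewrite ?dl_eq ?dl_lt //;
  [exact: is_poly1 | exact: is_polyq].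
Qed.

Definition m3 a b c x y z : elt := mon [:: a; b; c] [:: x; y; z].

(** This is q c_2 c_1 on the row word, and [hecke_r] is q c_1 c_2 on the column word. On the windows
    used below each coefficient contains q^-1 at most once, and the extra q cancels it. *)
Definition hecke_l a b c x y z : elt :=
  eltD (eltZ q (eltZ (dl b c) (eltB (eltZ (dl a b) (m3 a b c x y z)) (m3 b a c x y z))))
      (eltZ (- q) (eltB (eltZ (dl a c) (m3 a c b x y z)) (m3 c a b x y z))).
Definition hecke_r a b c x y z : elt :=
  eltD (eltZ q (eltZ (dl x y) (eltB (eltZ (dl y z) (m3 a b c x y z)) (m3 a b c x z y))))
      (eltZ (- q) (eltB (eltZ (dl x z) (m3 a b c y x z)) (m3 a b c y z x))).

Lemma hecke_lr a b c x y z : eqz (hecke_l a b c x y z) (hecke_r a b c x y z).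
Proof.
move=> A t rt; rewrite /hecke_l /hecke_r /eltD /eltZ /eltB /m3 /mon !mon3E.
by rewrite !scaleNr -!scalerBr (mon3_hecke rt).
Qed.

Lemma m3_poly a b c x y z : polymon 3 (m3 a b c x y z).
Proof. exact: span_mon. Qed.

(** In the expansion every term keeps coefficients divisible by q except minus the moved monomial
    and, when c < a < b, minus the monomial with row word bac. The latter descends at its last two
    rows while y <= z, so it lies in qM as well. *)
Lemma m3_l (x y z a b c : 'I_n) : (y < x)%N -> (y <= z)%N -> (a <= b)%N -> (c < b)%N ->
  qpm 3 (eltD (hecke_l a b c x y z) (mon (knuth a b c) [:: x; y; z])).
Proof.
move=> yx yz ab cb; have mP := @qpm_submod K n 3.
have qm e u v w x' y' z' : is_poly e -> qpm 3 (eltZ (q * e) (m3 u v w x' y' z')).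
  move=> eP; exists (eltZ e (m3 u v w x' y' z')); last by move=> A t _; rewrite /eltZ scalerA.
  by apply: spanZ => //; apply: m3_poly.
have P1 := is_poly1 K.
rewrite /knuth; case: ltnP => [ca|ac].
  move: ab; rewrite leq_eqVlt => /orP[/eqP/val_inj ab|ab].
    apply: (submod_eq mP) (qm 1 c a b x y z P1) => A t rt.
    rewrite /hecke_l /eltD /eltZ /eltB -ab !dl_eq scale1r subrr !scaler0 add0r.
    rewrite (dl_gt ca) scaleNr scalerBr scalerA divff ?qv_neq0 // scale1r opprB.
    by rewrite mulr1 subrK.
  have : qpm 3 (eltZ (-1) (m3 b a c x y z)).
    apply: submodN => //; rewrite /m3.
    have := @qpm_mon_descent [:: b] [:: x] a c y z [::] [::] erefl erefl; apply.
    by rewrite ca ltnNge yz.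
  move=> /(submodD mP (submodD mP (qm 1 a b c x y z P1) (qm 1 c a b x y z P1))).
  apply: (submod_eq mP) => A t rt.
  rewrite /hecke_l /eltD /eltZ /eltB (dl_gt ca) (dl_gt cb) (dl_lt ab).
  rewrite !scalerA divff ?qv_neq0 // scale1r mulr1 scaleN1r [(- q) *: _]scaleNr.
  rewrite scalerBr scalerA divff ?qv_neq0 // scale1r opprB -/(m3 a c b x y z).
  by rewrite -[RHS]addrA subrK addrAC.
have ab' : (a < b)%N := leq_ltn_trans ac cb.
have N1 := is_polyN P1.
have := submodD mP (submodD mP (qm 1 a b c x y z P1) (qm 1 c a b x y z P1))
   (submodN mP (qm _ a c b x y z (dl_poly ac))).
apply: (submod_eq mP) => A t rt.
rewrite /hecke_l /eltD /eltZ /eltB (dl_gt cb) (dl_lt ab').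
rewrite !scalerA divff ?qv_neq0 // scale1r mulr1 mulN1r [(- q) *: _]scaleNr.
rewrite [(- (_ * _)) *: _]scaleNr scalerBr scalerA opprB -/(m3 b a c x y z).
by rewrite [RHS]addrAC subrK addrA.
Qed.

(** Mirror image of [m3_l] on columns. The [if] is the inverse Knuth move, from a valley x > y <= z
    back to a peak. *)
Lemma m3_r (a b c x y z : 'I_n) : (a <= b)%N -> (c < b)%N -> (y < x)%N -> (y <= z)%N ->
  qpm 3 (eltD (hecke_r a b c x y z)
              (mon [:: a; b; c] (if (x <= z)%N then [:: x; z; y] else [:: y; x; z]))).
Proof.
move=> ab cb yx yz; have mP := @qpm_submod K n 3.
have qm e u v w x' y' z' : is_poly e -> qpm 3 (eltZ (q * e) (m3 u v w x' y' z')).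
  move=> eP; exists (eltZ e (m3 u v w x' y' z')); last by move=> A t _; rewrite /eltZ scalerA.
  by apply: spanZ => //; apply: m3_poly.
have P1 := is_poly1 K.
case: leqP => [xz|zx].
  have yz' : (y < z)%N := leq_trans yx xz.
  have := submodD mP (submodD mP (qm 1 a b c x y z P1) (qm 1 a b c y z x P1))
     (submodN mP (qm _ a b c y x z (dl_poly xz))).
  apply: (submod_eq mP) => A t rt.
  rewrite /hecke_r /eltD /eltZ /eltB (dl_gt yx) (dl_lt yz').
  rewrite !scalerA divff ?qv_neq0 // scale1r mulr1 mulN1r [(- q) *: _]scaleNr.
  rewrite [(- (_ * _)) *: _]scaleNr scalerBr scalerA opprB -/(m3 a b c x z y).
  by rewrite [RHS]addrAC subrK addrA.
move: yz; rewrite leq_eqVlt => /orP[/eqP/val_inj yz|yz].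
  apply: (submod_eq mP) (qm 1 a b c y z x P1) => A t rt.
  rewrite /hecke_r /eltD /eltZ /eltB yz !dl_eq scale1r subrr !scaler0 add0r.
  rewrite (dl_gt zx) scaleNr scalerBr scalerA divff ?qv_neq0 // scale1r opprB.
  by rewrite mulr1 subrK.
have : qpm 3 (eltZ (-1) (m3 a b c x z y)).
  apply: submodN => //; rewrite /m3.
  have := @qpm_mon_descent [::] [::] a b x z [:: c] [:: y] erefl erefl; apply.
  by rewrite zx ltnNge ab.
move=> /(submodD mP (submodD mP (qm 1 a b c x y z P1) (qm 1 a b c y z x P1))).
apply: (submod_eq mP) => A t rt.
rewrite /hecke_r /eltD /eltZ /eltB (dl_gt zx) (dl_gt yx) (dl_lt yz).
rewrite !scalerA divff ?qv_neq0 // scale1r mulr1 scaleN1r [(- q) *: _]scaleNr.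
rewrite scalerBr scalerA divff ?qv_neq0 // scale1r opprB -/(m3 a b c y x z).
by rewrite -[RHS]addrA subrK addrAC.
Qed.

Lemma size_knuth a b c : size (knuth a b c) = 3%N.
Proof. by rewrite /knuth; case: ifP. Qed.

Lemma cong_knuth3 (a b c x y z : 'I_n) :
  (a <= b)%N -> (c < b)%N -> (x <= y)%N -> (z < y)%N ->
  cong 3 (mon [:: a; b; c] [:: x; y; z]) (mon (knuth a b c) (knuth x y z)).
Proof.
move=> ab cb xy zy; have mP := @qpm_submod K n 3.
(* The mixed monomial has row word abc and the moved column word x' y' z'. Its two Hecke expansions
   are equal and reduce to minus the two sides of the congruence. *)
have key (x' y' z' : 'I_n) : (y' < x')%N -> (y' <= z')%N -> knuth x y z = [:: x'; y'; z'] ->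
    (if (x' <= z')%N then [:: x'; z'; y'] else [:: y'; x'; z']) = [:: x; y; z] ->
    cong 3 (mon [:: a; b; c] [:: x; y; z]) (mon (knuth a b c) (knuth x y z)).
  move=> yx yz -> E; have := submodD mP (m3_r ab cb yx yz) (submodN mP (m3_l yx yz ab cb)).
  apply: (submod_eq mP) => A t rt.
  rewrite E /eltD /eltZ /eltB (hecke_lr a b c x' y' z' rt) scaleN1r opprD addrACA.
  by rewrite subrr add0r.
rewrite /knuth in key *; case: (ltnP z x) key => [zx|xz] key.
  by apply: (key x z y); rewrite ?xy ?(ltnW zy).
by apply: (key y x z); rewrite ?(leq_ltn_trans xz zy) // leqNgt zy.
Qed.

Lemma cong_knuth p p' s s' (a b c x y z : 'I_n) :
  size p = size p' -> size s = size s' ->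
  (a <= b)%N -> (c < b)%N -> (x <= y)%N -> (z < y)%N ->
  cong (size p + size s).+3 (mon (p ++ [:: a, b, c & s]) (p' ++ [:: x, y, z & s']))
       (mon (p ++ knuth a b c ++ s) (p' ++ knuth x y z ++ s')).
Proof.
move=> sp ss ab cb xy zy.
have := @cong_mon_ctx 3 p p' [:: a; b; c] [:: x; y; z] _ _ s s' sp ss erefl erefl
  (size_knuth a b c) (size_knuth x y z)
  (cong_knuth3 ab cb xy zy).
by rewrite addn3 !addSn.
Qed.

End Knuth.

(** * Row insertion *)

Section Insertion.
Variables (K : fieldType) (n : nat).
Local Notation mon := (@mon K n).
Local Notation qpm := (@qpm K n).
Local Notation cong := (@cong K n).
Local Notation lei := (fun x y : 'I_n => (x <= y)%N).

Definition bump_word (r : seq 'I_n) (x : 'I_n) :=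
  let i := find (fun y : 'I_n => (x < y)%N) r in nth x r i :: set_nth x r i x.
Arguments bump_word : simpl never.

Lemma bump_wordE r1 (b : 'I_n) r2 (x : 'I_n) :
  all (fun y : 'I_n => (y <= x)%N) r1 -> (x < b)%N ->
  bump_word (r1 ++ b :: r2) x = b :: r1 ++ x :: r2.
Proof.
move=> r1x xb; rewrite /bump_word find_cat.
have /negPf-> : ~~ has (fun y : 'I_n => (x < y)%N) r1.
  by rewrite -all_predC; apply: sub_all r1x => y /=; rewrite -leqNgt.
rewrite /= xb addn0 nth_cat ltnn subnn /=; congr (_ :: _).
by elim: r1 {r1x} => //= a r1 ->.
Qed.

Lemma bump_split r (x : 'I_n) : has (fun y : 'I_n => (x < y)%N) r ->
  exists r1 b r2, [/\ r = r1 ++ b :: r2, all (fun y : 'I_n => (y <= x)%N) r1 & (x < b)%N].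
Proof.
elim: r => //= a r IHr; case: (ltnP x a) => [xa _|ax /= /IHr[r1 [b [r2 [-> r1x xb]]]]].
  by exists [::], a, r.
by exists (a :: r1), b, r2; split=> //=; rewrite ax.
Qed.

Lemma size_bump_word r (x : 'I_n) : has (fun y : 'I_n => (x < y)%N) r ->
  size (bump_word r x) = (size r).+1.
Proof.
case/bump_split=> r1 [b [r2 [-> r1x xb]]]; rewrite bump_wordE //=.
by rewrite !size_cat.
Qed.

(** One Knuth move reduces a bump to a bump in a row shorter by one letter. If x < z1, then x simply
    moves left. If z1 <= x, the move pulls out z2, the letter to be ejected; the rest is encoded as
    inserting z1 into [rcons r0 z2], which ejects z2 again. The next window therefore sits at the
    same place in both cases. *)
Lemma bump_step r0 (z1 z2 x : 'I_n) :
  sorted lei (r0 ++ [:: z1; z2]) -> (x < z2)%N ->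
  exists r1 x1 e,
  [/\ r0 ++ knuth z1 z2 x = rcons (rcons r1 x1) e,
      bump_word (r0 ++ [:: z1; z2]) x = rcons (bump_word r1 x1) e,
      sorted lei r1, has (fun y : 'I_n => (x1 < y)%N) r1 & size r1 = (size r0).+1].
Proof.
move=> Sr xz; have tr : transitive lei by move=> ? ? ?; apply: leq_trans.
have Sz1 : sorted lei (r0 ++ [:: z1]).
  by move: Sr; rewrite -[[:: z1; z2]]/([:: z1] ++ [:: z2]) catA => /cat_sorted2[].
rewrite /knuth; case: ltnP => [xz1|z1x].
  have xr : has (fun y : 'I_n => (x < y)%N) (r0 ++ [:: z1]) by rewrite has_cat /= xz1 orbT.
  have [r1 [b [r2 [E r1x xb]]]] := bump_split xr.
  exists (r0 ++ [:: z1]), x, z2; split=> //; last by rewrite size_cat addn1.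
    by rewrite -!cats1 -!catA.
  have -> : r0 ++ [:: z1; z2] = r1 ++ b :: rcons r2 z2.
    by rewrite -cat_rcons -cats1 E -catA /= cats1.
  by rewrite E !bump_wordE //= rcons_cat.
have r0z : all (fun y : 'I_n => (y <= z1)%N) r0.
  apply/allP=> y yr0; move: Sz1; rewrite sorted_pairwise // pairwise_cat.
  by case/and3P=> /allrelP/(_ y z1 yr0 (mem_head _ _)).
have z12 : (z1 <= z2)%N := leq_trans z1x (ltnW xz).
have z12' : (z1 < z2)%N := leq_ltn_trans z1x xz.
exists (rcons r0 z2), z1, x; split.
- by rewrite -!cats1 -!catA.
- have -> : bump_word (rcons r0 z2) z1 = z2 :: r0 ++ [:: z1] by rewrite -cats1 bump_wordE.
  rewrite -cat_rcons bump_wordE //; first by rewrite cats1 -cats1 -!cats1.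
  by rewrite all_rcons z1x; apply: sub_all r0z => y yz; apply: leq_trans z1x.
- move: Sr; case: {xz r0z Sz1} r0 => [|a r0] //=; rewrite !cat_path /= rcons_path => /and3P[-> h1 _].
  by apply: leq_trans h1 z12.
- by rewrite -cats1 has_cat /= z12' orbT.
- by rewrite size_rcons.
Qed.

Lemma sorted_has_last (r : seq 'I_n) (z x : 'I_n) :
  sorted lei (rcons r z) -> has (fun y : 'I_n => (x < y)%N) (rcons r z) -> (x < z)%N.
Proof.
have tr : transitive lei by move=> ? ? ?; apply: leq_trans.
move=> S /hasP[a]; rewrite mem_rcons inE => /predU1P[-> //|ar0 ya].
apply: leq_trans ya _; move: S; rewrite -cats1 sorted_pairwise // pairwise_cat.
by case/and3P=> /allrelP/(_ a z ar0 (mem_head _ _)).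
Qed.

(** The window slides left by one place at each step in both rows, whichever of the two Knuth moves
    each row undergoes, so the two bumps run in parallel. *)
Lemma cong_bump r r' (x x' : 'I_n) : size r = size r' ->
  sorted lei r -> sorted lei r' ->
  has (fun y : 'I_n => (x < y)%N) r -> has (fun y : 'I_n => (x' < y)%N) r' ->
  cong (size r).+1 (mon (rcons r x) (rcons r' x')) (mon (bump_word r x) (bump_word r' x')).
Proof.
have tr : transitive lei by move=> ? ? ?; apply: leq_trans.
move: {2}(size r) (erefl (size r)) => m.
elim: m r r' x x' => [|m IHm] r r' x x'; first by case: r.
case/lastP: r => // r z2; case/lastP: r' => [|r' z2']; rewrite ?size_rcons // => -[sr] [srr'].
move=> S S' h h'; have xz := sorted_has_last S h; have xz' := sorted_has_last S' h'.
case: m IHm sr => [|m] IHm sr.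
  case: r sr S h srr' => // _ _ _ /esym/size0nil -> /=.
  by apply: cong_refl => A t _; rewrite /bump_word /= xz xz'.
case/lastP: r sr srr' S h => // r z1; case/lastP: r' S' h' => [|r' z1']; rewrite ?size_rcons //.
rewrite -!cats1 -!catA /= => S' h' [sr] [srr'] S h.
have [r1 [x1 [e [E1 E2 S1 h1 s1]]]] := bump_step S xz.
have [r1' [x1' [e' [E1' E2' S1' h1' s1']]]] := bump_step S' xz'.
have z12 : (z1 <= z2)%N by move: S; rewrite sorted_pairwise // pairwise_cat /= => /and4P[_ _ /andP[]].
have z12' : (z1' <= z2')%N by move: S'; rewrite sorted_pairwise // pairwise_cat /= => /and4P[_ _ /andP[]].
have := @cong_knuth K n r r' [::] [::] z1 z2 x z1' z2' x' srr' erefl z12 xz z12' xz'.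
rewrite !cats0 addn0 => H; apply: cong_trans H _.
rewrite E1 E1' E2 E2' -!(cats1 _ e) -!(cats1 _ e').
have ss : size r1 = size r1' by rewrite s1 s1' srr'.
have := @cong_mon_ctx K n (size r1).+1 [::] [::] (rcons r1 x1) (rcons r1' x1')
  (bump_word r1 x1) (bump_word r1' x1') [:: e] [:: e'] erefl erefl.
rewrite !size_rcons !size_bump_word // -ss add0n addn1 s1 => /(_ erefl erefl erefl erefl).
apply; rewrite -s1; apply: IHm => //; by rewrite s1 sr.
Qed.

Definition rword (T : seq (seq 'I_n)) := flatten (rev T).

Lemma rword_cons r T : rword (r :: T) = rword T ++ r.
Proof. by rewrite /rword rev_cons -cats1 flatten_cat /= cats0. Qed.

Lemma size_rword (T T' : seq (seq 'I_n)) : shape T = shape T' -> size (rword T) = size (rword T').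
Proof.
by move=> E; rewrite /rword !size_flatten /seq.shape !map_rev !sumn_rev; congr sumn.
Qed.

Lemma size_rword_ins T (x : 'I_n) : size (rword (ins x T).1) = (size (rword T)).+1.
Proof.
elim: T x => //= r T IHT x; case: ltnP => h.
  have := IHT (nth x r (find (fun y : 'I_n => (x < y)%N) r)).
  case: (ins _ T) => T2 k /=; rewrite !rword_cons !size_cat => ->.
  by rewrite size_set_nth (maxn_idPr h) addSn.
by rewrite /= !rword_cons !size_cat size_rcons addnS.
Qed.

(** A sorted row is bumped by x exactly when its last letter exceeds x. If only one row is bumped,
    exactly one of the two words descends at its last two letters. *)
Lemma qpm_ins_descent p p' (r r' : seq 'I_n) (x x' : 'I_n) :
  size (rword p) = size (rword p') -> size r = size r' -> sorted lei r -> sorted lei r' ->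
  has (fun y : 'I_n => (x < y)%N) r /\ ~~ has (fun y : 'I_n => (x' < y)%N) r' \/
  ~~ has (fun y : 'I_n => (x < y)%N) r /\ has (fun y : 'I_n => (x' < y)%N) r' ->
  qpm (size (rword (r :: p))).+1
      (mon (rcons (rword (r :: p)) x) (rcons (rword (r' :: p')) x')).
Proof.
move=> sp sr Sr Sr' H.
case/lastP: r sr Sr H => [|r z].
  by case: r' Sr' => // _ _ _ [] [].
case/lastP: r' Sr' => [|r' z'] Sr'; rewrite !size_rcons // => -[sr] Sr H.
rewrite !rword_cons !rcons_cat -!cats1 -!catA /= !catA size_cat size_cat.
have := @qpm_mon_descent K n (rword p ++ r) (rword p' ++ r') z x z' x' [::] [::].
rewrite !size_cat sr sp addn0 addn1 => /(_ erefl erefl); apply.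
have hN (s : seq 'I_n) (a y : 'I_n) :
    ~~ has (fun b : 'I_n => (y < b)%N) (rcons s a) -> (y < a)%N = false.
  by rewrite has_rcons negb_or => /andP[/negPf].
case: H => -[h h'].
  by rewrite (sorted_has_last Sr h) (hN _ _ _ h').
by rewrite (sorted_has_last Sr' h') (hN _ _ _ h).
Qed.

(** The row of the new cell counts the bumps. While both insertions bump, the two words move in
    parallel; the first row in which only one of them bumps yields a lone descent and kills the
    monomial. *)
Lemma cong_ins (T T' : tableau n) (x x' : 'I_n) : shape T = shape T' ->
  all (sorted lei) T -> all (sorted lei) T' ->
  if (ins x T).2 == (ins x' T').2 then
    cong (size (rword T)).+1 (mon (rcons (rword T) x) (rcons (rword T') x'))
         (mon (rword (ins x T).1) (rword (ins x' T').1))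
  else qpm (size (rword T)).+1 (mon (rcons (rword T) x) (rcons (rword T') x')).
Proof.
elim: T T' x x' => [|r T IHT] [|r' T'] x x' //=; first by move=> *; apply: cong_refl.
move=> [sr sT] /andP[Sr ST] /andP[Sr' ST'].
have sTw := size_rword sT.
case: ltnP => h; case: ltnP => h'.
- rewrite -has_find in h; rewrite -has_find in h'.
  set i := find _ r; set i' := find _ r'.
  have := IHT T' (nth x r i) (nth x' r' i') sT ST ST'.
  have := size_rword_ins T (nth x r i); have := size_rword_ins T' (nth x' r' i').
  case: (ins _ T) => T2 k; case: (ins _ T') => T2' k' /= s2' s2 H.
  have C1 : cong (size (rword (r :: T))).+1
      (mon (rcons (rword (r :: T)) x) (rcons (rword (r' :: T')) x'))
      (mon (rcons (rword T) (nth x r i) ++ set_nth x r i x)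
           (rcons (rword T') (nth x' r' i') ++ set_nth x' r' i' x')).
    rewrite !rword_cons !rcons_cat !cat_rcons.
    have := @cong_mon_ctx K n (size r).+1 (rword T) (rword T') (rcons r x) (rcons r' x')
      (bump_word r x) (bump_word r' x') [::] [::] sTw erefl.
    rewrite !size_rcons !size_bump_word // -sr !cats0 addn0 addnS size_cat; apply=> //.
    exact: cong_bump.
  have ss : size (set_nth x r i x) = size (set_nth x' r' i' x').
    by rewrite !size_set_nth sr /i /i'; rewrite !has_find in h h' *; lia.
  have sE : (size (rword (r :: T))).+1 = ((size (rword T)).+1 + size (set_nth x r i x))%N.
    by rewrite rword_cons size_cat size_set_nth /i; rewrite has_find in h; lia.
  rewrite eqSS; case: ifP H => [/eqP kk|kk] H.
    apply: cong_trans C1 _; rewrite sE !rword_cons.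
    have := @cong_mon_ctx K n (size (rword T)).+1 [::] [::] _ _ (rword T2) (rword T2')
       _ _ erefl ss _ _ s2 _ H.
    by rewrite /= add0n !size_rcons s2' sTw; apply.
  apply: (submod_eq (@qpm_submod K n _) _
    (submodD (@qpm_submod K n _) C1 _)); last first.
    rewrite sE; have := @qpm_mon_ctx K n (size (rword T)).+1 [::] [::] _ _
       _ _ erefl ss _ _ H.
    by rewrite /= add0n !size_rcons sTw; apply.
  by move=> A t _; rewrite /eltD /eltB subrK.
- case: (ins _ T) => T2 k /=; apply: qpm_ins_descent => //; left.
  by rewrite !has_find -leqNgt.
- case: (ins _ T') => T2 k /=; apply: qpm_ins_descent => //; right.
  by rewrite !has_find -leqNgt.
- apply: cong_refl => A t _.
  by rewrite !rword_cons !rcons_cat.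
Qed.

End Insertion.

(** * Moving the first column out of a row reading word by Knuth moves *)

Section Columns.
Variables (K : fieldType) (n : nat).
Local Notation mon := (@mon K n).
Local Notation cong := (@cong K n).
Local Notation lei := (fun x y : 'I_n => (x <= y)%N).
Local Notation gti := (fun x y : 'I_n => (y < x)%N).

(** The letter x moves left over C by inverse Knuth moves on windows a x c, where a and c are
    consecutive letters of y :: C and c < a <= x. Both words always use the same type of move. *)
Lemma cong_pass1 (y y' : 'I_n) C C' (x x' : 'I_n) : size C = size C' ->
  path gti y C -> path gti y' C' -> (y <= x)%N -> (y' <= x')%N ->
  cong (size C).+2 (mon (y :: rcons C x) (y' :: rcons C' x')) (mon [:: y, x & C] [:: y', x' & C']).
Proof.
have key (z : 'I_n) (D : seq 'I_n) (c : 'I_n) : path gti z (rcons D c) ->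
    (c < last z D)%N /\ (last z D <= z)%N.
  elim: D z => [|d D IHD] z /=; first by rewrite andbT => ->.
  by case/andP=> dz /IHD[-> h]; split=> //; apply: leq_trans h (ltnW dz).
move=> sC pC pC' yx yx'.
elim/last_ind: C C' sC pC pC' => [|C c IHC] C' sC pC pC'.
  by case: C' sC {pC'} => // _; apply: cong_refl.
case/lastP: C' sC pC' => [|C' c']; rewrite !size_rcons // => -[sC] pC'.
have [cl ly] := key _ _ _ pC; have [cl' ly'] := key _ _ _ pC'.
have pC1 : path gti y C by move: pC; rewrite rcons_path => /andP[].
have pC1' : path gti y' C' by move: pC'; rewrite rcons_path => /andP[].
have lx := leq_trans ly yx; have lx' := leq_trans ly' yx'.
have sb : size (belast y C) = size (belast y' C') by rewrite !size_belast.
have := @cong_knuth K n (belast y C) (belast y' C') [::] [::]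
  (last y C) x c (last y' C') x' c' sb erefl lx (leq_trans cl lx) lx' (leq_trans cl' lx').
rewrite /knuth cl cl' !cats0 addn0 size_belast.
have E (z : 'I_n) (D : seq 'I_n) (a b : 'I_n) :
    belast z D ++ [:: last z D; a; b] = z :: rcons (rcons D a) b.
  by rewrite -cat_rcons -lastI -!cats1 /= -catA.
rewrite !E => /cong_sym H; apply: cong_trans H _.
have := @cong_mon_ctx K n (size C).+2 [::] [::] (y :: rcons C x) (y' :: rcons C' x')
   [:: y, x & C] [:: y', x' & C'] [:: c] [:: c'] erefl erefl.
rewrite /= !size_rcons -sC add0n addn1 !cats1 => /(_ erefl erefl erefl erefl); apply.
exact: IHC.
Qed.

Lemma cong_pass (y y' : 'I_n) C C' r r' : size C = size C' -> size r = size r' ->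
  path gti y C -> path gti y' C' -> path lei y r -> path lei y' r' ->
  cong (size C + size r).+1 (mon (y :: C ++ r) (y' :: C' ++ r')) (mon (y :: r ++ C) (y' :: r' ++ C')).
Proof.
move=> sC; elim: r r' y y' => [|x r IHr] [|x' r'] y y' //=.
  by move=> *; rewrite !cats0; apply: cong_refl.
move=> [sr] pC pC' /andP[yx pr] /andP[yx' pr'].
have := @cong_mon_ctx K n (size C).+2 [::] [::] (y :: rcons C x) (y' :: rcons C' x')
   [:: y, x & C] [:: y', x' & C'] r r' erefl sr.
rewrite /= !size_rcons -sC add0n addSn addSnnS !cat_rcons => /(_ erefl erefl erefl erefl) H.
apply: (cong_trans (H (cong_pass1 sC pC pC' yx yx'))) => {H}.
have pC1 : path gti x C.
  by case: C pC {sC IHr} => //= c C /andP[cy ->]; rewrite andbT (leq_trans cy yx).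
have pC1' : path gti x' C'.
  by case: C' pC' {sC IHr} => //= c C' /andP[cy ->]; rewrite andbT (leq_trans cy yx').
have := @cong_mon_ctx K n (size C + size r).+1 [:: y] [:: y'] (x :: C ++ r) (x' :: C' ++ r')
   (x :: r ++ C) (x' :: r' ++ C') [::] [::] erefl erefl.
have -> : (size C + (size r).+1).+1 = (size [:: y] + (size C + size r).+1 + size (Nil 'I_n))%N.
  by rewrite /=; lia.
rewrite /= !cats0 => H; apply: H; rewrite ?size_cat; try lia.
exact: IHr.
Qed.

(** The pairs are the rows from top to bottom, cut into first letter and rest. On the left stands
    the first column read downwards, followed by the remaining rows. Passing the part of the column
    below the top row through the rest of that row, one row after another, rebuilds the row reading
    word. *)
Lemma cong_strip (z z' : seq ('I_n * seq 'I_n)) :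
  map (fun p => size p.2) z = map (fun p => size p.2) z' ->
  sorted gti (map fst z) -> sorted gti (map fst z') ->
  all (fun p => path lei p.1 p.2) z -> all (fun p => path lei p.1 p.2) z' ->
  cong (size (flatten [seq p.1 :: p.2 | p <- z]))
       (mon (map fst z ++ flatten (map snd z)) (map fst z' ++ flatten (map snd z')))
       (mon (flatten [seq p.1 :: p.2 | p <- z]) (flatten [seq p.1 :: p.2 | p <- z'])).
Proof.
elim: z z' => [|[c r] z IHz] [|[c' r'] z'] //=; first by move=> *; apply: cong_refl.
move=> [sr sz] Sz Sz' /andP[pr az] /andP[pr' az'].
have sz' : size z = size z' by rewrite -[LHS](size_map (fun p => size p.2)) sz size_map.
(* The boolean selects whole rows or rows without their first letter, so one induction gives both
   size equalities. *)
have sf (b : bool) : size (flatten [seq (if b then p.1 :: p.2 else p.2) | p <- z])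
         = size (flatten [seq (if b then p.1 :: p.2 else p.2) | p <- z']).
  elim: z z' sz {IHz Sz Sz' az az' sz'} => [|p z IH] [|p' z'] //= [sp] /IH.
  by rewrite !size_cat => ->; case: (b); rewrite /= sp.
have sf1 := sf true; have sf2 := sf false; rewrite /= in sf1 sf2.
have sE : size (flatten [seq p.1 :: p.2 | p <- z]) = (size z + size (flatten (map snd z)))%N.
  by elim: (z) => //= p z1 IH; rewrite !size_cat /= IH; lia.
have := @cong_mon_ctx K n (size z + size r).+1 [::] [::]
  (c :: map fst z ++ r) (c' :: map fst z' ++ r') (c :: r ++ map fst z) (c' :: r' ++ map fst z')
  (flatten (map snd z)) (flatten (map snd z')) erefl sf2.
rewrite /= !size_cat !size_map -sr -sz' (addnC (size r)) add0n => /(_ erefl erefl erefl erefl) H.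
have sE2 : (size r + size (flatten [seq p.1 :: p.2 | p <- z])).+1
   = ((size z + size r).+1 + size (flatten (map snd z)))%N by rewrite sE; lia.
rewrite sE2 -!catA in H *.
apply: cong_trans (H _) _ => {H}.
  have := @cong_pass c c' (map fst z) (map fst z') r r'.
  by rewrite !size_map; apply.
rewrite -sE2.
have := @cong_mon_ctx K n (size (flatten [seq p.1 :: p.2 | p <- z])) (c :: r) (c' :: r')
  (map fst z ++ flatten (map snd z)) (map fst z' ++ flatten (map snd z'))
  (flatten [seq p.1 :: p.2 | p <- z]) (flatten [seq p.1 :: p.2 | p <- z']) [::] [::].
rewrite !size_cat !cats0 addn0 /= addSn => H; apply: H => //.
- by rewrite sr.
- by rewrite size_map sE.
- by rewrite size_map -sz' -sf2 sE.
- by apply: IHz => //; [move: Sz | move: Sz'] => /path_sorted.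
Qed.

End Columns.

(** * Insertion and recording tableaux, and the congruence for pairs of words *)

Section RobinsonSchensted.
Variables (K : fieldType) (n : nat).
Local Notation mon := (@mon K n).
Local Notation qpm := (@qpm K n).
Local Notation cong := (@cong K n).
Local Notation lei := (fun x y : 'I_n => (x <= y)%N).

(** Structurally recursive form of the bottom row after insertion; it covers the bumping and the
    appending branch of [ins] at once. *)
Fixpoint rowi (x : 'I_n) (r : seq 'I_n) : seq 'I_n :=
  if r is c :: r' then if (x < c)%N then x :: r' else c :: rowi x r' else [:: x].

Lemma rowi_bump (x : 'I_n) r : let i := find (fun y : 'I_n => (x < y)%N) r in
  (i < size r)%N -> set_nth x r i x = rowi x r.
Proof. by elim: r => //= c r IHr; case: (ltnP x c) => //= _ h; rewrite IHr. Qed.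

Lemma rowi_rcons (x : 'I_n) r : (size r <= find (fun y : 'I_n => (x < y)%N) r)%N ->
  rcons r x = rowi x r.
Proof. by elim: r => //= c r IHr; case: (ltnP x c) => //= _ /IHr ->. Qed.

Lemma insE (x : 'I_n) r T : ins x (r :: T) =
  if has (fun y : 'I_n => (x < y)%N) r then
    let y := nth x r (find (fun y : 'I_n => (x < y)%N) r) in
    (rowi x r :: (ins y T).1, (ins y T).2.+1)
  else (rowi x r :: T, 0%N).
Proof.
rewrite has_find /=; case: ltnP => h; last by rewrite rowi_rcons.
by rewrite rowi_bump //; case: ins.
Qed.

Lemma ins_head (x : 'I_n) T : exists T', (ins x T).1 = rowi x (head [::] T) :: T'.
Proof.
case: T => [|r T]; first by exists [::].
by rewrite insE; case: has; eexists.
Qed.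

Lemma ins2_le (x : 'I_n) T : ((ins x T).2 <= size T)%N.
Proof. by elim: T x => // r T IHT x; rewrite insE; case: has => //=; rewrite ltnS. Qed.

Lemma rowi_path (x c : 'I_n) r : (c <= x)%N -> path lei c r -> path lei c (rowi x r).
Proof.
elim: r c => [|d r IHr] c cx /=; first by rewrite cx.
case/andP=> cd dr; case: ltnP => [xd|dx] /=; last by rewrite cd IHr.
by rewrite cx; case: r dr {IHr} => //= e r /andP[de ->]; rewrite andbT (leq_trans (ltnW xd)).
Qed.

Lemma rowi_sorted (x : 'I_n) r : sorted lei r -> sorted lei (rowi x r).
Proof.
case: r => //= c r cr; case: ltnP => [xc|cx] /=; last exact: rowi_path.
by case: r cr => //= d r /andP[cd ->]; rewrite andbT (leq_trans (ltnW xc)).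
Qed.

Lemma row_below_cons (a b : 'I_n) r s :
  row_below (a :: r) (b :: s) = (a < b)%N && row_below r s.
Proof. by rewrite /row_below /= ltnS andbCA. Qed.

Lemma row_belown0 (r : seq 'I_n) : row_below r [::].
Proof. by case: r. Qed.

Lemma row_below_repl (a r s : seq 'I_n) (x y : 'I_n) : (x < y)%N ->
  row_below (a ++ y :: r) s -> row_below (a ++ x :: r) s.
Proof.
move=> xy; elim: a s => [|c a IHa] [|d s] //=; rewrite ?row_belown0 // !row_below_cons.
  by case/andP=> yd ->; rewrite (ltn_trans xy yd).
by case/andP=> -> /IHa.
Qed.

Lemma row_below_rcons (r s : seq 'I_n) x : row_below r s -> row_below (rcons r x) s.
Proof.
elim: r s => [|c r IHr] [|d s] //=; rewrite ?row_belown0 // !row_below_cons.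
by case/andP=> -> /IHr.
Qed.

(** Columns stay strict under a bump: the entry above y exceeds y, so the ejected y lands in the
    upper row weakly to the left of its old column, above an entry that is at most x. *)
Lemma row_below_rowi (a b r : seq 'I_n) (x y : 'I_n) :
  all (fun z : 'I_n => (z <= x)%N) a -> (x < y)%N ->
  row_below (a ++ y :: b) r -> row_below (a ++ x :: b) (rowi y r).
Proof.
move=> ax xy; elim: a ax r => [_|c a IHa /= /andP[cx ax]] [|d r] /=.
- by rewrite row_below_cons xy !row_belown0.
- by rewrite row_below_cons => /andP[yd br]; rewrite yd row_below_cons xy.
- by rewrite row_below_cons !row_belown0 (leq_ltn_trans cx xy).
- rewrite row_below_cons => /andP[cd abr]; case: ltnP => yd; rewrite row_below_cons.
    by rewrite (leq_ltn_trans cx xy) (row_below_repl xy).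
  by rewrite cd IHa.
Qed.

Lemma ins_tab (x : 'I_n) T : is_tab T -> is_tab (ins x T).1.
Proof.
elim: T x => //= r T IHT x /andP[/= /andP[/andP[r0 Sr] aT] pT].
have tT : is_tab T by rewrite /is_tab aT (path_sorted pT).
have rb : row_below r (head [::] T) by case: T pT {IHT aT tT} => [|s T /= /andP[]//]; rewrite row_belown0.
have rxn0 : rowi x r != [::] by case: (r) => //= c r'; case: ifP.
rewrite -/(ins x (r :: T)) insE; case: ifP => [h|/negbT h].
  set y := nth x r _ => /=; have := IHT y tT; have [T' E] := ins_head y T.
  rewrite E /is_tab /= => /andP[/andP[-> ->] ->].
  rewrite rxn0 rowi_sorted //= andbT.
  have [a [b [c [rE ax xb]]]] := bump_split h.
  have [yE xE] : y = b /\ rowi x r = a ++ x :: c.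
    have := bump_wordE c ax xb; rewrite -rE /bump_word; rewrite has_find in h.
    by rewrite rowi_bump // => -[].
  by rewrite yE xE row_below_rowi // -rE.
rewrite /is_tab /= rxn0 rowi_sorted // aT /=.
rewrite has_find -leqNgt in h; rewrite -rowi_rcons //.
case: T pT {IHT aT tT rb} => //= s T /andP[rs ->]; rewrite andbT.
exact: row_below_rcons.
Qed.

Lemma add_cellS r Q m : add_cell (r :: Q) 0 m = rcons r m :: Q.
Proof. by []. Qed.
Lemma add_cellSS r Q k m : add_cell (r :: Q) k.+1 m = r :: add_cell Q k m.
Proof. by rewrite /add_cell /= ltnS; case: ifP. Qed.

Lemma shape_ins (x : 'I_n) T Q m : shape T = shape Q ->
  shape (ins x T).1 = shape (add_cell Q (ins x T).2 m).
Proof.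
elim: T x Q => [|r T IHT] x [|s Q] // [rs TQ].
rewrite insE; case: ifP => [h|/negbT h] /=.
  rewrite add_cellSS /= -(IHT _ _ TQ); congr (_ :: _); rewrite has_find in h.
  by rewrite -rowi_bump // size_set_nth -rs (maxn_idPr h).
rewrite has_find -leqNgt in h.
by rewrite -rowi_rcons // !size_rcons rs TQ.
Qed.

(** The label m + 1 exceeds all others, so the row containing it is k, and deleting it, together
    with a row emptied thereby, recovers Q. The latter operation is [rm]. *)
Lemma add_cell_inj Q Q' k k' m :
  all (fun r => (r != [::]) && all (fun x => x <= m)%N r) Q ->
  all (fun r => (r != [::]) && all (fun x => x <= m)%N r) Q' ->
  (k <= size Q)%N -> (k' <= size Q')%N ->
  add_cell Q k m.+1 = add_cell Q' k' m.+1 -> Q = Q' /\ k = k'.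
Proof.
pose rm (Q : seq (seq nat)) := [seq r <- [seq [seq x <- r | (x <= m)%N] | r <- Q] | r != [::]].
have rmE Q0 : all (fun r => (r != [::]) && all (fun x => x <= m)%N r) Q0 -> rm Q0 = Q0.
  elim: Q0 => //= r Q0 IH /andP[/andP[r0 rm'] /IH IHE]; rewrite /rm /= -/(rm Q0) IHE.
  by rewrite (all_filterP rm') r0.
have rmA Q0 j : all (fun r => (r != [::]) && all (fun x => x <= m)%N r) Q0 ->
    rm (add_cell Q0 j m.+1) = Q0.
  elim: Q0 j => [|r Q0 IH] j; first by rewrite /rm /= ltnn.
  move=> /= /andP[/andP[r0 rm'] aQ]; case: j => [|j].
    by rewrite add_cellS /rm /= filter_rcons ltnn (all_filterP rm') r0 -/(rm Q0) rmE.
  by rewrite add_cellSS /rm /= (all_filterP rm') r0 -/(rm _) IH.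
have fA Q0 j : all (fun r => (r != [::]) && all (fun x => x <= m)%N r) Q0 ->
    (j <= size Q0)%N -> find (fun r => m.+1 \in r) (add_cell Q0 j m.+1) = j.
  elim: Q0 j => [|r Q0 IH] [|j] //=; rewrite ?mem_head //.
    by rewrite mem_rcons mem_head.
  move=> /= /andP[/andP[r0 rm'] aQ] jQ; rewrite add_cellSS /= IH //.
  by case: ifP => // /(allP rm'); rewrite ltnn.
move=> aQ aQ' kQ kQ' E; split; first by rewrite -(rmA Q k aQ) E rmA.
by rewrite -(fA Q k aQ kQ) E fA.
Qed.

Lemma RS_rcons (w : seq 'I_n) x :
  RS (rcons w x) = ((ins x (RS w).1).1, add_cell (RS w).2 (ins x (RS w).1).2 (size w).+1).
Proof.
have sz : forall w0 : seq 'I_n, (foldl (@RS_step n) ([::], [::], 0%N) w0).2 = size w0.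
  elim/last_ind => // w0 y; rewrite -cats1 foldl_cat size_cat addn1 /=.
  by case: (foldl _ _ w0) => -[P Q] m /= ->; case: ins.
rewrite /RS -cats1 foldl_cat /=; have := sz w.
by case: (foldl _ _ w) => -[P Q] m /= ->; case: ins.
Qed.

Lemma RS_tab (w : seq 'I_n) : is_tab (RS w).1.
Proof. by elim/last_ind: w => // w x; rewrite RS_rcons; apply: ins_tab. Qed.

Lemma RS_shape (w : seq 'I_n) : shape (RS w).1 = shape (RS w).2.
Proof. by elim/last_ind: w => // w x IHw; rewrite RS_rcons; apply: shape_ins. Qed.

Lemma RS_Q (w : seq 'I_n) :
  all (fun r => (r != [::]) && all (fun x => x <= size w)%N r) (RS w).2.
Proof.
elim/last_ind: w => // w x; rewrite RS_rcons size_rcons /=.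
move: (size w) (ins _ _).2 => m k; move: (RS w).2.
have weak r : (r != [::]) && all (fun x => x <= m)%N r ->
    (r != [::]) && all (fun x => x <= m.+1)%N r.
  by case/andP=> -> rm; apply: sub_all rm => y /leqW.
elim: k => [|k IHk] [|r Q] //=; rewrite ?leqnn // => /andP[rm aQ].
  rewrite all_rcons leqnn (sub_all _ aQ) // andbT -cats1; case/weak/andP: rm => _ ->.
  by case: r.
by rewrite add_cellSS /= weak // IHk.
Qed.

Lemma sorted_tab (T : tableau n) : is_tab T -> all (sorted lei) T.
Proof. by case/andP=> aT _; apply: sub_all aT => r /andP[]. Qed.

(** Induction on the last letter. The recording tableaux agree exactly when they agreed for the
    prefixes and the new cells lie in the same row. Accordingly the monomial can vanish modulo qM in
    two ways: already on the prefix, or at the last insertion. *)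
Lemma cong_RS (w u : seq 'I_n) : size w = size u ->
  if (RS w).2 == (RS u).2 then
    cong (size w) (mon w u) (mon (rword (RS w).1) (rword (RS u).1))
  else qpm (size w) (mon w u).
Proof.
elim/last_ind: w u => [|w x IHw] u.
  by move=> /esym/size0nil -> /=; apply: cong_refl.
case/lastP: u => [|u x']; rewrite !size_rcons // => -[swu].
rewrite !RS_rcons /= -swu.
have := IHw u swu; case: (eqVneq (RS w).2) => [QQ|QQ] H; last first.
  have -> : (add_cell (RS w).2 (ins x (RS w).1).2 (size w).+1
       == add_cell (RS u).2 (ins x' (RS u).1).2 (size w).+1) = false.
    apply/eqP=> /add_cell_inj[]; rewrite ?RS_Q //.
    - by rewrite swu RS_Q.
    - by rewrite -[size _](size_map size) -/(shape _) -RS_shape size_map ins2_le.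
    - by rewrite -[size (RS u).2](size_map size) -/(shape _) -RS_shape size_map ins2_le.
    - by move=> Q1; rewrite Q1 eqxx in QQ.
  have := @qpm_mon_ctx K n (size w) [::] [::] w u [:: x] [:: x'] erefl erefl erefl (esym swu) H.
  by rewrite /= add0n addn1 !cats1.
have sh : shape (RS w).1 = shape (RS u).1 by rewrite !RS_shape QQ.
have sR (v : seq 'I_n) : size (rword (RS v).1) = size v.
  by elim/last_ind: v => // v y IHv; rewrite RS_rcons size_rword_ins IHv size_rcons.
have C1 : cong (size w).+1 (mon (rcons w x) (rcons u x'))
    (mon (rcons (rword (RS w).1) x) (rcons (rword (RS u).1) x')).
  have := @cong_mon_ctx K n (size w) [::] [::] w u (rword (RS w).1) (rword (RS u).1)
     [:: x] [:: x'] erefl erefl erefl (esym swu) (sR w) _ H.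
  by rewrite /= add0n addn1 !cats1; apply; rewrite sR.
have := cong_ins K x x' sh (sorted_tab (RS_tab w)) (sorted_tab (RS_tab u)).
rewrite sR QQ; case: (eqVneq (ins x _).2) => [-> H1|kk H1].
  by rewrite eqxx; apply: cong_trans C1 H1.
have -> : (add_cell (RS u).2 (ins x (RS w).1).2 (size w).+1
       == add_cell (RS u).2 (ins x' (RS u).1).2 (size w).+1) = false.
  apply/eqP=> /add_cell_inj[]; rewrite ?swu ?RS_Q //.
  - by rewrite -[size _](size_map size) -/(shape _) -RS_shape -sh size_map ins2_le.
  - by rewrite -[size _](size_map size) -/(shape _) -RS_shape size_map ins2_le.
  - by move=> _ k1; rewrite k1 eqxx in kk.
apply: (submod_eq (@qpm_submod K n _) _ (submodD (@qpm_submod K n _) C1 H1)).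
by move=> A t _; rewrite /eltD /eltB subrK.
Qed.

End RobinsonSchensted.

(** * Antisymmetric tensors and quantum minors *)

Section Alternating.
Variables (K : fieldType) (n : nat).
Local Notation q := (qv K).
Local Notation s := ((- qv K)^-1).
Local Notation word := (seq 'I_n).
Local Notation sli := (fun x y : 'I_n => (x < y)%N).

Lemma sgnE : s = - q^-1. Proof. by rewrite invrN. Qed.

Fixpoint isrt (j : 'I_n) (w : word) : word :=
  if w is a :: w' then if (j < a)%N then j :: w else a :: isrt j w' else [:: j].

Lemma mem_isrt j w x : (x \in isrt j w) = (x == j) || (x \in w).
Proof.
elim: w => [|a w IHw] //=; case: ifP => _; rewrite !inE //.
by rewrite IHw orbCA.
Qed.

Lemma path_isrt (a j : 'I_n) w : (a < j)%N -> j \notin w -> path sli a w -> path sli a (isrt j w).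
Proof.
elim: w a => [|b w IHw] a /=; first by move=> ->.
rewrite inE negb_or => aj /andP[jb jw] /andP[ab bw].
case: (ltngtP j b) => [jlb|blj|/val_inj E] /=; first by rewrite aj jlb.
  by rewrite ab IHw.
by rewrite E eqxx in jb.
Qed.

Lemma sorted_isrt (j : 'I_n) w : j \notin w -> sorted sli w -> sorted sli (isrt j w).
Proof.
case: w => //= b w; rewrite inE negb_or => /andP[jb jw] bw.
case: (ltngtP j b) => [jlb|blj|/val_inj E] /=; first by rewrite jlb.
  by rewrite path_isrt.
by rewrite E eqxx in jb.
Qed.

Lemma enum_sorted (Y : {set 'I_n}) : sorted sli (enum Y).
Proof.
have tr : transitive sli by move=> ? ? ?; apply: ltn_trans.
rewrite /enum_mem -enumT; apply: sorted_filter => //.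
by have := iota_ltn_sorted 0 n; rewrite -val_enum_ord sorted_map.
Qed.

Lemma sli_eq (w w' : word) : sorted sli w -> sorted sli w' -> w =i w' -> w = w'.
Proof.
apply: irr_sorted_eq; first by move=> ? ? ?; apply: ltn_trans.
by move=> x; apply: ltnn.
Qed.

Lemma sorted_enum (w : word) : sorted sli w -> enum [set x in w] = w.
Proof.
move=> Sw; apply: sli_eq => //; first exact: enum_sorted.
by move=> x; rewrite mem_enum inE.
Qed.

Lemma enum_isrt (Y : {set 'I_n}) j : j \notin Y -> enum (j |: Y) = isrt j (enum Y).
Proof.
move=> jY; apply: sli_eq; first exact: enum_sorted.
  by apply: sorted_isrt; [rewrite mem_enum | exact: enum_sorted].
by move=> x; rewrite mem_isrt !mem_enum !inE.
Qed.

Lemma sli_uniq (w : word) : sorted sli w -> uniq w.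
Proof. by apply: sorted_uniq => [? ? ?|x]; [apply: ltn_trans | apply: ltnn]. Qed.

Fixpoint winv (u : word) : nat :=
  if u is j :: u' then count (fun y : 'I_n => (y < j)%N) u' + winv u' else 0.

Section Operators.
Variable V : lmodType (Kq K).
Implicit Type F : word -> V.

(* Hecke generators act on functions of words; the value 0 on short words keeps the
   braid relation valid without side conditions. *)
Definition gop F (w : word) : V :=
  if w is [:: a, b & w'] then F [:: b, a & w'] + co K a b *: F w else 0.

Fixpoint gi i F (w : word) : V :=
  if i is i'.+1 then if w is a :: w' then gi i' (fun u => F (a :: u)) w' else 0
  else gop F w.

Lemma eq_gi i F F' w : (forall u, size u = size w -> F u = F' u) -> gi i F w = gi i F' w.
Proof.
elim: i F F' w => [|i IHi] F F' [|a w] //= FF'; last first.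
  by apply: IHi => u su; apply: FF'; rewrite /= su.
by case: w FF' => //= b w FF'; rewrite !FF'.
Qed.

Lemma gi_cat i F w w' : (i.+1 < size w)%N ->
  gi i F (w ++ w') = gi i (fun u => F (u ++ w')) w.
Proof.
elim: i F w => [|i IHi] F [|a w] //=; first by case: w.
by rewrite ltnS => /IHi ->.
Qed.

(** q-antisymmetry: -q^-1 is the eigenvalue of the Hecke generators other than q. *)
Definition altg m F :=
  forall i w, (i.+1 < m)%N -> size w = m -> gi i F w = s *: F w.

Lemma altg_cons m F a : altg m.+1 F -> altg m (fun u => F (a :: u)).
Proof. by move=> aF i w im sw; have := aF i.+1 (a :: w) im; rewrite /= sw; apply. Qed.

Lemma altg_cat m F p : altg (size p + m) F -> altg m (fun u => F (p ++ u)).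
Proof. by elim: p F => //= a p IHp F /(altg_cons a)/IHp. Qed.

Lemma altg_swap m F (a b : 'I_n) w : altg m F -> (size w).+2 = m -> (a < b)%N ->
  F [:: b, a & w] = s *: F [:: a, b & w].
Proof.
move=> aF sw ab; have := aF 0%N [:: a, b & w]; rewrite -sw /= => /(_ isT erefl).
by rewrite co_lt // scale0r addr0.
Qed.

(** On a repeated letter T acts by q, so (q + q^-1) F = 0 there. The scalar is nonzero because q^2 +
    1 has constant coefficient 1. *)
Lemma altg_rep m F (a : 'I_n) w : altg m F -> (size w).+2 = m -> F [:: a, a & w] = 0.
Proof.
move=> aF sw; have := aF 0%N [:: a, a & w]; rewrite -sw /= => /(_ isT erefl) /eqP.
rewrite co_eq scalerBl scale1r addrC subrK -subr_eq0 -scalerBl scaler_eq0.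
rewrite sgnE opprK => /orP[/eqP E|/eqP //].
have /eqP : q * (q + q^-1) = 0 by rewrite E mulr0.
rewrite mulrDr divff ?qv_neq0 // -tofracM -tofrac1 -tofracD tofrac_eq0.
move=> /eqP/(congr1 (fun p : {poly K} => p`_0)); rewrite coefD coefXM coef1 coef0 /= add0r.
by move/eqP; rewrite oner_eq0.
Qed.

Lemma altg_isrt F (j : 'I_n) w : altg (size w).+1 F -> sorted sli w ->
  if j \in w then F (j :: w) = 0
  else F (j :: w) = s ^+ count (fun y : 'I_n => (y < j)%N) w *: F (isrt j w).
Proof.
elim: w F => [|a w IHw] F aF Sw /=; first by rewrite expr0 scale1r.
rewrite inE; case: (ltngtP j a) => [ja|aj|/val_inj ->]; last first.
- by rewrite eqxx; apply: altg_rep aF _.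
- have -> : (j == a) = false by apply/eqP=> E; rewrite E ltnn in aj.
  have := IHw _ (altg_cons a aF) (path_sorted Sw); rewrite (altg_swap aF (erefl _) aj).
  by case: ifP => _ /= ->; rewrite ?scaler0 // add1n exprS scalerA.
- have -> : (j == a) = false by apply/eqP=> E; rewrite E ltnn in ja.
  have pj : path sli j w by case: w Sw {IHw aF} => //= b w /andP[ab ->]; rewrite (ltn_trans ja ab).
  have tr : transitive sli by move=> ? ? ?; apply: ltn_trans.
  have /allP jw := order_path_min tr pj.
  have -> : j \in w = false by apply/negP=> /jw; rewrite ltnn.
  have -> : count (fun y : 'I_n => (y < j)%N) w = 0%N.
    apply/eqP; rewrite -leqn0 leqNgt -has_count; apply/hasPn => y /jw jy.
    by rewrite -leqNgt ltnW.
  by rewrite expr0 scale1r.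
Qed.

Lemma altg_sort F u : altg (size u) F ->
  if uniq u then F u = s ^+ winv u *: F (enum [set x in u]) else F u = 0.
Proof.
elim: u F => [|j u IHu] F aF /=.
  by rewrite expr0 scale1r (sorted_enum (w := [::])).
have := IHu _ (altg_cons j aF); case: (boolP (uniq u)) => [Uu Fe|_ ->]; last first.
  by rewrite andbF.
have sE : size (enum [set x in u]) = size u by rewrite -cardE cardsE; apply/card_uniqP.
have := @altg_isrt F j (enum [set x in u]); rewrite sE => /(_ aF (enum_sorted _)).
rewrite mem_enum inE andbT; case: ifP => ju /= H; first by rewrite Fe H scaler0.
have -> : [set x in j :: u] = j |: [set x in u] by apply/setP=> x; rewrite !inE.
rewrite enum_isrt ?inE ?ju // Fe H scalerA -exprD addnC.
suff -> : count (fun y : 'I_n => (y < j)%N) (enum [set x in u])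
        = count (fun y : 'I_n => (y < j)%N) u by [].
suff /seq.permP : perm_eq (enum [set x in u]) u by apply.
apply: uniq_perm => //; first exact: enum_uniq.
by move=> x; rewrite mem_enum inE.
Qed.

End Operators.

Lemma gi_linear (V W : lmodType (Kq K)) (f : V -> W) i F w :
  (forall x y, f (x + y) = f x + f y) -> (forall c x, f (c *: x) = c *: f x) ->
  f (gi i F w) = gi i (fun u => f (F u)) w.
Proof.
move=> fD fZ; elim: i F w => [|i IHi] F [|a w] //=.
- by rewrite -(scale0r (0 : V)) fZ scale0r.
- by case: w => [|b w]; rewrite ?fD ?fZ // -(scale0r (0 : V)) fZ scale0r.
- by rewrite -(scale0r (0 : V)) fZ scale0r.
Qed.

Lemma gi_sum (V : lmodType (Kq K)) (I : Type) (r : seq I) (P : pred I) (F : I -> word -> V) i w :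
  gi i (fun u => \sum_(j <- r | P j) F j u) w = \sum_(j <- r | P j) gi i (F j) w.
Proof.
elim: i F w => [|i IHi] F [|a w] /=.
- by rewrite big1.
- by case: w => [|b w]; [rewrite big1 | rewrite scaler_sumr -big_split].
- by rewrite big1.
- exact: (IHi (fun j u => F j (a :: u))).
Qed.

Section Minors.
Variables (A : algType (Kq K)) (t : 'I_n -> 'I_n -> A).

Definition ltc (Y : {set 'I_n}) (j : 'I_n) : nat := #|[set y in Y | (y < j)%N]|.

Lemma count_enum (Y : {set 'I_n}) (j : 'I_n) :
  count (fun y : 'I_n => (y < j)%N) (enum Y) = ltc Y j.
Proof.
rewrite /ltc cardE -size_filter; congr size.
by rewrite /enum_mem -filter_predI; apply: eq_filter => y; rewrite /= !inE andbC.
Qed.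

(* Coefficients of the q-antisymmetric tensor indexed by the subset Y. *)
Fixpoint extv (u : word) (Y : {set 'I_n}) : Kq K :=
  if u is j :: u' then if j \in Y then s ^+ ltc Y j * extv u' (Y :\ j) else 0
  else (Y == set0)%:R.

(** Expansion along the first row, where [ltc Y j] counts the inversions created by choosing column
    j first. The rows form an arbitrary word, repetitions allowed, so that antisymmetry in the rows
    can be stated. *)
Fixpoint minor (w : word) (Y : {set 'I_n}) : A :=
  if w is i :: w' then \sum_(j in Y) s ^+ ltc Y j *: (t i j * minor w' (Y :\ j))
  else (Y == set0)%:R.

(* [pair w V] is the sum over words u of t_{w,u} V(u). *)
Fixpoint pair (w : word) (V : word -> A) : A :=
  if w is i :: w' then \sum_j t i j * pair w' (fun u => V (j :: u)) else V [::].

Lemma eq_pair w V V' : (forall u, size u = size w -> V u = V' u) -> pair w V = pair w V'.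
Proof.
elim: w V V' => [|i w IHw] V V' VV' /=; first exact: VV'.
by apply: eq_bigr => j _; congr (_ * _); apply: IHw => u su; apply: VV'; rewrite /= su.
Qed.

Lemma pairZ c w V : pair w (fun u => c *: V u) = c *: pair w V.
Proof.
elim: w V => //= i w IHw V; rewrite scaler_sumr.
by apply: eq_bigr => j _; rewrite IHw scalerAr.
Qed.

Lemma pairD w V V' : pair w (fun u => V u + V' u) = pair w V + pair w V'.
Proof.
elim: w V V' => //= i w IHw V V'; rewrite -big_split /=.
by apply: eq_bigr => j _; rewrite IHw mulrDr.
Qed.

Lemma pair0 w : pair w (fun=> 0) = 0.
Proof. by elim: w => //= i w IHw; rewrite big1 // => j _; rewrite IHw mulr0. Qed.

Lemma pair_cat w1 w2 V :
  pair (w1 ++ w2) V = pair w1 (fun u1 => pair w2 (fun u2 => V (u1 ++ u2))).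
Proof. by elim: w1 V => //= i w1 IHw V; apply: eq_bigr => j _; rewrite IHw. Qed.

Lemma minorE w Y : minor w Y = pair w (fun u => (extv u Y)%:A).
Proof.
elim: w Y => [|i w IHw] Y /=; first by case: eqP => _; rewrite ?scale1r ?scale0r.
rewrite big_mkcond; apply: eq_bigr => j _; case: ifP => jY; last first.
  by under eq_pair => u _ do rewrite scale0r; rewrite pair0 mulr0.
under eq_pair => u _ do rewrite -scalerA.
by rewrite pairZ -IHw -scalerAr.
Qed.

Lemma minor_size w (Y : {set 'I_n}) : #|Y| != size w -> minor w Y = 0.
Proof.
elim: w Y => [|i w IHw] Y /=; first by rewrite cards_eq0 => /negPf ->.
move=> sY; apply: big1 => j jY; rewrite IHw ?mulr0 ?scaler0 //.
by move: sY; rewrite (cardsD1 j) jY.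
Qed.

Lemma ltc_lt (Y : {set 'I_n}) (a b : 'I_n) : (a < b)%N -> a \in Y ->
  ltc Y b = (ltc (Y :\ a) b).+1.
Proof.
move=> ab aY; rewrite /ltc (cardsD1 a) inE aY ab add1n; congr (#|pred_of_set _|.+1).
by apply/setP=> x; rewrite !inE andbA.
Qed.

Lemma ltc_ge (Y : {set 'I_n}) (a b : 'I_n) : (b <= a)%N -> ltc (Y :\ a) b = ltc Y b.
Proof.
move=> ba; apply: eq_card => x; rewrite !inE.
by case: eqP => // ->; rewrite ltnNge ba /= andbF.
Qed.

Lemma extv_swap (a b : 'I_n) u Y : (a < b)%N -> extv [:: b, a & u] Y = s * extv [:: a, b & u] Y.
Proof.
move=> ab /=; have abE : (a == b) = false by apply/eqP=> E; rewrite E ltnn in ab.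
rewrite !inE (eq_sym b) abE /=; case: (boolP (a \in Y)) => aY; case: (boolP (b \in Y)) => bY;
  rewrite ?mulr0 //.
rewrite (ltc_lt ab aY) (ltc_ge _ (ltnW ab)).
have -> : Y :\ a :\ b = Y :\ b :\ a by apply/setP=> x; rewrite !inE andbCA.
by rewrite !mulrA -!exprS -!exprD; congr (s ^+ _ * _); lia.
Qed.

Lemma extv_alt m Y : altg m (fun u => (extv u Y)%:A : A).
Proof.
move=> i w; elim: i w Y m => [|i IHi] [|a w] Y m //=; first by case: m.
- case: w => [|b w] /=; first by case: m => [|[]].
  move=> _ _; rewrite scalerA -scalerDl scalerA; congr (_ *: _).
  rewrite -/(extv [:: b, a & w] Y) -/(extv [:: a, b & w] Y).
  case: (ltngtP a b) => [ab|ba|/val_inj <-].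
  + by rewrite co_lt // extv_swap // mul0r addr0.
  + rewrite co_gt // (@extv_swap b a) // sgnE.
    move: (extv _ _) => c; apply/eqP; rewrite -subr_eq0; apply/eqP.
    have E := mulfV (qv_neq0 K).
    have -> : c + (q - q^-1) * (- q^-1 * c) - - q^-1 * (- q^-1 * c)
      = c * (1 - q * q^-1) by ring.
    by rewrite E subrr mulr0.
  + have -> : extv [:: a, a & w] Y = 0 by rewrite /= !inE eqxx /= mulr0; case: ifP.
    by rewrite !mulr0 addr0.
- by case: m.
- case: m => // m im [sw]; case: (boolP (a \in Y)) => aY /=; last first.
    have := @gi_linear A A (fun=> 0) i (fun=> 0) w; rewrite addr0 => E.
    rewrite scale0r scaler0.
    by rewrite -E // => c x; rewrite scaler0.
  rewrite (@eq_gi _ i _ (fun u => s ^+ ltc Y a *: (extv u (Y :\ a))%:A)); last first.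
    by move=> u _; rewrite scalerA.
  rewrite -(@gi_linear A A (fun x => s ^+ ltc Y a *: x) i (fun u => (extv u (Y :\ a))%:A)) //.
  + by rewrite (IHi w (Y :\ a) m im sw) !scalerA mulrA (mulrC s).
  + by move=> x y; rewrite scalerDr.
  + by move=> c x; rewrite !scalerA mulrC.
Qed.

(** An antisymmetric V is determined by its values on increasing words. Grouping the words u by
    their set Y of letters, the q-signs collected for one Y add up to the minor on Y. *)
Lemma pair_alt w V : altg (size w) V ->
  pair w V = \sum_(Y : {set 'I_n}) minor w Y * V (enum Y).
Proof.
elim: w V => [|i w IHw] V aV /=.
  rewrite (bigD1 set0) //= eqxx mul1r big1 ?addr0 ?enum_set0 //.
  by move=> Y /negPf ->; rewrite mul0r.
under eq_bigr => j _ do rewrite (IHw _ (altg_cons j aV)) mulr_sumr.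
under [RHS]eq_bigr => Y _ do rewrite mulr_suml.
rewrite [RHS](exchange_big_dep predT) //=; apply: eq_bigr => j _.
rewrite (bigID (fun Z : {set 'I_n} => j \in Z)) /= big1 ?add0r; last first.
  move=> Z jZ; case: (eqVneq #|Z| (size w)) => sZ; last by rewrite minor_size // mul0r mulr0.
  have := @altg_isrt _ V j (enum Z); rewrite -cardE sZ => /(_ aV (enum_sorted _)).
  by rewrite mem_enum jZ => ->; rewrite !mulr0.
rewrite [RHS](reindex_onto (fun Z => j |: Z) (fun Y => Y :\ j)) /=; last first.
  by move=> Y jY; rewrite setD1K.
apply: congr_big => // [Z|Z jZ].
  rewrite !inE eqxx /=; apply/idP/eqP => [jZ|<-]; first by rewrite setU1K.
  by rewrite !inE eqxx.
rewrite setU1K //.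
case: (eqVneq #|Z| (size w)) => sZ; last by rewrite minor_size // !(mul0r, mulr0, scaler0).
have := @altg_isrt _ V j (enum Z); rewrite -cardE sZ => /(_ aV (enum_sorted _)).
rewrite mem_enum (negPf jZ) => ->; rewrite enum_isrt // count_enum -scalerAl -!scalerAr mulrA.
congr (_ ^+ _ *: _); apply: eq_card => x; rewrite !inE.
by case: eqP => // ->; rewrite ltnn (negPf jZ).
Qed.

Hypothesis rt : qmat_rel t.

(* Adjointness of the Hecke actions on row and column words. *)
Lemma pair_gi i w V : (i.+1 < size w)%N -> pair w (gi i V) = gi i (pair^~ V) w.
Proof.
elim: i w V => [|i IHi] [|a w] V //=.
  case: w => // b w _ /=.
  have -> : co K a b *: (\sum_j t a j * (\sum_j0 t b j0 * pair w (fun u => V [:: j, j0 & u])))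
    = \sum_c \sum_d (co K a b *: (t a c * t b d)) * pair w (fun u => V [:: c, d & u]).
    rewrite scaler_sumr; apply: eq_bigr => c _; rewrite mulr_sumr scaler_sumr.
    by apply: eq_bigr => d _; rewrite mulrA scalerAl.
  have -> : \sum_j t b j * (\sum_j0 t a j0 * pair w (fun u => V [:: j, j0 & u]))
    = \sum_c \sum_d (t b c * t a d) * pair w (fun u => V [:: c, d & u]).
    by apply: eq_bigr => c _; rewrite mulr_sumr; apply: eq_bigr => d _; rewrite mulrA.
  rewrite -big_split /=.
  have -> : \sum_j t a j * (\sum_j0 t b j0 * pair w (fun u => V [:: j0, j & u] + co K j j0 *: V [:: j, j0 & u]))
    = \sum_c \sum_d (t a c * t b d) * pair w (fun u => V [:: d, c & u])
      + \sum_c \sum_d (co K c d *: (t a c * t b d)) * pair w (fun u => V [:: c, d & u]).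
    rewrite -big_split; apply: eq_bigr => c _ /=; rewrite mulr_sumr -big_split /=.
    apply: eq_bigr => d _; rewrite pairD pairZ mulrA mulrDr; congr (_ + _).
    by rewrite -scalerAr -scalerAl.
  rewrite [X in X + _]exchange_big -big_split /=; apply: eq_bigr => c _.
  rewrite -!big_split /=; apply: eq_bigr => d _; rewrite -!mulrDl; congr (_ * _).
  have /eqP := qmat_frt rt a b c d; rewrite subr_eq => /eqP ->.
  by rewrite addrAC -scalerDl subrK addrC.
rewrite ltnS => iw; rewrite gi_sum; apply: eq_bigr => j _.
rewrite IHi // -(@gi_linear A A (fun x => t a j * x)) //.
  by move=> x y; rewrite mulrDr.
by move=> c x; rewrite scalerAr.
Qed.

(** Adjointness carries antisymmetry from columns to rows. Applied to [extv], it makes minors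
    antisymmetric in their row word. *)
Lemma altg_pair m V : altg m V -> altg m (pair^~ V).
Proof.
move=> aV i w im sw; rewrite -pair_gi ?sw // -pairZ; apply: eq_pair => u su.
by apply: aV; rewrite // su.
Qed.

Lemma minor_alt m Y : altg m (minor^~ Y).
Proof.
move=> i w im sw; rewrite minorE -(altg_pair (@extv_alt m Y) im sw).
by apply: eq_gi => u _; rewrite minorE.
Qed.

Lemma gi_pair i w (G : word -> word -> A) u :
  gi i (fun u1 => pair w (G u1)) u = pair w (fun u2 => gi i (G^~ u2) u).
Proof.
elim: w G => //= a w IHw G; rewrite gi_sum; apply: eq_bigr => j _.
rewrite -(IHw (fun u1 u2 => G u1 (j :: u2))) -(@gi_linear A A (fun x => t a j * x)) //.
  by move=> x y; rewrite mulrDr.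
by move=> c x; rewrite scalerAr.
Qed.

Lemma altg_pair_cat m w V : altg (m + size w) V ->
  altg m (fun u1 => pair w (fun u2 => V (u1 ++ u2))).
Proof.
move=> aV i u1 im su1; rewrite (gi_pair i w (fun u1 u2 => V (u1 ++ u2))) -pairZ.
apply: eq_pair => u2 su2; rewrite -gi_cat ?su1 // aV ?size_cat ?su1 ?su2 //.
by rewrite (leq_trans im) // leq_addr.
Qed.

(** This is [pair_alt] applied twice to [extv], first on the letters paired with w1, then on those
    paired with w2. The coefficient vanishes unless Y is the disjoint union of Y1 and Y2. *)
Lemma minor_laplace w1 w2 Y : minor (w1 ++ w2) Y =
  \sum_(Y1 : {set 'I_n}) \sum_(Y2 : {set 'I_n})
    extv (enum Y1 ++ enum Y2) Y *: (minor w1 Y1 * minor w2 Y2).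
Proof.
rewrite minorE pair_cat pair_alt; last first.
  exact: (altg_pair_cat (@extv_alt (size w1 + size w2) Y)).
apply: eq_bigr => Y1 _; case: (eqVneq #|Y1| (size w1)) => s1; last first.
  by rewrite minor_size // mul0r big1 // => Y2 _; rewrite mul0r scaler0.
rewrite pair_alt; last first.
  by apply: (@altg_cat _ (size w2) (fun u => (extv u Y)%:A) (enum Y1) (@extv_alt _ Y)).
by rewrite mulr_sumr; apply: eq_bigr => Y2 _; rewrite mulrA -scalerAr mulr1.
Qed.

Lemma minor_sort w Y :
  if uniq w then minor w Y = s ^+ winv w *: minor (enum [set x in w]) Y
  else minor w Y = 0.
Proof. exact: (altg_sort (@minor_alt (size w) Y)). Qed.

End Minors.
End Alternating.

(** * The braiding *)

(** The braid relation T_1 T_2 T_1 = T_2 T_1 T_2, checked for each relative order of three letters.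
    H and J are the values of T_2 T_1 F and T_1 T_2 F. *)
Lemma hecke_braid (R : fieldType) (q : R) m (co : 'I_m -> 'I_m -> R)
    (F : 'I_m -> 'I_m -> 'I_m -> R) (a b c : 'I_m) : q != 0 ->
  (forall x y : 'I_m, (x < y)%N -> co x y = 0) ->
  (forall x, co x x = q - 1) ->
  (forall x y : 'I_m, (y < x)%N -> co x y = q - q^-1) ->
  let H x y z := F z x y + co x z * F x z y + co y z * (F y x z + co x y * F x y z) in
  let J x y z := F y z x + co x z * F y x z + co x y * (F x z y + co y z * F x y z) in
  H b a c + co a b * H a b c = J a c b + co b c * J a b c.
Proof.
move=> q0 lt ee gt H J; rewrite /H /J {H J}.
case: (ltngtP a b) => ab; case: (ltngtP b c) => bc; case: (ltngtP a c) => ac.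
all: try by [lia | rewrite ?(lt _ _ ab) ?(lt _ _ ac) ?(lt _ _ bc) ?(gt _ _ ab) ?(gt _ _ ac) ?(gt _ _ bc); ring].
all: try move/val_inj: ab => ab; try move/val_inj: bc => bc; try move/val_inj: ac => ac.
all: rewrite -?ab -?bc -?ac ?ee; rewrite -?ab -?bc -?ac in ab bc ac.
all: try rewrite (lt _ _ ab); try rewrite (gt _ _ ab); try rewrite (lt _ _ ac); try rewrite (gt _ _ ac); try rewrite (lt _ _ bc); try rewrite (gt _ _ bc).
all: try by field.
by rewrite -ab !ee.
Qed.

Section Braiding.
Variables (K : fieldType) (n : nat).
Local Notation q := (qv K).
Local Notation s := ((- qv K)^-1).
Local Notation word := (seq 'I_n).

Section Ops.
Variable V : lmodType (Kq K).
Implicit Type F : word -> V.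

(* T_m ... T_1, which moves the first letter past the next m letters. *)
Fixpoint cyc m F (w : word) : V :=
  if m is m'.+1 then if w is a :: w' then cyc m' (fun u => gop F (a :: u)) w' else 0
  else F w.

Lemma eq_cyc m F F' w : (forall u, size u = size w -> F u = F' u) -> cyc m F w = cyc m F' w.
Proof.
elim: m F F' w => [|m IHm] F F' [|a w] //= FF'; try exact: FF'.
apply: IHm => u su; apply: (@eq_gi K n V 0 F F' (a :: u)) => v.
by rewrite /= su; apply: FF'.
Qed.

Lemma cycD m F F' w : cyc m (fun u => F u + F' u) w = cyc m F w + cyc m F' w.
Proof.
elim: m F F' w => [|m IHm] F F' [|a w] //=; first by rewrite addr0.
rewrite -IHm; apply: eq_cyc => -[|b u] _ /=; first by rewrite addr0.
by rewrite scalerDr addrACA.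
Qed.

Lemma cycZ c m F w : cyc m (fun u => c *: F u) w = c *: cyc m F w.
Proof.
elim: m F w => [|m IHm] F [|a w] //=; first by rewrite scaler0.
rewrite -IHm; apply: eq_cyc => -[|b u] _ /=; first by rewrite scaler0.
by rewrite scalerDr !scalerA (mulrC c).
Qed.

Lemma giDZ c i F F' w : gi i (fun u => F u + c *: F' u) w = gi i F w + c *: gi i F' w.
Proof.
elim: i F F' w => [|i IHi] F F' [|a w] //=; rewrite ?scaler0 ?addr0 //.
  case: w => [|b w] /=; first by rewrite scaler0 addr0.
  by rewrite !scalerDr !scalerA addrACA (mulrC (co K a b)).
Qed.

Lemma gop_shift i F a u : gi i.+1 (fun v => gop F (a :: v)) u = gop (gi i.+2 F) (a :: u).
Proof. by case: u => [|b u] //=; rewrite giDZ. Qed.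

End Ops.

Lemma cyc_linear (V W : lmodType (Kq K)) (f : V -> W) m F w :
  (forall x y, f (x + y) = f x + f y) -> (forall c x, f (c *: x) = c *: f x) ->
  f (cyc m F w) = cyc m (fun u => f (F u)) w.
Proof.
move=> fD fZ; have f0 : f 0 = 0 by rewrite -(scale0r (0 : V)) fZ scale0r.
elim: m F w => [|m IHm] F [|a w] //=; rewrite IHm.
by apply: eq_cyc => -[|b u] _ //=; rewrite fD fZ.
Qed.

Lemma cyc_sum (V : lmodType (Kq K)) (I : Type) (r : seq I) (F : I -> word -> V) m w :
  cyc m (fun u => \sum_(j <- r) F j u) w = \sum_(j <- r) cyc m (F j) w.
Proof.
elim: r => [|j r IHr].
  rewrite [RHS]big_nil -[RHS](scale0r (cyc m (fun=> 0) w)) -cycZ.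
  by apply: eq_cyc => u _; rewrite big_nil scaler0.
rewrite big_cons -IHr -cycD; apply: eq_cyc => u _; exact: big_cons.
Qed.

Lemma gop_braid (F : word -> (Kq K)^o) a b u :
  gop (gi 1 (gop F)) [:: a, b & u] = gi 1 (gop (gi 1 F)) [:: a, b & u].
Proof.
case: u => [|c u] /=; first by rewrite scaler0 addr0.
have := (@hecke_braid _ q n (@co K n) (fun x y z => F [:: x, y, z & u]) a b c (qv_neq0 K)
  (@co_lt K n) (@co_eq K n) (@co_gt K n)).
by rewrite /= /GRing.scale /=; apply.
Qed.

(** One braid relation, and commutation with the distant factors, lowers the index of a generator by
    one across the cyclic product. Antisymmetry in the last m of m + 1 letters thus becomes
    antisymmetry in the first m. *)
Lemma gi_cyc i m (F : word -> (Kq K)^o) w : (i.+1 < m)%N ->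
  gi i (cyc m F) w = cyc m (gi i.+1 F) w.
Proof.
elim: m i F w => [|m IHm] [|i] F [|a w] //=.
  case: m IHm => // m IHm _; case: w => [|b w] //=.
  rewrite -cycZ -cycD; apply: eq_cyc => u _.
  exact: (gop_braid F a b u).
rewrite ltnS => im; rewrite IHm //; apply: eq_cyc => u _.
exact: gop_shift.
Qed.


Lemma co_laurent a b : is_laurent (@co K n a b).
Proof.
have L1 : is_laurent (1 : Kq K) by apply/is_laurentP/is_poly1.
have Lq := is_laurentq K; have LV := is_laurentVq K.
rewrite /co; case: ifP => _; first exact/is_laurentP/is_poly0.
by case: ifP => _; apply: is_laurentD => //; apply: is_laurentN.
Qed.

Lemma cyc_laurent m (F : word -> (Kq K)^o) w :
  (forall u, is_laurent (F u)) -> is_laurent (cyc m F w : Kq K).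
Proof.
elim: m F w => [|m IHm] F [|a w] //= LF; try exact/is_laurentP/is_poly0.
apply: IHm => -[|b u] /=; first exact/is_laurentP/is_poly0.
by apply: is_laurentD => //; apply: is_laurentM => //; apply: co_laurent.
Qed.

Lemma cyc_pair (A : algType (Kq K)) (t : 'I_n -> 'I_n -> A) m w V : qmat_rel t ->
  size w = m.+1 -> cyc m (pair t ^~ V) w = pair t w (cyc m V).
Proof.
move=> rt; elim: m w V => [|m IHm] [|a w] V //= [sw].
have -> : cyc m (fun u => gop (pair t ^~ V) (a :: u)) w
   = cyc m (fun u => \sum_j t a j * pair t u (fun v => gop V (j :: v))) w.
  apply: eq_cyc => u; rewrite sw => su.
  by have := @pair_gi K n A t rt 0 (a :: u) V; rewrite /= su => <-.
rewrite cyc_sum; apply: eq_bigr => j _; rewrite -IHm //.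
rewrite -(@cyc_linear A A (fun x => t a j * x)) //.
  by move=> x y; rewrite mulrDr.
by move=> c x; rewrite scalerAr.
Qed.

Lemma extv_laurent u (Y : {set 'I_n}) : is_laurent (extv K u Y).
Proof.
elim: u Y => [|j u IHu] Y /=.
  by case: eqP => _; apply/is_laurentP; [exact: is_poly1 | exact: is_poly0].
case: ifP => _; last exact/is_laurentP/is_poly0.
apply: is_laurentM => //; apply: is_laurentX; rewrite sgnE.
exact/is_laurentN/is_laurentVq.
Qed.

(* The tensor product of the letter j with the q-antisymmetric tensor of Y. *)
Definition jext (j : 'I_n) (Y : {set 'I_n}) (u : word) : (Kq K)^o :=
  if u is i :: u' then if i == j then extv K u' Y else 0 else 0.

Lemma gi_jext i m j Y w : (i.+1 < m)%N -> size w = m.+1 ->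
  gi i.+1 (jext j Y) w = s *: jext j Y w.
Proof.
case: w => //= a w im [sw]; case: eqP => _; last first.
  by rewrite scaler0; elim: i w {im sw} => [|i IHi] [|b w] //=; case: w => //= *; rewrite scaler0 addr0.
have := @extv_alt K n (Kq K)^o m Y i w im sw.
rewrite (@eq_gi K n (Kq K)^o i _ (fun u => extv K u Y)).
  by move=> ->; rewrite /GRing.scale /= mulr1.
by move=> u _; rewrite /GRing.scale /= mulr1.
Qed.

Lemma cyc_jext_alt i m j Y w : (i.+1 < m)%N -> size w = m.+1 ->
  gi i (cyc m (jext j Y)) w = s *: cyc m (jext j Y) w.
Proof.
move=> im sw; rewrite gi_cyc // -cycZ; apply: eq_cyc => u su.
by rewrite (@gi_jext i m) // su.
Qed.

Lemma pair_cyc_jext (A : algType (Kq K)) (t : 'I_n -> 'I_n -> A) m w i j Y :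
  size w = m ->
  pair t (rcons w i) (fun u => (cyc m (jext j Y) u)%:A) =
  \sum_(Z : {set 'I_n}) \sum_k
    cyc m (jext j Y) (rcons (enum Z) k) *: (minor t w Z * t i k).
Proof.
move=> sw; rewrite -cats1 pair_cat pair_alt.
  apply: eq_bigr => Z _; rewrite /= mulr_sumr; apply: eq_bigr => k _.
  by rewrite cats1 -!scalerAr mulr1.
move=> l u lm su; rewrite gi_pair -pairZ; apply: eq_pair => v sv.
have -> : gi l (fun u0 => (cyc m (jext j Y) (u0 ++ v))%:A) u
   = (gi l (fun u0 => cyc m (jext j Y) (u0 ++ v)) u)%:A :> A.
  rewrite -(@gi_linear K n (Kq K)^o A (fun x => (x : Kq K)%:A)) //.
    by move=> x y; rewrite scalerDl.
  by move=> c x; rewrite scalerA.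
rewrite sw in lm su.
rewrite -(gi_cat (fun u0 => cyc m (jext j Y) u0)) ?su // cyc_jext_alt //.
  by rewrite scalerA.
by rewrite size_cat su sv addn1.
Qed.

Local Notation elt := (qelem K n).

Definition mnr (w : word) (Y : {set 'I_n}) : elt := fun A t => minor t w Y.

(** The generators are invertible over K[q, 1/q]. Values of T F on ascents give F on descents, those
    on descents then give F on ascents, and on repeated letters T is multiplication by q. *)
Lemma cyc_back (P : elt -> Prop) m
    (F : forall (A : algType (Kq K)), ('I_n -> 'I_n -> A) -> word -> A) :
  submod (@is_laurent K) P ->
  (forall w, size w = m.+1 -> P (fun A t => cyc m (F A t) w)) ->
  forall w, size w = m.+1 -> P (fun A t => F A t w).
Proof.
move=> mP; elim: m F => [|m IHm] F PF; first exact: PF.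
have PG w : size w = m.+2 -> P (fun A t => gop (F A t) w).
  case: w => //= a w [sw]; apply: (IHm (fun A t u => gop (F A t) (a :: u))) => // u su.
  by apply: (PF (a :: u)); rewrite /= su.
case=> [|a [|b w]] // sw.
have sw' : size [:: b, a & w] = m.+2 by [].
have lt (c d : 'I_n) : size [:: c, d & w] = m.+2 -> (c < d)%N ->
    P (fun A t => F A t [:: d, c & w]).
  move=> s1 cd; apply: (submod_eq mP _ (PG _ s1)) => A t _ /=.
  by rewrite co_lt // scale0r addr0.
case: (ltngtP a b) => [ab|ba|/val_inj ab].
- have L := is_laurentN (co_laurent b a).
  apply: (submod_eq mP _ (submodD mP (PG _ sw') (submodZ mP L (lt _ _ sw ab)))) => A t _.
  by rewrite /eltD /eltZ /= scaleNr addrK.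
- exact: lt.
- rewrite -ab in sw *; apply: (submod_eq mP _ (submodZ mP (is_laurentVq K) (PG _ sw))) => A t _.
  by rewrite /eltZ /= co_eq scalerBl scale1r addrC subrK scalerA mulVf ?qv_neq0 // scale1r.
Qed.

Lemma mnr_sort (P : elt -> Prop) w Y z : submod (@is_laurent K) P ->
  (uniq w -> P (eltM (mnr (enum [set x in w]) Y) z)) -> P (eltM (mnr w Y) z).
Proof.
move=> mP; case: (boolP (uniq w)) => Uw H.
  have L : is_laurent (s ^+ winv w) by apply: is_laurentX; rewrite sgnE; apply/is_laurentN/is_laurentVq.
  apply: (submod_eq mP _ (submodZ mP L (H isT))) => A t rt.
  by have := minor_sort rt w Y; rewrite Uw /eltM /eltZ /mnr => ->; rewrite scalerAl.
apply: (submod_eq mP _ (submod0 mP)) => A t rt.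
by have := minor_sort rt w Y; rewrite (negPf Uw) /eltM /mnr => ->; rewrite mul0r.
Qed.

End Braiding.

(** * Moving monomials past minors, and the transpose symmetry of minors *)

Section Exchange.
Variables (K : fieldType) (n : nat).
Local Notation q := (qv K).
Local Notation s := ((- qv K)^-1).
Local Notation elt := (qelem K n).
Local Notation mnr := (@mnr K n).
Local Notation gen := (@gen K n).
Local Notation mon := (@mon K n).
Local Notation laurmon := (@laurmon K n).
Local Notation laur := (@is_laurent K).

(* The image under [cyc] of j (x) (antisymmetric) is (antisymmetric) (x) letter, by the
   braid relation; [cyc_back] then inverts [cyc] over K[q, 1/q]. *)
Lemma gen_mnr_swap (P : elt -> Prop) i j w Y : submod laur P ->
  (forall (X Z : {set 'I_n}) i' j', #|X| = size w -> #|Z| = size w ->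
     P (eltM (mnr (enum X) Z) (gen i' j'))) ->
  P (eltM (gen i j) (mnr w Y)).
Proof.
move=> mP HP.
pose F (A : algType (Kq K)) (t : 'I_n -> 'I_n -> A) u := pair t u (fun v => (jext K j Y v)%:A).
(* The tensor [jext] keeps only the words starting with j, so this pairing is t_ij times the
   minor. *)
apply: (@submod_eq _ _ _ _ mP (fun A t => F A t (i :: w))).
  move=> A t rt; rewrite /F /eltM /gen /= (bigD1 j) //= eqxx -minorE big1 ?addr0 //.
  by move=> k /negPf kj; rewrite kj scale0r pair0 mulr0.
apply: (@cyc_back K n P (size w) F) => //.
case/lastP=> // w' i'; rewrite size_rcons => -[sw'].
have L u : is_laurent (jext K j Y u : Kq K).
  case: u => [|k u] /=; first exact/is_laurentP/is_poly0.
  by case: eqP => _; [exact: extv_laurent | exact/is_laurentP/is_poly0].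
apply: (@submod_eq _ _ _ _ mP (fun A t => \sum_(Z : {set 'I_n})
   (\sum_k cyc (size w) (jext K j Y) (rcons (enum Z) k) *: (minor t w' Z * t i' k)))).
  move=> A t rt; rewrite /F cyc_pair ?size_rcons ?sw' // -(pair_cyc_jext t i' j Y sw').
  apply: eq_pair => u _.
  apply: (@cyc_linear K n (Kq K)^o A (fun x => (x : Kq K)%:A)) => [x y|c x].
    by rewrite scalerDl.
  by rewrite scalerA.
refine (submod_sum _ mP _) => Z _.
refine (submod_sum _ mP _) => k _; apply: (@submodZ _ _ _ _ mP _ (eltM (mnr w' Z) (gen i' k))).
  exact: cyc_laurent.
case: (eqVneq #|Z| (size w)) => sZ; last first.
  apply: (submod_eq mP _ (submod0 mP)) => A t rt.
  by rewrite /eltM /mnr minor_size ?mul0r // sw'.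
apply: mnr_sort => // Uw; apply: HP => //.
by rewrite cardsE -sw'; apply/card_uniqP.
Qed.

(** The generators of c cross the minor one by one. Index sets and generators change, but the size
    of the minor does not, and the straightening induction relies on that size. *)
Lemma mon_mnr_swap (P : elt -> Prop) k l m c z (X Y : {set 'I_n}) : submod laur P ->
  (forall (X Z : {set 'I_n}) e, #|X| = m -> #|Z| = m -> laurmon (k + l) e ->
     P (eltM (mnr (enum X) Z) e)) ->
  laurmon k c -> laurmon l z -> #|X| = m -> #|Y| = m ->
  P (eltM c (eltM (mnr (enum X) Y) z)).
Proof.
move=> mP HP Lc Lz sX sY; move: c Lc; apply: span_min; first exact: submod_mulr.
move=> _ [w [u [sw su ->]]].
elim: w u k P mP HP sw su => [|i w IHw] [|j u] [|k] P mP HP //=.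
  move=> _ _; apply: (submod_eq mP _ (HP X Y z sX sY Lz)) => A t rt.
  by rewrite /eltM /mon qmonomial_nil mul1r.
move=> [sw] [su].
have := IHw u k (fun x => P (eltM (gen i j) x)) (submod_mull _ mP) _ sw su.
move=> H; apply: (submod_eq mP _ (H _)).
  by move=> A t rt; rewrite /eltM /mon qmonomial_cons !mulrA.
move=> X1 Z1 e sX1 sZ1 Le.
have := @gen_mnr_swap (fun x => P (eltM x e)) i j (enum X1) Z1 (submod_mulr _ mP).
rewrite -cardE sX1 => H1; apply: (submod_eq mP _ (H1 _)).
  by move=> A t rt; rewrite /eltM mulrA.
move=> X2 Z2 i' j' sX2 sZ2.
apply: (submod_eq mP _ (HP X2 Z2 (eltM (gen i' j') e) sX2 sZ2 _)).
  by move=> A t rt; rewrite /eltM mulrA.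
by rewrite addSn -add1n; apply: span_mon_mul => //; apply: span_gen_mon.
Qed.

Lemma sgn_laurent : laur s.
Proof. by rewrite sgnE; apply/is_laurentN/is_laurentVq. Qed.

Lemma mnr_laurmon w Y : laurmon (size w) (mnr w Y).
Proof.
elim: w Y => [|i w IHw] Y /=.
  case: (eqVneq Y set0) => Y0.
    by apply: (span_eq _ (span_mon1 _ _)) => A t _; rewrite /mnr /= Y0 eqxx.
  by apply: (span_eq _ (span0 _ _)) => A t _; rewrite /mnr /= (negPf Y0).
refine (submod_sum _ (span_submod _ _) _) => j _; apply: (@spanZ _ _ _ _ _ (eltM (gen i j) (mnr w (Y :\ j)))).
  exact/is_laurentX/sgn_laurent.
by rewrite -add1n; exact: (span_mon_mul (span_gen_mon _ i j) (IHw (Y :\ j))).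
Qed.

Definition ttr (A : Type) (t : 'I_n -> 'I_n -> A) := fun i j => t j i.

Lemma qmat_rel_tr (A : algType (Kq K)) (t : 'I_n -> 'I_n -> A) : qmat_rel t -> qmat_rel (ttr t).
Proof.
case=> r1 r2 r3 r4; rewrite /ttr; split=> [i k l kl|i j k ij|i j k l ij kl|i j k l ij kl].
- exact: r2.
- exact: r1.
- by rewrite (r3 k l i j).
- by rewrite (r4 k l i j) // (r3 k l i j).
Qed.

Lemma enum_min (Z : {set 'I_n}) x : x \in Z -> (forall z : 'I_n, z \in Z -> (x <= z)%N) ->
  enum Z = x :: enum (Z :\ x).
Proof.
move=> xZ xmin; apply: sli_eq; first exact: enum_sorted.
  have := enum_sorted (Z :\ x); case E: (enum _) => [|y w] //= ->; rewrite andbT.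
  have : y \in enum (Z :\ x) by rewrite E mem_head.
  rewrite mem_enum !inE => /andP[yx /xmin]; rewrite leq_eqVlt => /orP[/eqP/val_inj xy|//].
  by rewrite xy eqxx in yx.
by move=> y; rewrite !(mem_enum, inE); case: eqP => // ->.
Qed.

Lemma set_min (Z : {set 'I_n}) : Z != set0 ->
  exists2 x, x \in Z & forall z : 'I_n, z \in Z -> (x <= z)%N.
Proof. by case/set0Pn=> z zZ; case: (arg_minnP val zZ) => x xZ xmin; exists x. Qed.

Lemma ltc_min (Z : {set 'I_n}) (x : 'I_n) : (forall z : 'I_n, z \in Z -> (x <= z)%N) -> ltc Z x = 0%N.
Proof.
move=> xmin; apply: eq_card0 => z; rewrite !inE; apply/negbTE; rewrite negb_and.
by case: (boolP (z \in Z)) => //= /xmin; rewrite -leqNgt.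
Qed.

(* Expand along the least row and the least column; the mixed terms agree because
   antidiagonal generators commute. *)
Lemma minor_tr (A : algType (Kq K)) (t : 'I_n -> 'I_n -> A) (X Y : {set 'I_n}) : qmat_rel t ->
  minor t (enum X) Y = minor (ttr t) (enum Y) X.
Proof.
move=> rt; case: (eqVneq #|X| #|Y|) => sXY; last first.
  by rewrite !minor_size // -cardE // eq_sym.
move: {2}#|X| (erefl #|X|) sXY => m; move: X Y; elim/ltn_ind: m => m IHm X Y sX sXY.
case: (eqVneq X set0) => [X0|X0].
  have -> : Y = set0 by apply/eqP; rewrite -cards_eq0 -sXY X0 cards0.
  by rewrite X0 enum_set0 /= eqxx.
have Y0 : Y != set0 by rewrite -cards_eq0 -sXY cards_eq0.
have [x xX xmin] := set_min X0; have [y yY ymin] := set_min Y0.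
have xmin' (z : 'I_n) : z \in X :\ x -> (x < z)%N.
  rewrite !inE => /andP[zx /xmin]; rewrite leq_eqVlt => /orP[/eqP/val_inj xz|//].
  by rewrite xz eqxx in zx.
have ymin' (z : 'I_n) : z \in Y :\ y -> (y < z)%N.
  rewrite !inE => /andP[zx /ymin]; rewrite leq_eqVlt => /orP[/eqP/val_inj xz|//].
  by rewrite xz eqxx in zx.
have sX1 : #|X| = #|X :\ x|.+1 by rewrite (cardsD1 x) xX.
have sY1 : #|Y| = #|Y :\ y|.+1 by rewrite (cardsD1 y) yY.
rewrite (enum_min xX xmin) (enum_min yY ymin) /= (bigD1 y) //= [RHS](bigD1 x) //=.
rewrite !ltc_min // (IHm #|X :\ x|) //; [|by rewrite -sX sX1|by apply: succn_inj; rewrite -sX1 -sY1].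
congr (_ + _).
have E (Z : {set 'I_n}) z0 (G : 'I_n -> A) :
    \sum_(z in Z | z != z0) G z = \sum_(z in Z :\ z0) G z.
  by apply: eq_bigl => z; rewrite !inE andbC.
rewrite !E.
transitivity (\sum_(y1 in Y :\ y) \sum_(x1 in X :\ x)
  s ^+ (ltc (Y :\ y) y1 + ltc (X :\ x) x1).+1 *:
    (t x y1 * t x1 y * minor (ttr t) (enum (Y :\ y :\ y1)) (X :\ x :\ x1))).
  apply: eq_bigr => y1 y1Y; have [y1y y1Y'] := setD1P y1Y.
  have yY1 : y \in Y :\ y1 by rewrite !inE eq_sym y1y.
  rewrite (IHm #|X :\ x|) //; first last.
  - apply: succn_inj; rewrite -sX1 sXY (cardsD1 y1) y1Y'; lia.
  - by rewrite -sX sX1.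
  rewrite (@enum_min (Y :\ y1) y) //; last by move=> z /setD1P[_ /ymin].
  rewrite /= mulr_sumr scaler_sumr; apply: eq_bigr => x1 x1X.
  have -> : Y :\ y1 :\ y = Y :\ y :\ y1 by apply/setP=> z; rewrite !inE andbCA.
  rewrite -scalerAr scalerA -exprD mulrA (ltc_lt (ymin' _ y1Y) yY).
  by rewrite addSn.
rewrite exchange_big; apply: eq_bigr => x1 x1X /=.
have [x1x x1X'] := setD1P x1X.
have xX1 : x \in X :\ x1 by rewrite !inE eq_sym x1x.
have sx1 : #|X| = #|X :\ x1|.+1 by rewrite (cardsD1 x1) x1X'.
rewrite -(IHm #|X :\ x1|) //; first last.
- by apply: succn_inj; rewrite -sx1 -sY1.
- by rewrite -sX sx1.
rewrite (@enum_min (X :\ x1) x) //; last by move=> z /setD1P[_ /xmin].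
rewrite /= mulr_sumr scaler_sumr; apply: eq_bigr => y1 y1Y.
have [y1y y1Y'] := setD1P y1Y.
have -> : X :\ x1 :\ x = X :\ x :\ x1 by apply/setP=> z; rewrite !inE andbCA.
have sx2 : #|X| = #|X :\ x :\ x1|.+2 by rewrite sX1 (cardsD1 x1) x1X.
have sy2 : #|Y| = #|Y :\ y :\ y1|.+2 by rewrite sY1 (cardsD1 y1) y1Y.
rewrite -(IHm #|X :\ x :\ x1|) //; first last.
- by apply: succn_inj; apply: succn_inj; rewrite -sx2 -sy2.
- by rewrite -sX sx2.
rewrite -scalerAr scalerA -exprD mulrA (ltc_lt (xmin' _ x1X) xX).
have [_ _ r3 _] := rt.
have {}r3 := r3 x x1 y y1 (xmin' _ x1X) (ymin' _ y1Y).
by rewrite [ttr t y x1]/ttr -r3 addSn addnC.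
Qed.

Lemma minor_laplace2 (A : algType (Kq K)) (t : 'I_n -> 'I_n -> A) w1 w2 Y : qmat_rel t ->
  minor t (w1 ++ w2) Y = \sum_(J : {set 'I_n} * {set 'I_n})
    extv K (enum J.1 ++ enum J.2) Y *: (minor t w1 J.1 * minor t w2 J.2).
Proof. by move=> rt; rewrite minor_laplace // pair_big. Qed.

End Exchange.

(** * Garnir relations *)

Section Garnir.
Variables (K : fieldType) (n : nat).
Local Notation q := (qv K).
Local Notation s := ((- qv K)^-1).
Local Notation word := (seq 'I_n).
Local Notation elt := (qelem K n).
Local Notation mnr := (@mnr K n).
Local Notation laurmon := (@laurmon K n).
Local Notation laur := (@is_laurent K).
Local Notation sli := (fun x y : 'I_n => (x < y)%N).

Lemma extv_supp u (Z : {set 'I_n}) : extv K u Z != 0 -> uniq u /\ [set x in u] = Z.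
Proof.
elim: u Z => [|j u IHu] Z /=.
  case: (eqVneq Z set0) => [-> _|_]; last by rewrite eqxx.
  by split=> //; apply/setP=> x; rewrite !inE.
case: ifP => [jZ|_]; last by rewrite eqxx.
rewrite mulf_eq0 negb_or => /andP[_ /IHu[Uu uZ]].
have ju : j \notin u.
  by have := setD11 j Z; rewrite -uZ inE => ->.
split; first by rewrite ju.
by rewrite -(setD1K jZ) -uZ; apply/setP=> x; rewrite !inE.
Qed.

Lemma extv_set (u : word) : uniq u -> exists e, extv K u [set x in u] = s ^+ e.
Proof.
elim: u => [|j u IHu] /=.
  exists 0%N; have -> : [set x : 'I_n | false] = set0 by apply/setP=> x; rewrite !inE.
  by rewrite eqxx.
case/andP=> ju /IHu[e Ee]; exists (ltc [set x in j :: u] j + e)%N.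
rewrite inE mem_head exprD -Ee; congr (_ * extv K _ _); apply/setP=> x; rewrite !inE.
by case: eqP => //= ->; rewrite (negPf ju).
Qed.

Definition msum (X : {set 'I_n}) : nat := \sum_(x in X) x.

Lemma msum_seq (w : word) : uniq w -> msum [set x in w] = (\sum_(x <- w) x)%N.
Proof. by move=> Uw; rewrite /msum big_uniq //; apply: eq_bigl => x; rewrite inE. Qed.

(** The elements of X outside S come from D and lie below b, while those of S outside X are at least
    b; there are equally many of both, and at least one. *)
Lemma msum_exchange (X S D : {set 'I_n}) b : X \subset D :|: S -> #|X| = #|S| -> X != S ->
  (forall x : 'I_n, x \in D -> (x < b)%N) -> (forall x : 'I_n, x \in S -> (b <= x)%N) ->
  (msum X < msum S)%N.
Proof.
move=> XDS sXS XS Db Sb.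
rewrite /msum (big_setID S) [X in (_ < X)%N](big_setID X) /= setIC ltn_add2l.
have k0 : #|X :\: S| = #|S :\: X|.
  by have := cardsID S X; have := cardsID X S; rewrite setIC sXS; lia.
have kpos : (0 < #|S :\: X|)%N.
  rewrite card_gt0 setD_eq0; apply: contra XS => SX.
  by rewrite eq_sym eqEcard SX sXS leqnn.
apply: (@leq_trans (#|X :\: S| * b)).
  rewrite -sum_nat_const; apply: (@leq_trans (\sum_(x in X :\: S) (x + 1)%N)).
    rewrite big_split /= sum1_card k0; lia.
  apply: leq_sum => x /setDP[xX xS]; rewrite addn1; apply: Db.
  by move/subsetP: XDS => /(_ x xX); rewrite inE (negPf xS) orbF.
rewrite k0 -sum_nat_const; apply: leq_sum => x /setDP[xS _]; exact: Sb.
Qed.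

(** After a Laplace expansion of both minors, the sum over all splittings of Z is a Laplace
    expansion of the transposed matrix. It reassembles into single minors whose row set is the whole
    of Z. *)
Lemma garnir_sum (P : elt -> Prop) (c d : word) (Z Y Y' : {set 'I_n}) : submod laur P ->
  (forall x (U : {set 'I_n}) e, laurmon (size c) x -> #|U| = #|Z| -> laurmon (size d) e ->
     P (eltM x (eltM (mnr (enum Z) U) e))) ->
  P (fun A t => \sum_(X : {set 'I_n} * {set 'I_n}) extv K (enum X.1 ++ enum X.2) Z *:
       (minor t (c ++ enum X.1) Y * minor t (enum X.2 ++ d) Y')).
Proof.
move=> mP HP.
apply: (@submod_eq _ _ _ _ mP (fun A t =>
  \sum_(J : {set 'I_n} * {set 'I_n}) \sum_(L : {set 'I_n} * {set 'I_n})
    (extv K (enum J.1 ++ enum J.2) Y * extv K (enum L.1 ++ enum L.2) Y') *: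
    (minor t c J.1 * (minor (ttr t) (enum J.2 ++ enum L.1) Z * minor t d L.2)))).
  move=> A t rt; apply/esym.
  transitivity (\sum_(X : {set 'I_n} * {set 'I_n}) \sum_(J : {set 'I_n} * {set 'I_n})
      \sum_(L : {set 'I_n} * {set 'I_n})
    (extv K (enum J.1 ++ enum J.2) Y * extv K (enum L.1 ++ enum L.2) Y') *:
    (minor t c J.1 * (extv K (enum X.1 ++ enum X.2) Z *:
       (minor t (enum X.1) J.2 * minor t (enum X.2) L.1) * minor t d L.2))).
    apply: eq_bigr => X _; rewrite !minor_laplace2 // mulr_suml scaler_sumr.
    apply: eq_bigr => J _; rewrite mulr_sumr scaler_sumr; apply: eq_bigr => L _.
    rewrite -!scalerAl -!scalerAr !scalerA !mulrA; congr (_ *: _).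
    by rewrite -mulrA mulrC.
  rewrite exchange_big; apply: eq_bigr => J _; rewrite exchange_big; apply: eq_bigr => L _ /=.
  rewrite -scaler_sumr -mulr_sumr -mulr_suml; congr (_ *: (_ * (_ * _))).
  rewrite (minor_laplace2 _ _ _ (qmat_rel_tr rt)); apply: eq_bigr => X _.
  by rewrite !(minor_tr _ _ rt).
refine (submod_sum _ mP _) => J _; refine (submod_sum _ mP _) => L _.
apply: (@submodZ _ _ _ _ mP _ (fun A t =>
  minor t c J.1 * (minor (ttr t) (enum J.2 ++ enum L.1) Z * minor t d L.2))).
  by apply: is_laurentM; apply: extv_laurent.
set u := enum J.2 ++ enum L.1.
case: (boolP (uniq u && (size u == #|Z|))) => [/andP[Uu /eqP sU]|Nu].
  have sU' : #|[set x in u]| = #|Z| by rewrite cardsE -sU; apply/card_uniqP.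
  have := HP _ _ _ (mnr_laurmon K c J.1) sU' (mnr_laurmon K d L.2).
  move/(submodZ mP (is_laurentX (winv u) (sgn_laurent K))).
  apply: (submod_eq mP) => A t rt.
  have := minor_sort (qmat_rel_tr rt) u Z; rewrite Uu => ->.
  by rewrite /eltZ /eltM /mnr (minor_tr _ _ rt) -scalerAl -scalerAr.
apply: (submod_eq mP _ (submod0 mP)) => A t rt; rewrite /elt0.
suff -> : minor (ttr t) u Z = 0 by rewrite mul0r mulr0.
move: Nu; rewrite negb_and => /orP[Nu|sU].
  by have := minor_sort (qmat_rel_tr rt) u Z; rewrite (negPf Nu).
by apply: minor_size; rewrite eq_sym.
Qed.

(* A violation of the tableau condition in row r is removed by q-antisymmetrizing the
   entries of X from row r on together with the first r + 1 entries of X'. *)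
Lemma garnir (P : elt -> Prop) (X Y X' Y' : {set 'I_n}) p a r x0 : submod laur P ->
  #|X| = p -> #|Y| = p -> #|X'| = a -> #|Y'| = a -> (r < a <= p)%N ->
  (nth x0 (enum X') r < nth x0 (enum X) r)%N ->
  (forall X1 X1' : {set 'I_n}, #|X1| = p -> #|X1'| = a -> (msum X1 < msum X)%N ->
     P (eltM (mnr (enum X1) Y) (mnr (enum X1') Y'))) ->
  (forall x (Z U : {set 'I_n}) e, laurmon r x -> #|Z| = p.+1 -> #|U| = p.+1 -> laurmon (a - r.+1) e ->
     P (eltM x (eltM (mnr (enum Z) U) e))) ->
  P (eltM (mnr (enum X) Y) (mnr (enum X') Y')).
Proof.
move=> mP sX sY sX' sY' /andP[ra ap] viol H1 H2.
have tr : transitive sli by move=> ? ? ?; apply: ltn_trans.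
pose c := take r (enum X); pose S := drop r (enum X).
pose d := take r.+1 (enum X'); pose e := drop r.+1 (enum X').
have SX := enum_sorted X; have SX' := enum_sorted X'.
have UX : uniq (enum X) := enum_uniq _; have UX' : uniq (enum X') := enum_uniq _.
have szX : size (enum X) = p by rewrite -cardE.
have szX' : size (enum X') = a by rewrite -cardE.
have rp : (r < p)%N := leq_trans ra ap.
pose b : nat := nth x0 (enum X) r.
have db (x : 'I_n) : x \in d -> (x < b)%N.
  move=> /(nthP x0)[i]; rewrite size_takel ?szX' // => ir <-.
  rewrite nth_take //; apply: leq_ltn_trans viol.
  move: ir; rewrite ltnS leq_eqVlt => /orP[/eqP -> //|ir]; apply: ltnW.
  by apply: (sorted_ltn_nth tr x0 SX'); rewrite ?inE ?szX' //; apply: ltn_trans ra.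
have Sb (x : 'I_n) : x \in S -> (b <= x)%N.
  move=> /(nthP x0)[i]; rewrite size_drop szX => ir <-; rewrite nth_drop.
  case: i ir => [|i] ir; first by rewrite addn0.
  apply: ltnW; apply: (sorted_ltn_nth tr x0 SX); rewrite ?inE ?szX //; lia.
have US : uniq S by rewrite drop_uniq.
have Ud : uniq d by rewrite take_uniq.
have dS : ~~ has (mem d) S.
  by apply/hasPn=> x xS; apply/negP=> /db xb; have := Sb x xS; rewrite leqNgt xb.
have dS' : ~~ has (mem S) d by rewrite has_sym.
have szd : size d = r.+1 by rewrite size_takel // szX'.
(* The violation at row r separates d from S, so Z has (p - r) + (r + 1) = p + 1 elements. *)
pose Z := [set x in S ++ d].
have sZ : #|Z| = p.+1.
  rewrite cardsE; have /card_uniqP -> : uniq (S ++ d) by rewrite cat_uniq US Ud dS'.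
  by rewrite size_cat szd size_drop szX addnS subnK // ltnW.
have SS : enum [set x in S] = S by apply/sorted_enum/(drop_sorted).
have Sd : enum [set x in d] = d by apply/sorted_enum/take_sorted.
have szc : size c = r by rewrite size_takel // szX ltnW.
have sze : size e = (a - r.+1)%N by rewrite size_drop szX'.
pose F (X1 : {set 'I_n} * {set 'I_n}) : elt := fun A t => extv K (enum X1.1 ++ enum X1.2) Z *:
       (minor t (c ++ enum X1.1) Y * minor t (enum X1.2 ++ e) Y').
have HS := @garnir_sum P c e Z Y Y' mP.
have {HS} PS : P (fun A t => \sum_X1 F X1 A t).
  apply: HS => x U z; rewrite szc sze sZ => Lx sU Lz; exact: H2.
(* The splitting M gives back the original product. Every other nonzero term replaces entries of S,
   all at least b, by smaller ones and so lowers [msum]. *)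
pose M := ([set x in S], [set x in d]).
have PR : P (fun A t => \sum_(X1 | X1 != M) F X1 A t).
  refine (submod_sum _ mP _) => -[X1 X2] NM.
  case: (eqVneq (extv K (enum X1 ++ enum X2) Z) 0) => [E0|/extv_supp[U12 Z12]].
    by apply: (submod_eq mP _ (submod0 mP)) => A t rt; rewrite /F /= E0 scale0r.
  apply: (@submodZ _ _ _ _ mP _ (eltM (mnr (c ++ enum X1) Y) (mnr (enum X2 ++ e) Y'))).
    exact: extv_laurent.
  case: (eqVneq (size (c ++ enum X1)) p) => [s1|s1]; last first.
    apply: (submod_eq mP _ (submod0 mP)) => A t rt; rewrite /eltM /mnr minor_size ?mul0r //.
    by rewrite sY eq_sym.
  apply: mnr_sort => // U1.
  have s1' : #|[set x in c ++ enum X1]| = p by rewrite cardsE -s1; apply/card_uniqP.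
  have sX1 : #|X1| = #|[set x in S]|.
    rewrite cardsE (card_uniqP US) size_drop szX.
    by rewrite -s1 size_cat szc -cardE addKn.
  have X1Z : X1 \subset [set x in d] :|: [set x in S].
    apply/subsetP=> x xX1; have : x \in Z by rewrite -Z12 inE mem_cat mem_enum xX1.
    by rewrite !inE mem_cat orbC.
  have X1S : X1 != [set x in S].
    apply: contra NM => /eqP X1S; rewrite /M X1S xpair_eqE eqxx /=; apply/eqP/setP=> x.
    have := congr1 (fun A0 : {set 'I_n} => x \in A0) Z12; rewrite X1S !inE !mem_cat !mem_enum inE.
    case: (boolP (x \in S)) => //= xS _.
    have -> : x \in d = false by apply/negbTE; apply: (hasPn dS).
    apply/negbTE; move: U12; rewrite cat_uniq X1S => /and3P[_ /hasPn h _].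
    by apply/negP=> xX2; have := h x; rewrite !mem_enum inE xX2 xS => /(_ isT).
  have lt1 : (msum [set x in c ++ enum X1] < msum X)%N.
    rewrite msum_seq //; have -> : X = [set x in c ++ S].
      by apply/setP=> x; rewrite inE cat_take_drop mem_enum.
    rewrite msum_seq; last by rewrite cat_take_drop.
    rewrite !big_cat /= ltn_add2l -[X in (_ < X)%N]msum_seq // big_enum.
    apply: (@msum_exchange X1 [set x in S] [set x in d] b) => // x; rewrite inE; [exact: db|exact: Sb].
  case: (eqVneq (size (enum X2 ++ e)) a) => [s2|s2]; last first.
    apply: (submod_eq mP _ (submod0 mP)) => A t rt.
    rewrite /eltM /mnr [minor t (enum X2 ++ e) Y']minor_size ?mulr0 //.
    by rewrite sY' eq_sym.
  have PP : submod laur (fun x => P (eltM (mnr (enum [set x in c ++ enum X1]) Y) x)).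
    exact: submod_mull.
  apply: (submod_eq PP) (@mnr_sort K n _ (enum X2 ++ e) Y' (@elt1 K n) PP _) => [A t _|U2].
    by rewrite /eltM /elt1 mulr1.
  have s2' : #|[set x in enum X2 ++ e]| = a by rewrite cardsE -s2; apply/card_uniqP.
  have := H1 _ _ s1' s2' lt1; apply: (submod_eq mP) => A t _.
  by rewrite /eltM /elt1 mulr1.
have Udd : uniq (S ++ d) by rewrite cat_uniq US Ud dS'.
have [k Ek] := extv_set Udd.
(* This is the inverse of the coefficient [s ^+ k] of the term M. *)
have Lk : laur ((- q) ^+ k) by apply/is_laurentX/is_laurentN/is_laurentq.
have LN : laur (-1) by apply/is_laurentN/is_laurentP/is_poly1.
apply: (submod_eq mP _ (submodZ mP Lk (submodD mP PS (submodZ mP LN PR)))) => A t rt.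
rewrite /eltZ /eltD (bigD1 M) //= scaleN1r addrK /F /= SS Sd -/Z in Ek *.
by rewrite Ek !cat_take_drop scalerA -exprMn divff ?oppr_eq0 ?qv_neq0 // expr1n scale1r.
Qed.

End Garnir.

(** * Identification of [qdet] with the recursive minor *)

Section Determinant.
Variables (K : fieldType) (n : nat).
Local Notation s := ((- qv K)^-1).
Local Notation sli := (fun x y : 'I_n => (x < y)%N).

Lemma inv_count_sum m (w : 'S_m) :
  inv_count w = (\sum_(i < m) \sum_(j < m) ((i < j) && (w j < w i)))%N.
Proof.
rewrite /inv_count -sum1_card pair_big_dep /= big_mkcond /=.
by apply: eq_bigr => -[i j] _; rewrite inE /=; case: ifP.
Qed.

Lemma sum_lt_ord m (w : 'S_m) k : (\sum_(j < m) (w j < k)%N)%N = minn k m.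
Proof.
rewrite (reindex_inj (@perm_inj _ w^-1)) /=.
under eq_bigr => j _ do rewrite permKV.
rewrite -(big_mkord xpredT (fun j => (j < k)%N : nat)).
elim: m {w} => [|m IHm]; first by rewrite big_geq // minn0.
by rewrite big_nat_recr //= IHm; lia.
Qed.

(** The leading value j is inverted with each of the j smaller values after it; the remaining
    positions keep the inversions of w. *)
Lemma inv_count_lift m (j : 'I_m.+1) (w : 'S_m) :
  inv_count (lift_perm ord0 j w) = (j + inv_count w)%N.
Proof.
rewrite !inv_count_sum big_ord_recl /= big_ord_recl ltnn add0n lift_perm_id.
congr (_ + _)%N.
  have E : minn j m = j by have := ltn_ord j; lia.
  rewrite -[RHS]E -(sum_lt_ord w); apply: eq_bigr => k _; rewrite lift_perm_lift /=.
  by congr nat_of_bool; rewrite /bump; case: leqP => h; lia.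
apply: eq_bigr => i _; rewrite big_ord_recl ltn0 add0n; apply: eq_bigr => k _.
rewrite !lift_perm_lift /=; congr nat_of_bool; rewrite ltnS; congr (_ && _).
by rewrite /bump; do 2!case: leqP => ?; lia.
Qed.

Variables (A : algType (Kq K)) (t : 'I_n -> 'I_n -> A).

Lemma det_minor m (a b : 'I_m -> 'I_n) : {homo b : i j / (i < j)%N} ->
  \sum_(w : 'S_m) s ^+ inv_count w *: \prod_(k < m) t (a k) (b (w k))
  = minor t [seq a k | k <- enum 'I_m] [set b k | k : 'I_m].
Proof.
elim: m a b => [|m IHm] a b bH.
  have E (w : 'S_0) : w = 1%g by apply/permP=> -[].
  rewrite (big_pred1 1%g) => [|w]; last by rewrite (E w) /= eqxx.
  have -> : enum 'I_0 = [::] by apply: size0nil; rewrite -cardE card_ord.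
  have -> : [set b k | k : 'I_0] = set0 by apply/setP=> x; rewrite inE; apply/imsetP=> -[[]].
  rewrite big_ord0 inv_count_sum big_ord0 expr0 scale1r /=.
  by rewrite eqxx.
have bI : injective b.
  move=> i j E; apply/val_inj; case: (ltngtP i j) => // /bH; rewrite E ltnn //.
rewrite enum_ordSl /= -map_comp big_imset /=; last by move=> i j _ _; apply: bI.
have lI : injective (fun x : 'I_m.+1 * 'S_m => lift_perm ord0 x.1 x.2).
  move=> [j w] [j' w'] /= E.
  have jj : j = j' by have := congr1 (fun f : 'S_m.+1 => f ord0) E; rewrite !lift_perm_id.
  congr (_, _) => //; apply/permP=> k; apply: (@lift_inj _ j).
  have := congr1 (fun f : 'S_m.+1 => f (lift ord0 k)) E.
  by rewrite !lift_perm_lift -jj.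
have lB : bijective (fun x : 'I_m.+1 * 'S_m => lift_perm ord0 x.1 x.2).
  by apply: inj_card_bij => //; rewrite card_prod !card_Sn card_ord factS.
rewrite (reindex _ (onW_bij _ lB)) /=.
rewrite -(pair_big xpredT xpredT (fun j (w : 'S_m) => s ^+ inv_count (lift_perm ord0 j w) *:
   \prod_(k < m.+1) t (a k) (b (lift_perm ord0 j w k)))) /=.
apply: eq_bigr => j _.
have -> : ltc [set b k | k : 'I_m.+1] (b j) = j.
  rewrite /ltc; transitivity #|[set i : 'I_m.+1 | (i < j)%N]|.
    rewrite -(card_imset _ bI); apply: eq_card => x; rewrite !inE.
    apply/andP/imsetP => [[/imsetP[i _ ->] bij]|[i]].
      exists i => //; rewrite inE; case: (ltngtP i j) => // [/bH|/val_inj E].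
        by rewrite ltnNge (ltnW bij).
      by rewrite E ltnn in bij.
    by rewrite inE => /bH bij ->; split=> //; apply: imset_f.
  transitivity (\sum_(i < m.+1) ((1%g : 'S_m.+1) i < j)%N)%N; last first.
    by rewrite sum_lt_ord; have := ltn_ord j; lia.
  rewrite -sum1_card big_mkcond; apply: eq_bigr => i _; rewrite inE perm1.
  by case: ltnP.
have -> : [set b k | k : 'I_m.+1] :\ b j = [set b (lift j k) | k : 'I_m].
  apply/setP=> x; rewrite !inE; apply/andP/imsetP => [[xj /imsetP[i _ xi]]|[k _ ->]].
    have ji : j != i by apply: contra xj => /eqP ->; rewrite xi.
    by have [k ik _] := unlift_some ji; exists k; rewrite // -ik.
  rewrite (inj_eq bI) eq_sym neq_lift; split=> //; exact: imset_f.
rewrite -(IHm (fun k => a (lift ord0 k)) (fun k => b (lift j k))); last first.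
  by move=> x y xy; apply: bH; rewrite /= /bump; case: (leqP j x) => ?; case: (leqP j y) => ?; lia.
rewrite mulr_sumr scaler_sumr.
apply: eq_bigr => w _.
rewrite inv_count_lift exprD big_ord_recl lift_perm_id -scalerA -scalerAr.
congr (_ *: (_ *: (_ * _))); apply: eq_bigr => k _; by rewrite lift_perm_lift.
Qed.

Lemma qdet_minor I J : size I = size J -> sorted sli J ->
  qdet t I J = minor t I [set x in J].
Proof.
move=> sIJ SJ; have tr : transitive sli by move=> ? ? ?; apply: ltn_trans.
pose a (k : 'I_(size I)) := tnth (in_tuple I) k.
pose b (k : 'I_(size I)) := nth (a k) J k.
(* The default value inside [qdet] varies with the row; as I and J have equal size, it can be
   changed freely. *)
have bE (k k' : 'I_(size I)) : b k = nth (a k') J k by apply: set_nth_default; rewrite -sIJ.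
transitivity (minor t [seq a k | k <- enum 'I_(size I)] [set b k | k : 'I_(size I)]).
  rewrite -det_minor; last first.
    move=> i j ij; rewrite (bE j i).
    by apply: (sorted_ltn_nth tr (a i) SJ) => //; rewrite inE -sIJ.
  apply: eq_bigr => w _; congr (_ *: _); apply: eq_bigr => k _; congr (t _ _).
  by rewrite (bE (w k) k).
congr (minor t _ _); first exact: map_tnth_enum (in_tuple I).
apply/setP=> x; rewrite inE; apply/imsetP/(nthP x) => [[k _ ->]|[k kJ <-]].
  by exists k; rewrite -?sIJ //; apply: set_nth_default; rewrite -sIJ.
by rewrite -sIJ in kJ; exists (Ordinal kJ) => //; apply: set_nth_default; rewrite -sIJ.
Qed.

End Determinant.

(** * Bitableaux modulo q *)

Section Bitableaux.
Variables (K : fieldType) (n : nat).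
Local Notation q := (qv K).
Local Notation s := ((- qv K)^-1).
Local Notation word := (seq 'I_n).
Local Notation elt := (qelem K n).
Local Notation gen := (@gen K n).
Local Notation mon := (@mon K n).
Local Notation qpm := (@qpm K n).
Local Notation cong := (@cong K n).
Local Notation polymon := (@polymon K n).
Local Notation sli := (fun x y : 'I_n => (x < y)%N).
Local Notation lei := (fun x y : 'I_n => (x <= y)%N).

Definition gtc (Y : {set 'I_n}) (j : 'I_n) : nat := #|[set y in Y | (j < y)%N]|.

Lemma ltc_gtc (Y : {set 'I_n}) j : j \in Y -> (ltc Y j + gtc Y j).+1 = #|Y|.
Proof.
move=> jY; rewrite (cardsD1 j Y) jY add1n -(cardsID [set y : 'I_n | (y < j)%N] (Y :\ j)).
congr (_ + _).+1; apply: eq_card => y; rewrite !inE.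
  by case: (eqVneq y j) => [->|]; rewrite ?ltnn ?andbF.
case: (ltngtP y j) => [yj|yj|/val_inj ->]; rewrite ?eqxx ?andbF ?andbT //=.
by case: eqP => // E; rewrite E ltnn in yj.
Qed.

(* The minor expanded with its rows in decreasing order, which has coefficients in K[q]. *)
Fixpoint rminor (A : algType (Kq K)) (t : 'I_n -> 'I_n -> A) (w : word) (Y : {set 'I_n}) : A :=
  if w is i :: w' then \sum_(j in Y) (- q) ^+ gtc Y j *: (t i j * rminor t w' (Y :\ j))
  else (Y == set0)%:R.

Definition rmnr w Y : elt := fun A t => rminor t w Y.

Lemma rmnr_polymon w Y : polymon (size w) (rmnr w Y).
Proof.
elim: w Y => [|i w IHw] Y /=.
  case: (eqVneq Y set0) => Y0.
    by apply: (span_eq _ (span_mon1 _ _)) => A t _; rewrite /rmnr /= Y0 eqxx.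
  by apply: (span_eq _ (span0 _ _)) => A t _; rewrite /rmnr /= (negPf Y0).
refine (submod_sum _ (span_submod _ _) _) => j _.
apply: (@spanZ _ _ _ _ _ (eltM (gen i j) (rmnr w (Y :\ j)))).
  exact/is_polyX/is_polyN/is_polyq.
by rewrite -add1n; exact: (span_mon_mul (span_gen_mon _ i j) (IHw (Y :\ j))).
Qed.

(** Here N m is m(m-1)/2. Reversing the rows multiplies the minor by [s ^+ N m]. Since [ltc] and
    [gtc] add up to the number of other columns, trading one for the other throughout the expansion
    costs [(- q) ^+ N m], and the two factors cancel. *)
Lemma minor_rminor (A : algType (Kq K)) (t : 'I_n -> 'I_n -> A) (c : word) (Y : {set 'I_n}) :
  qmat_rel t -> sorted sli c -> #|Y| = size c -> minor t c Y = rminor t (rev c) Y.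
Proof.
pose N m := iteri m addn 0%N.
have NS m : N m.+1 = (m + N m)%N by [].
have q0 : (- q) != 0 by rewrite oppr_eq0 qv_neq0.
have rE : forall (w : word) (Z : {set 'I_n}), #|Z| = size w ->
    rminor t w Z = (- q) ^+ N (size w) *: minor t w Z.
  elim=> [|i w IHw] Z sZ; first by rewrite scale1r.
  rewrite [size _]/= NS /= scaler_sumr; apply: eq_bigr => j jZ.
  rewrite IHw; last by move: sZ; rewrite (cardsD1 j) jZ => -[].
  rewrite -scalerAr !scalerA; congr (_ *: _).
  have := ltc_gtc jZ; rewrite sZ => -[<-].
  have E : s ^+ ltc Z j * (- q) ^+ ltc Z j = 1 by rewrite -exprMn mulVf // expr1n.
  rewrite !exprD -[LHS]mul1r -E; move: (s ^+ _) ((- q) ^+ _) ((- q) ^+ _) ((- q) ^+ _) => a b c' d.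
  by ring.
move=> rt Sc sY; rewrite rE ?size_rev //.
have Ec : [set x in rev c] = [set x in c] by apply/setP=> x; rewrite !inE mem_rev.
have := minor_sort rt (rev c) Y; rewrite rev_uniq sli_uniq // Ec sorted_enum // => ->.
have -> : winv (rev c) = N (size c).
  elim/last_ind: c Sc {sY Ec} => // c x IHc Sc; rewrite rev_rcons size_rcons NS /= IHc.
    congr (_ + _)%N; apply/eqP; rewrite -[X in _ == X]size_rev -all_count all_rev.
    have tr : transitive sli by move=> ? ? ?; apply: ltn_trans.
    apply/allP=> y yc; move: Sc; rewrite -cats1 sorted_pairwise // pairwise_cat.
    by case/and3P=> /allrelP/(_ y x yc (mem_head _ _)).
  by move: Sc; rewrite -cats1 => /cat_sorted2[].
by rewrite scalerA -exprMn divff // expr1n scale1r.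
Qed.

Lemma set_max (Z : {set 'I_n}) : Z != set0 ->
  exists2 x, x \in Z & forall z : 'I_n, z \in Z -> (z <= x)%N.
Proof. by case/set0Pn=> z zZ; case: (arg_maxnP val zZ) => x xZ xmax; exists x. Qed.

Lemma enum_max (Z : {set 'I_n}) x : x \in Z -> (forall z : 'I_n, z \in Z -> (z <= x)%N) ->
  enum Z = rcons (enum (Z :\ x)) x.
Proof.
have tr : transitive sli by move=> ? ? ?; apply: ltn_trans.
move=> xZ xmax; apply: sli_eq; first exact: enum_sorted.
  rewrite -cats1 sorted_pairwise // pairwise_cat /= !andbT -sorted_pairwise //.
  rewrite enum_sorted andbT; apply/allrelP=> y z; rewrite mem_enum !inE => /andP[yx /xmax].
  rewrite leq_eqVlt => /orP[/eqP/val_inj xy|yx' /eqP -> //].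
  by rewrite xy eqxx in yx.
by move=> y; rewrite mem_rcons !(mem_enum, inE); case: eqP => // ->.
Qed.

(** At each step of the expansion the largest remaining column has coefficient 1 and all others
    carry a positive power of q. The surviving term takes the columns in decreasing order. *)
Lemma cong_rmnr w (Y : {set 'I_n}) : #|Y| = size w ->
  cong (size w) (rmnr w Y) (mon w (rev (enum Y))).
Proof.
elim: w Y => [|i w IHw] Y sY.
  have -> : Y = set0 by apply/eqP; rewrite -cards_eq0 sY.
  by apply: cong_refl => A t _; rewrite /rmnr /mon /= eqxx enum_set0 qmonomial_nil.
have Y0 : Y != set0 by rewrite -cards_eq0 sY.
have [y yY ymax] := set_max Y0.
have sY1 : #|Y :\ y| = size w by move: sY; rewrite (cardsD1 y) yY => -[].
have g0 : gtc Y y = 0%N.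
  apply: eq_card0 => z; rewrite !inE; apply/negbTE; rewrite negb_and.
  by case: (boolP (z \in Y)) => //= /ymax; rewrite -leqNgt.
rewrite (enum_max yY ymax) rev_rcons.
have mP := @qpm_submod K n (size (i :: w)).
pose R : elt := fun A t => \sum_(j in Y | j != y) (- q) ^+ gtc Y j *: (t i j * rminor t w (Y :\ j)).
have QR : qpm (size (i :: w)) R.
  refine (submod_sum _ mP _) => j /andP[jY jy].
  have : (0 < gtc Y j)%N.
    rewrite card_gt0; apply/set0Pn; exists y; rewrite inE yY /= ltn_neqAle ymax // andbT.
    by apply: contra jy => /eqP/val_inj ->.
  case: (gtc Y j) => // g _.
  exists (eltZ (- (- q) ^+ g) (eltM (gen i j) (rmnr w (Y :\ j)))).
    apply: spanZ; first exact/is_polyN/is_polyX/is_polyN/is_polyq.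
    by rewrite /= -add1n; exact: (span_mon_mul (span_gen_mon _ i j) (rmnr_polymon w (Y :\ j))).
  by move=> A t _; rewrite /eltZ /eltM scalerA exprS mulrN mulNr.
have QM : qpm (size (i :: w)) (eltM (gen i y) (eltB (rmnr w (Y :\ y)) (mon w (rev (enum (Y :\ y)))))).
  by rewrite /= -add1n; apply: qpm_mull (IHw _ sY1); exact: span_gen_mon.
apply: (submod_eq mP _ (submodD mP QM QR)) => A t _.
have E : rminor t (i :: w) Y = t i y * rminor t w (Y :\ y) + R A t.
  by rewrite /= (bigD1 y) //= g0 expr0 scale1r.
by rewrite /eltB /eltD /eltM /rmnr E /mon qmonomial_cons mulrBr addrAC.
Qed.

Definition tailT (T : tableau n) : tableau n := map behead T.
(* A tableau in which empty rows are allowed. *)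
Definition wtab (T : tableau n) := all (sorted lei) T && sorted (@row_below n) T.

Lemma is_tab_wtab T : is_tab T -> wtab T.
Proof.
by case/andP=> aT ST; rewrite /wtab ST andbT; apply: sub_all aT => r /andP[].
Qed.

Lemma shape_tail (T T' : tableau n) : shape T = shape T' -> shape (tailT T) = shape (tailT T').
Proof.
elim: T T' => [|r T IHT] [|r' T'] //= [sr /IHT ->].
by rewrite !size_behead sr.
Qed.

Lemma size_rwordE (T : tableau n) : size (rword T) = sumn (shape T).
Proof. by elim: T => //= r T IHT; rewrite rword_cons size_cat IHT addnC. Qed.

Lemma is_tab_head (T : tableau n) : is_tab T -> all (fun r => size r <= size (head [::] T))%N T.
Proof.
case/andP=> _; case: T => //= r T; elim: T r => [|r' T IHT] r /=; first by rewrite leqnn.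
case/andP=> rr /IHT /andP[_ h]; rewrite leqnn; have rr' : (size r' <= size r)%N by case/andP: rr.
by rewrite rr'; apply: sub_all h => u /leq_trans; apply.
Qed.

Lemma wtab_tail T : wtab T -> wtab (tailT T).
Proof.
case/andP=> aT ST; apply/andP; split.
  by rewrite all_map; apply: sub_all aT => -[|x r] //= /path_sorted.
have E : {homo behead : r1 r2 / @row_below n r1 r2}.
  move=> [|x1 r1] [|x2 r2] //=; rewrite /row_below //=.
    by case: r1.
  by rewrite ltnS => /and3P[-> _ ->].
exact: homo_sorted ST.
Qed.

Lemma column_tail T k : column T k.+1 = column (tailT T) k.
Proof. by rewrite /column /tailT; elim: T => //= r T ->; case: r => [|x r]; case: k. Qed.

Lemma size_column (T T' : tableau n) k : shape T = shape T' -> size (column T k) = size (column T' k).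
Proof.
elim: T T' => [|r T IH] [|r' T'] //= [sr /IH].
rewrite /column /=; have E : isSome (onth r k) = isSome (onth r' k).
  by elim: r r' k sr {IH} => [|x r IHr] [|x' r'] [|k] //= [] /IHr; apply.
by case: (onth r k) (onth r' k) E => [x|] [x'|] //= _ ->.
Qed.

Lemma sorted_column0 T : wtab T -> sorted sli (column T 0).
Proof.
rewrite /wtab => /andP[_]; elim: T => // -[|x r] T IH ST.
  rewrite /column /=; exact: (IH (path_sorted ST)).
have := IH (path_sorted ST); rewrite /column /=.
case: T ST {IH} => //= -[|y r'] T /andP[] /=; last first.
  by rewrite /row_below /= => /and3P[_ -> _] _ ->.
move=> _ ST _; suff -> : pmap (fun r0 : word => onth r0 0) T = [::] by [].
by elim: T ST => //= -[|z u] T IH /andP[]; rewrite /row_below.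
Qed.

(** The number of factors is a parameter so that an induction can strip columns; columns beyond the
    last are empty and contribute the factor 1. *)
Definition bprod m (T T' : tableau n) : elt :=
  fun A t => \prod_(k < m) qdet t (column T k) (column T' k).

Lemma bprodS m T T' : eqz (bprod m.+1 T T')
  (eltM (fun A t => qdet t (column T 0) (column T' 0)) (bprod m (tailT T) (tailT T'))).
Proof.
move=> A t _; rewrite /bprod /eltM big_ord_recl; congr (_ * _).
by apply: eq_bigr => k _; rewrite !column_tail.
Qed.

Definition hdtl (r : word) := if r is x :: r' then Some (x, r') else None.

Lemma cong_bprod m T T' : wtab T -> wtab T' -> shape T = shape T' ->
  all (fun r => size r <= m)%N T ->
  polymon (sumn (shape T)) (bprod m T T') /\
  cong (sumn (shape T)) (bprod m T T') (mon (rword T) (rword T')).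
Proof.
elim: m T T' => [|m IHm] T T' wT wT' sh Tm.
  have E U : all (fun r : word => size r <= 0)%N U -> (rword U = [::]) * (sumn (shape U) = 0%N).
    by elim: U => [|[] U IH] //= /IH[IH1 IH2]; rewrite rword_cons IH1 IH2.
  have T'm : all (fun r : word => size r <= 0)%N T'.
    by have := Tm; rewrite -!(all_map size (fun k => k <= 0)%N) -/(shape _) sh.
  rewrite !E //.
  have B1 : eqz (@elt1 K n) (bprod 0 T T') by move=> A t _; rewrite /bprod big_ord0.
  split; first exact: span_eq B1 (span_mon1 _ _).
  by apply: cong_refl => A t rt; rewrite -(B1 A t rt) /mon qmonomial_nil.
have shD := shape_tail sh.
have Tm' : all (fun r => size r <= m)%N (tailT T).
  rewrite all_map; apply: sub_all Tm => r /=; rewrite size_behead; lia.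
have [PB CB] := IHm _ _ (wtab_tail wT) (wtab_tail wT') shD Tm'.
have sC := size_column 0 sh.
have Sc := sorted_column0 wT; have Sc' := sorted_column0 wT'.
set c := column T 0 in sC Sc *; set c' := column T' 0 in sC Sc' *.
have sY : #|[set x in c']| = size c.
  by rewrite cardsE sC; apply/card_uniqP/sli_uniq.
have QE : eqz (rmnr (rev c) [set x in c']) (fun A t => qdet t c c').
  by move=> A t rt; rewrite /rmnr qdet_minor // (minor_rminor rt).
have QP : polymon (size c) (fun A t => qdet t c c').
  by apply: (span_eq QE); have := rmnr_polymon (rev c) [set x in c']; rewrite size_rev.
have QC : cong (size c) (fun A t => qdet t c c') (mon (rev c) (rev c')).
  have := @cong_rmnr (rev c) [set x in c']; rewrite size_rev sorted_enum // => /(_ sY).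
  by apply: cong_trans; apply: cong_refl => A t rt; rewrite -QE.
have sE : sumn (shape T) = (size c + sumn (shape (tailT T)))%N.
  rewrite /c; elim: (T) => //= r U IH; rewrite IH /column /=.
  by case: r => [|x r] /=; lia.
rewrite sE; split.
  apply: (span_eq (x := eltM (fun A t => qdet t c c') (bprod m (tailT T) (tailT T')))).
    by move=> A t rt; rewrite (bprodS m T T' rt).
  exact: span_mon_mul.
apply: cong_trans (cong_refl _ (bprodS m T T')) _.
have sw' : sumn (shape (tailT T')) = sumn (shape (tailT T)) by rewrite shD.
apply: cong_trans (cong_mul QP _ QC CB) _.
  by apply: span_mon; rewrite size_rwordE.
(* The rows from top to bottom, cut as [cong_strip] expects; rows emptied by stripping columns are
   skipped. *)
pose z (U : tableau n) := rev (pmap hdtl U).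
have zf U : map fst (z U) = rev (column U 0).
  rewrite /z map_rev; congr rev; rewrite /column.
  by elim: U => //= -[|x r] U /= IH; rewrite ?IH //= IH.
have zs U : flatten (map snd (z U)) = rword (tailT U).
  rewrite /z /rword map_rev; elim: U => //= -[|x r] U /=; rewrite !rev_cons -!cats1 !flatten_cat /=.
    by rewrite !cats0.
  by move=> ->.
have za U : flatten [seq p.1 :: p.2 | p <- z U] = rword U.
  rewrite /z /rword map_rev; elim: U => //= -[|x r] U /=; rewrite !rev_cons -!cats1 !flatten_cat /=.
    by rewrite !cats0.
  by move=> ->.
have := @cong_strip K n (z T) (z T'); rewrite !zf !zs !za.
have -> : size (rword T) = (size c + sumn (shape (tailT T)))%N by rewrite size_rwordE.
move=> H; apply: cong_trans (H _ _ _ _ _).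
- by apply: cong_refl => A t _; rewrite /eltM /mon qmonomial_cat // !size_rev.
- rewrite /z !map_rev; congr rev.
  elim: T T' sh {wT wT' Tm shD Tm' PB CB c c' sC Sc Sc' sY QE QP QC sE sw' H} => [|r T IH] [|r' T'] //= [sr /IH].
  by case: r r' sr => [|x r] [|x' r'] //= [->] ->.
- by rewrite rev_sorted.
- by rewrite rev_sorted.
- rewrite /z all_rev; case/andP: wT => aT _; elim: (T) aT => //= -[|x r] U IH //= /andP[pr /IH].
  by rewrite /= pr.
- rewrite /z all_rev; case/andP: wT' => aT _; elim: (T') aT => //= -[|x r] U IH //= /andP[pr /IH].
  by rewrite /= pr.
Qed.

Definition bitz (T T' : tableau n) : elt := fun A t => bitab t T T'.

Lemma cong_bitz T T' : is_tab T -> is_tab T' -> shape T = shape T' ->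
  polymon (sumn (shape T)) (bitz T T') /\
  cong (sumn (shape T)) (bitz T T') (mon (rword T) (rword T')).
Proof.
by move=> tT tT' sh; apply: cong_bprod; rewrite ?is_tab_wtab ?is_tab_head.
Qed.

End Bitableaux.

(** * Straightening over Laurent polynomials *)

Section Straightening.
Variables (K : fieldType) (n : nat).
Local Notation word := (seq 'I_n).
Local Notation elt := (qelem K n).
Local Notation mnr := (@mnr K n).
Local Notation mon := (@mon K n).
Local Notation laurmon := (@laurmon K n).
Local Notation laur := (@is_laurent K).
Local Notation bitz := (@bitz K n).
Local Notation bprod := (@bprod K n).
Local Notation sli := (fun x y : 'I_n => (x < y)%N).

(** Rows of T beyond the length of c are lost, whence the bounds on [size T] below. *)
Fixpoint addcol (c : word) (T : tableau n) : tableau n :=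
  if c is x :: c' then (x :: head [::] T) :: addcol c' (behead T) else [::].

Fixpoint colle (c : word) (T : tableau n) {struct T} : bool :=
  if T is r :: T' then if c is x :: c' then (x <= head x r)%N && colle c' T' else false
  else true.

Lemma shape_addcol c c' T T' : size c = size c' -> shape T = shape T' ->
  shape (addcol c T) = shape (addcol c' T').
Proof.
elim: c c' T T' => [|x c IHc] [|x' c'] T T' //= [sc] sh.
rewrite (IHc c' (behead T) (behead T')) //.
  by case: T T' sh => [|r T] [|r' T'] //= [->].
by case: T T' sh => [|r T] [|r' T'] //= [].
Qed.

Lemma sumn_addcol c T : (size T <= size c)%N ->
  sumn (shape (addcol c T)) = (size c + sumn (shape T))%N.
Proof.
elim: c T => [|x c IHc] [|r T] //=; rewrite ?ltnS => sT; rewrite IHc //=; lia.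
Qed.

Lemma tail_addcol m c T c' T' : (size T <= size c)%N -> (size T' <= size c')%N ->
  eqz (bprod m (tailT (addcol c T)) (tailT (addcol c' T'))) (bprod m T T').
Proof.
have E c0 T0 k : (size T0 <= size c0)%N -> column (tailT (addcol c0 T0)) k = column T0 k.
  rewrite /column; elim: c0 T0 => [|x c0 IHc] [|r T0] //=; rewrite ?ltnS => sT.
    by have := IHc [::] isT; rewrite /= => ->; case: (k).
  by rewrite IHc.
by move=> sT sT' A t _; rewrite /bprod; apply: eq_bigr => k _; rewrite !E.
Qed.

Lemma column_addcol c T : column (addcol c T) 0 = c.
Proof. by rewrite /column; elim: c T => //= x c IHc T; rewrite IHc. Qed.

Lemma bitz_addcol c T c' T' : size c = size c' -> (0 < size c)%N ->
  (size T <= size c)%N -> shape T = shape T' ->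
  eqz (bitz (addcol c T) (addcol c' T')) (eltM (fun A t => qdet t c c') (bitz T T')).
Proof.
move=> sc c0 sT sh A t rt.
have -> : bitz (addcol c T) (addcol c' T') t
    = bprod (size (head [::] T)).+1 (addcol c T) (addcol c' T') t by case: c sc c0 sT.
rewrite (bprodS _ _ _ rt) /eltM !column_addcol (tail_addcol _ _ _ rt) //.
by rewrite -[size T'](size_map size) -/(shape _) -sh size_map -sc.
Qed.

Lemma addcol_tab c T : sorted sli c -> is_tab T -> colle c T -> is_tab (addcol c T).
Proof.
elim: c T => [|x c IHc] T //= Sc tT cT.
have tT' : is_tab (behead T).
  by case: T tT {cT} => //= r T /andP[/= /andP[_ aT] /path_sorted ST]; rewrite /is_tab aT.
have cT' : colle c (behead T) by case: T cT {tT tT'} => [|r T] /=; [case: (c) | case/andP].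
have := IHc (behead T) (path_sorted Sc) tT' cT'.
rewrite /is_tab /= => /andP[-> Sa]; rewrite andbT; apply/andP; split.
  case: T tT cT {tT' cT' Sa} => //= r T /andP[/= /andP[/andP[r0 Sr] _] _] /andP[xr _].
  by case: r r0 Sr xr => //= z r _ -> ->.
case: c Sc {IHc cT' cT} Sa => //= y c /andP[xy Sc] Sa; rewrite Sa andbT.
rewrite row_below_cons xy /=.
case: T tT {tT' Sa} => //= r T /andP[_ /=]; case: T => [|r' T] /=; last by case/andP.
by case: (r).
Qed.

Lemma colle_viol c T x0 : is_tab T -> (size T <= size c)%N -> ~~ colle c T ->
  exists2 r, (r < size T)%N & (nth x0 (column T 0) r < nth x0 c r)%N.
Proof.
move=> /andP[aT _]; elim: T c aT => [|r T IHT] [|x c] //= /andP[/andP[r0 _] aT].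
rewrite ltnS => sT; rewrite negb_and; case: r r0 => //= y r _.
rewrite -ltnNge /column /= => /orP[yx|/(IHT c aT sT)[k kT h]]; first by exists 0%N.
by exists k.+1.
Qed.

Lemma size_column0 (T : tableau n) : is_tab T -> size (column T 0) = size T.
Proof.
by case/andP=> aT _; elim: T aT => //= -[|x r] T IHT //= /andP[_ /IHT <-].
Qed.

Definition bitG k (z : elt) := exists T T' : tableau n,
  [/\ is_tab T, is_tab T', shape T = shape T', sumn (shape T) = k & z = bitz T T'].

Local Notation LR k := (zspan laur (bitG k)).

Lemma poly_laurmon k x : polymon k x -> laurmon k x.
Proof.
move: x; apply: span_min => [|g Gg]; last exact: span_gen.
split; [exact: span0 | exact: spanD | | exact: span_eq].
by move=> c x cP; apply: spanZ; apply: is_laurentP.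
Qed.

Lemma bitz_split T T' : is_tab T -> is_tab T' -> shape T = shape T' -> T != [::] ->
  exists (X X' : {set 'I_n}) z, [/\ #|X| = size T, #|X'| = size T,
     enum X = column T 0 /\ enum X' = column T' 0,
     (size T <= sumn (shape T))%N /\ laurmon (sumn (shape T) - size T) z
   & eqz (bitz T T') (eltM (mnr (enum X) X') z)].
Proof.
move=> tT tT' sh T0.
have Sc := sorted_column0 (is_tab_wtab tT); have Sc' := sorted_column0 (is_tab_wtab tT').
have sT' : size T = size T' by rewrite -[LHS](size_map size) -/(shape _) sh size_map.
have sC' : size (column T' 0) = size T by rewrite size_column0.
have cd : #|[set x in column T' 0]| = size T.
  by rewrite cardsE -sC'; apply/card_uniqP/sli_uniq.
have head_max := is_tab_head tT.
have h0 : (0 < size (head [::] T))%N.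
  by case: (T) T0 tT => //= -[|x r] U.
have shD := shape_tail sh.
have sE : sumn (shape T) = (size T + sumn (shape (tailT T)))%N.
  by case/andP: tT => aT _; elim: (T) aT => //= -[|x r] U IH //= /andP[_ /IH ->]; lia.
exists [set x in column T 0], [set x in column T' 0],
  (bprod (size (head [::] T)).-1 (tailT T) (tailT T')).
split.
- by rewrite cardsE -(size_column0 tT); apply/card_uniqP/sli_uniq.
- by [].
- by rewrite !sorted_enum.
- rewrite sE leq_addr addKn; split=> //; apply: poly_laurmon.
  have tm : all (fun r => size r <= (size (head [::] T)).-1)%N (tailT T).
    by rewrite all_map; apply: sub_all head_max => r /=; rewrite size_behead; lia.
  by have [] := cong_bprod K (wtab_tail (is_tab_wtab tT)) (wtab_tail (is_tab_wtab tT')) shD tm.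
- move=> A t rt; have := bprodS (size (head [::] T)).-1 T T' rt; rewrite prednK // /eltM.
  by rewrite qdet_minor ?size_column0 // /mnr sorted_enum // => <-.
Qed.

Definition trz (x : elt) : elt := fun A t => x A (ttr t).

Lemma submod_tr (S : Kq K -> Prop) (P : elt -> Prop) : submod S P -> submod S (fun x => P (trz x)).
Proof.
case=> P0 PD PZ Peq; split=> // [x y Px Py|c x cS Px|x y xy Px].
- exact: (PD _ _ Px Py).
- exact: (PZ _ _ cS Px).
- by apply: Peq Px => A t rt; apply: xy; apply: qmat_rel_tr.
Qed.

Lemma laurmon_tr k x : laurmon k x -> laurmon k (trz x).
Proof.
move: x; apply: span_min; first exact/submod_tr/span_submod.
move=> _ [w [u [sw su ->]]]; apply: (span_eq _ (span_mon _ su sw)) => A t _.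
rewrite /trz /mon; elim: w u {sw su} => [|i w IHw] [|j u]; rewrite /qmonomial ?big_nil //=.
by rewrite !big_cons; congr (_ * _); apply: IHw.
Qed.

(* Downward induction on the length p of the first column, then on the sum of its
   entries; the Garnir correction terms contain a minor of size p + 1. *)
Lemma straighten_step k p (X Y : {set 'I_n}) z :
  (forall j, (j < k)%N -> forall w u, size w = j -> size u = j -> LR j (mon w u)) ->
  (0 < p <= k)%N -> #|X| = p -> #|Y| = p -> laurmon (k - p) z ->
  LR k (eltM (mnr (enum X) Y) z).
Proof.
move=> IHk; have mLR := span_submod laur (bitG k).
move: {2}(k - p)%N (erefl (k - p)%N) => d; move: p X Y z.
elim/ltn_ind: d => d IHd p X Y z dE /andP[p0 pk].
have {}IHd p' (X' Y' : {set 'I_n}) z' : (p < p' <= k)%N -> #|X'| = p' -> #|Y'| = p' -> laurmon (k - p') z' ->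
    LR k (eltM (mnr (enum X') Y') z').
  by case/andP=> pp pk'; apply: (IHd (k - p')%N); rewrite // ?pk' -?dE; lia.
move: {2}(msum X + msum Y)%N (erefl (msum X + msum Y)%N) => m; move: X Y z.
elim/ltn_ind: m => m IHm X Y z mE sX sY Lz.
move: z Lz; apply: span_min; first exact: submod_mull.
move=> _ [w [u [sw su ->]]].
have kp : (k - p < k)%N by lia.
(* By induction on the degree the right factor becomes a bitableau, so the only obstruction left
   lies between the columns X, Y and the first columns of T, T'. *)
move: (mon w u) (IHk _ kp w u sw su) => {w u sw su}; apply: span_min; first exact: submod_mull.
move=> _ [T [T' [tT tT' sh sk ->]]].
have sT' : size T = size T' by rewrite -[LHS](size_map size) -/(shape _) sh size_map.
case: (boolP [&& (size T <= p)%N, colle (enum X) T & colle (enum Y) T']) => [/and3P[sT cX cY]|std].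
  apply: (@span_eq _ _ _ _ (bitz (addcol (enum X) T) (addcol (enum Y) T'))).
    move=> A t rt; rewrite (bitz_addcol _ _ _ sh rt) -?cardE ?sX ?sY //.
    rewrite /eltM qdet_minor -?cardE ?sX ?sY ?enum_sorted //.
    by congr (minor t _ _ * _); apply/setP=> x; rewrite inE mem_enum.
  apply: span_gen; exists (addcol (enum X) T), (addcol (enum Y) T'); split=> //.
  - exact: addcol_tab (enum_sorted _) _ _.
  - exact: addcol_tab (enum_sorted _) _ _.
  - by apply: shape_addcol => //; rewrite -!cardE sX sY.
  - by rewrite sumn_addcol -cardE sX // sk; lia.
have T0 : T != [::] by case: (T) (T') sT' std => // -[].
have [X1 [Y1 [z [sX1 sY1 [EX EY] [sTk Lz] BE]]]] := bitz_split tT tT' sh T0.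
rewrite sk in sTk Lz.
apply: (@span_eq _ _ _ _ (eltM (mnr (enum X) Y) (eltM (mnr (enum X1) Y1) z))).
  by move=> A t rt; rewrite /eltM (BE A t rt).
have T0' : (0 < size T)%N by case: (T) T0.
(* If the right factor starts with a longer column, its minor is moved to the front, where the
   induction on the column length applies. *)
case: (leqP (size T) p) => [sTp|sTp]; last first.
  have LX : laurmon p (mnr (enum X) Y).
    by have := mnr_laurmon K (enum X) Y; rewrite -cardE sX.
  apply: (mon_mnr_swap mLR _ LX Lz sX1 sY1) => X2 Y2 e sX2 sY2.
  have -> : (p + (k - p - size T) = k - size T)%N by lia.
  by apply: IHd => //; lia.
have cor (c : elt) (Z U : {set 'I_n}) e r : (r < size T)%N ->
    laurmon r c -> #|Z| = p.+1 -> #|U| = p.+1 -> laurmon (size T - r.+1) e ->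
    LR k (eltM (eltM c (eltM (mnr (enum Z) U) e)) z).
  move=> rT Lc sZ sU Le; have Lez := span_mon_mul Le Lz.
  apply: (@span_eq _ _ _ _ (eltM c (eltM (mnr (enum Z) U) (eltM e z)))).
    by move=> A t _; rewrite /eltM !mulrA.
  apply: (mon_mnr_swap mLR _ Lc Lez sZ sU) => X2 Y2 e2 sX2 sY2.
  have -> : (r + (size T - r.+1 + (k - p - size T)) = k - p.+1)%N by lia.
  by apply: IHd => //; lia.
have step (X2 X2' Y2 Y2' : {set 'I_n}) : #|X2| = p -> #|Y2| = p ->
    #|X2'| = size T -> (msum X2 + msum Y2 < m)%N ->
    LR k (eltM (eltM (mnr (enum X2) Y2) (mnr (enum X2') Y2')) z).
  move=> sX2 sY2 sX2' ltm.
  apply: (@span_eq _ _ _ _ (eltM (mnr (enum X2) Y2) (eltM (mnr (enum X2') Y2') z))).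
    by move=> A t _; rewrite /eltM mulrA.
  apply: (IHm _ ltm) => //.
  have := span_mon_mul (mnr_laurmon K (enum X2') Y2') Lz; rewrite -cardE sX2'.
  by have -> : (size T + (k - p - size T) = k - p)%N by lia.
move: std; rewrite sTp /= negb_and => viol.
have [x0 _] : exists x0, x0 \in X by apply/set0Pn; rewrite -card_gt0 sX.
apply: (@span_eq _ _ _ _ (eltM (eltM (mnr (enum X) Y) (mnr (enum X1) Y1)) z)).
  by move=> A t _; rewrite /eltM mulrA.
case/orP: viol => viol.
  have [|r rT h] := @colle_viol (enum X) T x0 tT _ viol; first by rewrite -cardE sX.
  rewrite -EX in h.
  apply: (@garnir K n (fun x => LR k (eltM x z)) X Y X1 Y1 p (size T) r x0) => //.
  - exact: submod_mulr.
  - by rewrite rT sTp.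
  - by move=> X2 X2' sX2 sX2' lt; apply: step => //; rewrite -mE ltn_add2r.
  - by move=> x Z U e Lx sZ sU Le; apply: cor Lx sZ sU Le.
have [|r rT h] := @colle_viol (enum Y) T' x0 tT' _ viol.
  by rewrite -cardE sY -sT'.
rewrite -EY in h; rewrite -sT' in rT.
(* A violation among the column indices becomes one among the row indices after transposition, so
   the same Garnir relation serves. *)
pose P x := LR k (eltM (trz x) z).
have mP : submod laur P by apply: (@submod_tr laur (fun x => LR k (eltM x z))); apply: submod_mulr.
have trE (X2 Y2 X3 Y3 : {set 'I_n}) :
    eqz (eltM (trz (eltM (mnr (enum Y2) X2) (mnr (enum Y3) X3))) z)
        (eltM (eltM (mnr (enum X2) Y2) (mnr (enum X3) Y3)) z).
  by move=> A t rt; rewrite /eltM /trz /mnr !(minor_tr _ _ rt).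
apply: span_eq (trE _ _ _ _) _.
apply: (@garnir K n P Y X Y1 X1 p (size T) r x0) => //.
- by rewrite rT sTp.
- move=> Y2 Y2' sY2 sY2' lt; apply: (@span_eq _ _ _ _ (eltM (eltM (mnr (enum X) Y2) (mnr (enum X1) Y2')) z)).
    by move=> A t rt; rewrite (trE X Y2 X1 Y2' A t rt).
  by apply: step => //; rewrite -mE ltn_add2l.
- move=> x Z U e Lx sZ sU Le; have := cor _ U Z _ r rT (laurmon_tr Lx) sU sZ (laurmon_tr Le).
  apply: span_eq => A t rt; rewrite /P /eltM /trz /mnr.
  by rewrite (minor_tr _ _ rt).
Qed.

Lemma straightening k w u : size w = k -> size u = k -> LR k (mon w u).
Proof.
elim/ltn_ind: k w u => k IHk w u sw su.
case: w sw => [|i w] sw; case: u su => [|j u] su; try by rewrite -su in sw.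
  apply: (@span_eq _ _ _ _ (bitz [::] [::])).
    by move=> A t _; rewrite /bitz /bitab /= big_ord0 /mon qmonomial_nil.
  by apply: span_gen; exists [::], [::]; split=> //; rewrite -sw.
(* The first generator is a minor of size 1, the starting point p = 1 of [straighten_step]. *)
apply: (@span_eq _ _ _ _ (eltM (mnr (enum [set i]) [set j]) (mon w u))).
  move=> A t _; rewrite /eltM /mnr enum_set1 /= big_set1 /mon qmonomial_cons setDv eqxx mulr1.
  have -> : ltc [set j] j = 0%N by apply: eq_card0 => x; rewrite !inE; case: eqP => // ->; rewrite ltnn.
  by rewrite expr0 scale1r.
apply: (@straighten_step k 1); rewrite ?cards1 //; first by rewrite -sw.
by rewrite -sw subn1; apply: span_mon => //; move: su; rewrite -sw => -[].
Qed.

End Straightening.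

(** * Integrality *)

Section Integrality.
Variables (K : fieldType) (n : nat).
Local Notation q := (qv K).
Local Notation elt := (qelem K n).
Local Notation mon := (@mon K n).
Local Notation cong := (@cong K n).
Local Notation polymon := (@polymon K n).
Local Notation laur := (@is_laurent K).
Local Notation pol := (@is_poly K).
Local Notation bitz := (@bitz K n).
Local Notation LP k := (zspan pol (@bitG K n k)).

(** Asking for all m >= N lets bounds for different summands be combined. *)
Lemma clear_denominators G (x : elt) : zspan laur G x ->
  exists N, forall m, (N <= m)%N -> zspan pol G (eltZ (q ^+ m) x).
Proof.
move: x; apply: span_min; last first.
  move=> g Gg; exists 0%N => m _; apply: spanZ; last exact: span_gen.
  exact/is_polyX/is_polyq.
split.
- exists 0%N => m _; apply: (span_eq _ (span0 _ _)) => A t _.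
  by rewrite /eltZ /elt0 scaler0.
- move=> x y [N1 H1] [N2 H2]; exists (N1 + N2)%N => m mN.
  apply: (span_eq _ (spanD (H1 m _) (H2 m _))); try lia.
  by move=> A t _; rewrite /eltZ /eltD scalerDr.
- move=> c x [i ic] [N H]; exists (i + N)%N => m mN.
  apply: (span_eq _ (spanZ ic (H (m - i)%N _))); last lia.
  move=> A t _; rewrite /eltZ !scalerA mulrAC -exprD subnKC //.
  by apply: leq_trans mN; apply: leq_addr.
- move=> x y xy [N H]; exists N => m mN; apply: (span_eq _ (H m mN)) => A t rt.
  by rewrite /eltZ (xy _ _ rt).
Qed.

(** The maximum over the finitely many pairs of words of length k works for every monomial, hence
    for their K[q]-span. *)
Lemma polymon_denominator k : exists N, forall x, polymon k x -> LP k (eltZ (q ^+ N) x).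
Proof.
have H (wu : k.-tuple 'I_n * k.-tuple 'I_n) : exists N, forall m, (N <= m)%N ->
    LP k (eltZ (q ^+ m) (mon wu.1 wu.2)).
  by apply: clear_denominators; apply: straightening; rewrite size_tuple.
have [f Hf] := fin_all_exists H; exists (\max_wu f wu).
apply: span_min; first split.
- by apply: (span_eq _ (span0 _ _)) => A t _; rewrite /eltZ /elt0 scaler0.
- by move=> x y Hx Hy; apply: (span_eq _ (spanD Hx Hy)) => A t _; rewrite /eltZ /eltD scalerDr.
- move=> c x cP Hx; apply: (span_eq _ (spanZ cP Hx)) => A t _.
  by rewrite /eltZ !scalerA mulrC.
- by move=> x y xy Hx; apply: (span_eq _ Hx) => A t rt; rewrite /eltZ (xy _ _ rt).
move=> _ [w [u [sw su ->]]].
have Ew : size w == k by apply/eqP.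
have Eu : size u == k by apply/eqP.
by apply: (Hf (Tuple Ew, Tuple Eu)); apply: leq_bigmax.
Qed.

Definition RSbit (w u : seq 'I_n) : elt :=
  fun A t => if (RS w).2 == (RS u).2 then bitab t (RS w).1 (RS u).1 else 0.

Lemma sumn_RS (w : seq 'I_n) : sumn (shape (RS w).1) = size w.
Proof.
by elim/last_ind: w => // w x IHw; rewrite RS_rcons -size_rwordE size_rword_ins size_rwordE IHw size_rcons.
Qed.

Lemma RSbit_cong w u : size w = size u ->
  LP (size w) (RSbit w u) /\ cong (size w) (mon w u) (RSbit w u).
Proof.
move=> swu; have := cong_RS K swu; case: (eqVneq (RS w).2) => [QQ|QQ] H; last first.
  have E : eqz (@elt0 K n) (RSbit w u) by move=> A t _; rewrite /RSbit (negPf QQ).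
  split; first exact: span_eq E (span0 _ _).
  apply: (submod_eq (@qpm_submod K n _) _ H) => A t rt.
  by rewrite /eltB -(E A t rt) /elt0 subr0.
have sh : shape (RS w).1 = shape (RS u).1 by rewrite !RS_shape QQ.
have E : eqz (bitz (RS w).1 (RS u).1) (RSbit w u).
  by move=> A t _; rewrite /RSbit QQ eqxx.
split.
  apply: span_eq E (span_gen _ _); exists (RS w).1, (RS u).1.
  by split; rewrite ?RS_tab ?sumn_RS.
have [_] := cong_bitz K (RS_tab w) (RS_tab u) sh; rewrite sumn_RS => H1.
apply: cong_trans H _; apply: cong_trans (cong_sym H1) _.
exact: cong_refl.
Qed.

Lemma polymon_mod k x : polymon k x -> exists2 l, LP k l & cong k x l.
Proof.
have mP := @qpm_submod K n k.
move: x; apply: span_min; first split.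
- by exists (@elt0 K n); [exact: span0 | exact: cong_refl].
- move=> x y [l Ll xl] [l' Ll' yl]; exists (eltD l l'); first exact: spanD.
  apply: (submod_eq mP _ (submodD mP xl yl)) => A t _.
  by rewrite /eltD /eltB opprD addrACA.
- move=> c x cP [l Ll xl]; exists (eltZ c l); first exact: spanZ.
  by apply: (submod_eq mP _ (submodZ mP cP xl)) => A t _; rewrite /eltZ /eltB scalerBr.
- move=> x y xy [l Ll xl]; exists l => //.
  by apply: (submod_eq mP _ xl) => A t rt; rewrite /eltB (xy _ _ rt).
move=> _ [w [u [sw su ->]]]; have swu : size w = size u by rewrite sw.
by have [L C] := RSbit_cong swu; rewrite sw in L C; exists (RSbit w u).
Qed.

(* Iterating M = L + qM gives M = L + q^N M, and q^N M is contained in L for large N. *)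
Lemma polymon_bit k x : polymon k x -> LP k x.
Proof.
move=> Mx; have [N HN] := polymon_denominator k.
have [l Ll [z Mz E]] : exists2 l, LP k l & exists2 z, polymon k z &
    eqz x (eltD l (eltZ (q ^+ N) z)).
  elim: N {HN} => [|N [l Ll [z Mz E]]].
    exists (@elt0 K n); first exact: span0.
    by exists x => // A t _; rewrite /eltD /eltZ /elt0 add0r expr0 scale1r.
  have [l' Ll' [z' Mz' E']] := polymon_mod Mz.
  exists (eltD l (eltZ (q ^+ N) l')).
    by apply: spanD => //; apply: spanZ => //; apply/is_polyX/is_polyq.
  exists z' => // A t rt; rewrite (E _ _ rt) /eltD /eltZ.
  have /eqP := E' A t rt; rewrite /eltB subr_eq /eltZ => /eqP ->.
  by rewrite scalerDr scalerA -exprSr -addrA; congr (_ + _); rewrite addrC.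
apply: span_eq (spanD Ll (HN z Mz)) => A t rt.
by rewrite (E _ _ rt).
Qed.

Lemma LP_list k x : LP k x -> exists s : seq (tableau n * tableau n * {poly K}),
  all (fun e => [&& is_tab e.1.1, is_tab e.1.2 & shape e.1.1 == shape e.1.2]) s /\
  eqz x (fun A t => \sum_(e <- s) polyq e.2 *: bitab t e.1.1 e.1.2).
Proof.
move: x; apply: span_min; first split.
- by exists [::]; split=> // A t _; rewrite big_nil.
- move=> x y [l [al El]] [l' [al' El']]; exists (l ++ l'); rewrite all_cat al al'; split=> // A t rt.
  by rewrite big_cat /eltD (El _ _ rt) (El' _ _ rt).
- move=> c x [p ->] [l [al El]]; exists [seq (e.1, p * e.2) | e <- l].
  rewrite all_map; split=> [|A t rt]; first exact: sub_all al.
  rewrite big_map /eltZ (El _ _ rt) scaler_sumr; apply: eq_bigr => e _ /=.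
  by rewrite scalerA /polyq tofracM.
- by move=> x y xy [l [al El]]; exists l; split=> // A t rt; rewrite -(xy _ _ rt) (El _ _ rt).
move=> _ [T [T' [tT tT' sh _ ->]]]; exists [:: (T, T', 1)].
rewrite /= tT tT' sh eqxx; split=> // A t _.
by rewrite big_seq1 /= /polyq tofrac1 scale1r.
Qed.

End Integrality.

Theorem theorem1p1 (K : fieldType) (charK : [pchar K] =i pred0)
  (n : nat) (n_ge1 : (0 < n)%N) (w u : seq 'I_n) (size_wu : size w = size u) :
  congr_qL
    (fun A t => qmonomial t w u)
    (fun A t => if (RS w).2 == (RS u).2 then bitab (K:=K) t (RS w).1 (RS u).1 else 0).
Proof.
(* The difference of the two sides is q z with z in M, and M = L writes z as a K[q]-combination of
   bitableaux. *)
have [_ [z Mz E]] := RSbit_cong K size_wu.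
have [l [al El]] := LP_list (polymon_bit Mz).
exists l; split=> // A t rt.
have := E A t rt; rewrite /eltB /mon /RSbit => ->.
rewrite /eltZ (El A t rt) scaler_sumr; apply: eq_bigr => e _.
by rewrite scalerA.
Qed.
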